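(* For every integer $p\geqslant 4$, $(n^{p-1},n)$ is a filling pair for both $G_{p,p}$ and $G_{p,p-1}$.
   Context: For $p\geqslant 3$ let $\mathfrak l_p$ be the real Lie algebra with basis $x_1,\dots,x_p$ whose only nonzero brackets of basis elements (up to antisymmetry) are $[x_1,x_i]=x_{i+1}$ for $2\leqslant i\leqslant p-1$; its center is spanned by $x_p$. For $3\leqslant q\leqslant p$, $\mathfrak g_{p,q}$ is the central product of $\mathfrak l_p$ and $\mathfrak l_q$, i.e. the quotient of $\mathfrak l_p\times\mathfrak l_q$ by the central ideal identifying the last basis vectors of $\mathfrak l_p$ and $\mathfrak l_q$; $G_{p,q}$ is the simply connected Lie group with Lie algebra $\mathfrak g_{p,q}$. A compact presentation of a locally compact group $G$ is a presentation $\langle S\mid R\rangle$ with $S$ a compact generating set and $R$ a set of words of bounded length in the free group $F_S$ whose normal closure is the kernel of $F_S\to G$; $G$ is compactly presented if one exists (simply connected Lie groups are). A word is null-homotopic if it represents $1$ in $G$. A filling of a null-homotopic word $w$ of area $k$ is an expression $w=\prod_{i=1}^k u_i^{-1}r_iu_i$ in $F_S$ with $u_i\in F_S$, $r_i\in R^{\pm1}$. A word $u$ has word diameter $\leqslant d$ if for every decomposition $u=u'u''$ into subwords, $u'$ represents an element at distance $\leqslant d$ from $1$ in the Cayley graph of $(G,S)$; the filling has diameter $\leqslant d$ if every $u_i$ has word diameter $\leqslant d$. For increasing unbounded $f,g:\mathbf R_+\to\mathbf R_+$, $G$ admits $(f,g)$ as a filling pair if every null-homotopic word of length $n$ has a filling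 which simultaneously has area in $O(f(n))$ and filling diameter in $O(g(n))$. (For the pairs considered here this does not depend on the choice of compact presentation.) *)

(* Defs.v *)
From HB Require Import structures.
From mathcomp Require Import all_boot all_order all_algebra.
From mathcomp Require Import all_classical all_reals all_analysis.
From mathcomp Require Import ring lra zify.
Set Implicit Arguments.
Unset Strict Implicit.
Unset Printing Implicit Defensive.

Import Order.TTheory GRing.Theory Num.Theory.
Import numFieldNormedType.Exports.

Local Open Scope classical_set_scope.
Local Open Scope ring_scope.

HB.mixin Record isTopologicalGroup G of Topological G & Group G := {
  mulg_continuous : continuous (fun x : G * G => (x.1 * x.2)%g) ;
  invg_continuous : continuous (fun x : G => (x^-1)%g) }.

#[short(type="topGroupType")]
HB.structure Definition TopologicalGroup :=
  {G of Topological G & Group G & isTopologicalGroup G}.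

Section Words.
Variable G : groupType.

(* A word over S is a possibly non-reduced sequence of letters; (s, true)
   stands for s and (s, false) for s^-1.  The group F_S is the set of words
   over S modulo free_eq. *)
Definition word := seq (G * bool).

Implicit Types (S : set G) (w u r : word) (Rel : set word).

Definition letter_val (l : G * bool) : G := if l.2 then l.1 else (l.1^-1)%g.

Definition word_val w : G := (\prod_(l <- w) letter_val l)%g.

Definition word_inv w : word := rev [seq (l.1, ~~ l.2) | l <- w].

Definition word_over S w : Prop := forall l, l \in w -> S l.1.

Inductive free_eq : word -> word -> Prop :=
| free_eq_refl w : free_eq w w
| free_eq_sym w w' : free_eq w w' -> free_eq w' w
| free_eq_trans w w' w'' : free_eq w w' -> free_eq w' w'' -> free_eq w w''
| free_eq_cancel (l : G * bool) w w' :
    free_eq (w ++ [:: l, (l.1, ~~ l.2) & w']) (w ++ w').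

(* The entries of fl are the pairs (u_i, r_i), so that size fl is the area. *)
Definition is_filling S Rel w (fl : seq (word * word)) : Prop :=
  (forall ur, ur \in fl ->
     word_over S ur.1 /\ (Rel ur.2 \/ Rel (word_inv ur.2))) /\
  free_eq w (flatten [seq word_inv ur.1 ++ ur.2 ++ ur.1 | ur <- fl]).

End Words.

Section FillingPairs.
Variables (R : realType) (G : topGroupType).

Implicit Types (S : set G) (u : word G) (Rel : set (word G)) (d : R).

Definition word_ball S d : set G :=
  [set x | exists w : word G,
     [/\ word_over S w, word_val w = x & (size w)%:R <= d]].

Definition word_diameter_le S d u : Prop :=
  forall u1 u2 : word G, u = u1 ++ u2 -> word_ball S d (word_val u1).

Definition filling_diameter_le S d (fl : seq (word G * word G)) : Prop :=
  forall ur, ur \in fl -> word_diameter_le S d ur.1.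

Definition compact_generating S : Prop :=
  compact S /\ forall x : G, exists2 w : word G, word_over S w & word_val w = x.

Definition compact_presentation S Rel : Prop :=
  [/\ compact_generating S,
      forall r, Rel r -> word_over S r,
      exists k : nat, forall r, Rel r -> (size r <= k)%N &
      forall w : word G, word_over S w ->
        (word_val w = 1%g <-> exists fl, is_filling S Rel w fl)].

Definition filled_within S Rel (area diam : nat -> R) : Prop :=
  forall w : word G, word_over S w -> word_val w = 1%g ->
  exists fl, [/\ is_filling S Rel w fl, (size fl)%:R <= area (size w) &
                 filling_diameter_le S (diam (size w)) fl].

Definition filling_pair_for S Rel (f g : R -> R) : Prop :=
  exists area diam : nat -> R,
    [/\ area =O_\oo (fun n : nat => f n%:R),
        diam =O_\oo (fun n : nat => g n%:R) &
        filled_within S Rel area diam].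

Definition finite_filling S Rel : Prop :=
  exists area diam : nat -> R, filled_within S Rel area diam.

(* The filling pair is required for all compact presentations which have some
   filling functions at all, and such presentations must exist.  A compact
   presentation with an ill-chosen infinite set of relators may fail
   finite_filling (null-homotopic words of bounded length can need an unbounded
   area); it then satisfies filling_pair_for with no f and g.  The relators
   formed by all null-homotopic words of length at most k, for k large, do
   satisfy it. *)
Definition admits_filling_pair (f g : R -> R) : Prop :=
  (exists S Rel, compact_presentation S Rel /\ finite_filling S Rel) /\
  (forall S Rel, compact_presentation S Rel -> finite_filling S Rel ->
     filling_pair_for S Rel f g).

End FillingPairs.

Arguments admits_filling_pair {R} G f g.

Section LieAlgebra.
Variable R : realType.

(* x_k, numbered from 1; this is 0 unless 1 <= k <= p. *)
Definition lp_basis (p k : nat) : 'rV[R]_p := \row_(i < p) (i.+1 == k)%:R.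

Definition lp_basis_bracket (p i j : nat) : 'rV[R]_p :=
  if (i == 1)%N && (1 < j)%N then lp_basis p j.+1
  else if (j == 1)%N && (1 < i)%N then - lp_basis p i.+1
  else 0.

Definition lp_bracket p (a b : 'rV[R]_p) : 'rV[R]_p :=
  \sum_(i < p) \sum_(j < p) (a 0 i * b 0 j) *: lp_basis_bracket p i.+1 j.+1.

Definition lpq_bracket p q (u v : 'rV[R]_p * 'rV[R]_q) : 'rV[R]_p * 'rV[R]_q :=
  (lp_bracket u.1 v.1, lp_bracket u.2 v.2).

(* g_{p,q} is the quotient of l_p x l_q by this ideal. *)
Definition central_ideal p q : set ('rV[R]_p * 'rV[R]_q) :=
  [set u | exists c : R, u = (c *: lp_basis p p, - c *: lp_basis q q)].

(* A faithful representation of g_{p,q} by nilpotent matrices; see rho_bracket,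
   rho_kernel and rho_nilpotent below.  The vectors
   e_0, ..., e_{p+q-4} of R^(p+q-3) are the chain
     x_2, ..., x_{p-1}, x_p = y_q, y_{q-1}, ..., y_2
   and span the abelian ideal of g_{p,q} complementary to x_1, y_1: thus
   x_i = e_{i-2} and y_j = e_{p+q-2-j}.  On this ideal ad x_1 and ad y_1 act by
   the matrices chain_up and chain_down, and the representation is the affine
   one, x_1, y_1 being linear and the ideal acting by translations. *)
Definition chain_vec (n k : nat) : 'cV[R]_n := \col_(i < n) (i == k :> nat)%:R.

Definition chain_up (n p : nat) : 'M[R]_n :=
  \matrix_(i, j) ((i == j.+1 :> nat) && (i.+2 <= p)%N)%:R.

Definition chain_down (n p : nat) : 'M[R]_n :=
  \matrix_(i, j) ((j == i.+1 :> nat) && (p <= i.+2)%N)%:R.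

Definition rho_x (p q i : nat) : 'M[R]_(p + q - 3 + 1) :=
  if i == 1%N then block_mx (chain_up _ p) 0 0 0
  else block_mx 0 (chain_vec _ (i - 2)) 0 0.

Definition rho_y (p q j : nat) : 'M[R]_(p + q - 3 + 1) :=
  if j == 1%N then block_mx (chain_down _ p) 0 0 0
  else block_mx 0 (chain_vec _ (p + q - 2 - j)) 0 0.

Definition rho p q (u : 'rV[R]_p * 'rV[R]_q) : 'M[R]_(p + q - 3 + 1) :=
  \sum_(i < p) u.1 0 i *: rho_x p q i.+1 + \sum_(j < q) u.2 0 j *: rho_y p q j.+1.

(* The exponential of a nilpotent matrix: A ^+ n = 0 for A nilpotent of size n. *)
Definition expm n (A : 'M[R]_n) : 'M[R]_n := \sum_(k < n) (k`!%:R)^-1 *: A ^+ k.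

End LieAlgebra.

Section Exponential.
Variables (R : realType) (n : nat).
Implicit Types A B T : 'M[R]_n.

Lemma fact_neq0 k : (k`!%:R : R) != 0.
Proof. by rewrite pnatr_eq0 -lt0n fact_gt0. Qed.

Lemma expmD A B : A * B = B * A ->
  (forall i j, (n <= i + j)%N -> A ^+ i * B ^+ j = 0) ->
  expm A * expm B = expm (A + B).
Proof.
move=> cAB nil.
pose F i j : 'M[R]_n := ((i`!%:R)^-1 * (j`!%:R)^-1) *: (A ^+ i * B ^+ j).
have F0 i j : (n <= i + j)%N -> F i j = 0.
  by move=> h; rewrite /F nil // scaler0.
transitivity (\sum_(0 <= i < n) \sum_(0 <= j < n) F i j).
  rewrite /expm big_distrlr /= big_mkord; apply: eq_bigr => i _.
  rewrite big_mkord; apply: eq_bigr => j _.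
  by rewrite -!mulmxE -scalemxAl -scalemxAr scalerA.
transitivity (\sum_(0 <= i < n) \sum_(0 <= k < n | (i <= k)%N) F i (k - i)%N).
  rewrite [LHS]big_nat [RHS]big_nat; apply: eq_bigr => i /andP[_ ltin].
  rewrite (@big_cat_nat _ _ _ (n - i)) ?leq_subr //= addrC big_nat big1 ?add0r; last first.
    by move=> j /andP[h _]; apply: F0; lia.
  transitivity (\sum_(i <= k < n) F i (k - i)%N); last by rewrite (@big_nat_widenl _ _ _ i 0).
  have := @big_addn _ 0 +%R 0 n i predT (fun k => F i (k - i)%N); rewrite add0n => ->.
  by apply: eq_bigr => j _; rewrite addnK.
rewrite (exchange_big_dep_nat predT) //= /expm big_mkord; apply: eq_bigr => k _.
rewrite exprDn_comm; last exact: cAB.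
transitivity (\sum_(0 <= i < k.+1) F i (k - i)%N).
  by rewrite (@big_nat_widen _ _ _ 0 k.+1 n).
rewrite scaler_sumr -(big_mkord predT (fun i => (k`!%:R)^-1 *: (A ^+ (k - i) * B ^+ i *+ 'C(k, i)))).
rewrite [LHS]big_nat_rev /= [LHS]big_nat [RHS]big_nat; apply: eq_bigr => i /andP[_ leik].
rewrite ltnS in leik.
rewrite add0n subSS subKn // /F -scalerMnr scalerMnl; congr (_ *: _).
rewrite -mulr_natr -(bin_fact leik) !natrM.
have := fact_neq0 i; have := fact_neq0 (k - i).
have : ('C(k, i)%:R : R) != 0 by rewrite pnatr_eq0 -lt0n bin_gt0.
move=> h1 h2 h3; field; by rewrite h1 h2 h3.
Qed.

Lemma expm0 : expm (0 : 'M[R]_n) = 1.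
Proof.
rewrite /expm; case: n => [|m]; first by apply/matrixP => -[].
rewrite big_ord_recl /= big1 => [|i _]; last by rewrite exprS mul0r scaler0.
by rewrite expr0 invr1 scale1r addr0.
Qed.

Definition phim A : 'M[R]_n := \sum_(k < n) (k.+1`!%:R)^-1 *: A ^+ k.

Lemma unipotent_inv K : K ^+ n = 0 -> ((1 : 'M[R]_n) + K) * (\sum_(i < n) (- K) ^+ i) = 1.
Proof.
move=> K0; have := subrX1 (- K) n.
rewrite exprNn K0 mulr0 sub0r => /(congr1 -%R); rewrite opprK -mulNr opprB opprK.
by rewrite addrC.
Qed.

Lemma phim_inv A : A ^+ n = 0 -> exists B, phim A * B = 1.
Proof.
move=> A0; pose Q := \sum_(k < n.-1) (k.+2`!%:R)^-1 *: A ^+ k.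
have -> : phim A = 1 + A * Q.
  rewrite /phim /Q {Q}; move: A A0; case: (n) => [|m] A A0; first by apply/matrixP => -[].
  rewrite big_ord_recl /= invr1 scale1r expr0; congr (_ + _).
  rewrite mulr_sumr; apply: eq_bigr => i _.
  by rewrite exprS -!mulmxE -scalemxAr.
have cAQ : GRing.comm A Q.
  rewrite /GRing.comm mulr_sumr mulr_suml; apply: eq_bigr => i _.
  by rewrite -!mulmxE -scalemxAl -scalemxAr !mulmxE -exprS -exprSr.
exists (\sum_(i < n) (- (A * Q)) ^+ i); apply: unipotent_inv.
by rewrite exprMn_comm // A0 mul0r.
Qed.

Lemma expm_unipotent A : A ^+ n = 0 -> ((1 : 'M[R]_n) - expm A) ^+ n = 0.
Proof.
move=> A0; pose Q := \sum_(k < n.-1) (k.+1`!%:R)^-1 *: A ^+ k.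
have -> : (1 : 'M[R]_n) - expm A = A * - Q.
  rewrite mulrN -[RHS]add0r -(subrr (1 : 'M[R]_n)) -addrA -opprD; congr (_ - _).
  rewrite /expm /Q {Q}; move: A A0; case: (n) => [|m] A A0; first by apply/matrixP => -[].
  rewrite big_ord_recl /= invr1 scale1r expr0; congr (_ + _).
  rewrite mulr_sumr; apply: eq_bigr => i _.
  by rewrite exprS -!mulmxE -scalemxAr.
have cAQ : GRing.comm A Q.
  rewrite /GRing.comm mulr_sumr mulr_suml; apply: eq_bigr => i _.
  by rewrite -!mulmxE -scalemxAl -scalemxAr !mulmxE -exprS -exprSr.
by rewrite exprMn_comm ?A0 ?mul0r // /GRing.comm mulrN mulNr cAQ.
Qed.

Lemma geom_inv A : ((1 : 'M[R]_n) - A) ^+ n = 0 ->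
  A *m (\sum_(i < n) ((1 : 'M[R]_n) - A) ^+ i) = 1%:M.
Proof.
move=> A0; have := unipotent_inv (K := A - 1).
have -> : (1 : 'M[R]_n) + (A - 1) = A by rewrite addrC subrK.
rewrite opprB; apply; by rewrite -opprB exprNn A0 mulr0.
Qed.
End Exponential.

Section Block.
Variables (R : realType) (n : nat).

Definition aff (T : 'M[R]_n) (v : 'cV[R]_n) : 'M[R]_(n + 1) := block_mx T v 0 0.
Definition gaff (T : 'M[R]_n) (v : 'cV[R]_n) : 'M[R]_(n + 1) := block_mx T v 0 1%:M.

Lemma gaffM T v T' v' : gaff T v * gaff T' v' = gaff (T *m T') (T *m v' + v).
Proof. by rewrite /gaff -mulmxE mulmx_block !mulmx0 !mul0mx !mulmx1 !addr0 !add0r. Qed.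

Lemma affX T v k : aff T v ^+ k.+1 = aff (T ^+ k.+1) (T ^+ k *m v).
Proof.
elim: k => [|k IH]; first by rewrite !expr1 expr0 mul1mx.
rewrite exprS IH /aff -mulmxE mulmx_block !mulmx0 !mul0mx !addr0.
by rewrite mulmxE -exprS mulmxA mulmxE -exprS.
Qed.

Lemma aff_nil T v : T ^+ n = 0 -> aff T v ^+ (n + 1) = 0.
Proof.
have e : (n + 1)%N = n.+1 by rewrite addn1.
move=> T0; rewrite [X in _ ^+ X]e affX exprS T0 mulr0 mul0mx /aff.
by rewrite -[RHS](block_mx0).
Qed.

Lemma aff_expm T v : T ^+ n = 0 -> expm (aff T v) = gaff (expm T) (phim T *m v).
Proof.
move=> T0; rewrite /expm.
rewrite -(big_mkord predT (fun k => (k`!%:R)^-1 *: aff T v ^+ k)).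
have -> : index_iota 0 (n + 1) = index_iota 0 n.+1 by rewrite addn1.
rewrite big_nat_recl //= fact0 invr1 scale1r expr0.
have -> : (1 : 'M[R]_(n + 1)) = block_mx 1%:M 0 0 1%:M by rewrite -scalar_mx_block.
under eq_bigr => i _ do rewrite affX /aff scale_block_mx !scaler0.
have -> : \sum_(0 <= i < n) block_mx ((i.+1`!%:R)^-1 *: T ^+ i.+1)
  ((i.+1`!%:R)^-1 *: (T ^+ i *m v)) 0 (0 : 'M[R]_1) =
  block_mx (\sum_(0 <= i < n) (i.+1`!%:R)^-1 *: T ^+ i.+1)
   (\sum_(0 <= i < n) (i.+1`!%:R)^-1 *: (T ^+ i *m v)) 0 0.
  elim/big_rec3: _ => [|i x y z _ ->]; first by rewrite block_mx0.
  by rewrite add_block_mx !addr0.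
rewrite add_block_mx !addr0 !add0r /gaff; congr block_mx.
  rewrite -(big_mkord predT (fun k => (k`!%:R)^-1 *: T ^+ k)).
  have -> : (1%:M : 'M[R]_n) = (0`!%:R)^-1 *: T ^+ 0.
    by rewrite fact0 invr1 expr0 scale1r.
  rewrite -(@big_nat_recl _ _ _ _ 0 (fun k => (k`!%:R)^-1 *: T ^+ k)) //.
  by rewrite big_nat_recr //= T0 scaler0 addr0.
rewrite /phim mulmx_suml big_mkord; apply: eq_bigr => i _.
by rewrite scalemxAl.
Qed.

End Block.

Section AffineForm.
Variable R : realType.
Variables p q : nat.
Let n := (p + q - 3)%N.
Notation U := (chain_up R n p).
Notation D := (chain_down R n p).
Implicit Types (u v : 'rV[R]_p * 'rV[R]_q).

Lemma affD m (A B : 'M[R]_m) x y : aff A x + aff B y = aff (A + B) (x + y).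
Proof. by rewrite /aff add_block_mx !addr0. Qed.

Lemma affZ m c (A : 'M[R]_m) x : c *: aff A x = aff (c *: A) (c *: x).
Proof. by rewrite /aff scale_block_mx !scaler0. Qed.

Lemma aff00 m : aff (0 : 'M[R]_m) 0 = 0.
Proof. exact: block_mx0. Qed.

Lemma aff_sum m (I : finType) (A : I -> 'M[R]_m) x :
  \sum_i aff (A i) (x i) = aff (\sum_i A i) (\sum_i x i).
Proof.
elim/big_rec3: _ => [|i a b c _ ->]; first by rewrite aff00.
by rewrite affD.
Qed.

Lemma aff_inj m (A B : 'M[R]_m) x y : aff A x = aff B y -> A = B /\ x = y.
Proof. by move=> /eq_block_mx[-> -> _ _]. Qed.

Lemma gaff_inj m (A B : 'M[R]_m) x y : gaff A x = gaff B y -> A = B /\ x = y.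
Proof. by move=> /eq_block_mx[-> -> _ _]. Qed.

(* The coefficient of x_1. *)
Definition sco m (a : 'rV[R]_m) : R := \sum_(i < m) a 0 i *+ (i == 0%N :> nat).

Definition Tm u : 'M[R]_n := sco u.1 *: U + sco u.2 *: D.

Definition Vm u : 'cV[R]_n :=
  \sum_(i < p) (u.1 0 i *+ (i != 0%N :> nat)) *: chain_vec R n (i - 1) +
  \sum_(j < q) (u.2 0 j *+ (j != 0%N :> nat)) *: chain_vec R n (p + q - 3 - j).

Lemma rhoE u : rho u = aff (Tm u) (Vm u).
Proof.
rewrite /rho /Tm /Vm.
have -> : \sum_(i < p) u.1 0 i *: rho_x R p q i.+1 =
   aff (sco u.1 *: U) (\sum_(i < p) (u.1 0 i *+ (i != 0%N :> nat)) *: chain_vec R n (i - 1)).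
  rewrite /sco scaler_suml -aff_sum; apply: eq_bigr => i _.
  rewrite /rho_x eqSS subSS; case: eqP => _.
    by rewrite mulr1n mulr0n scale0r /aff scale_block_mx !scaler0.
  by rewrite mulr1n mulr0n scale0r /aff scale_block_mx !scaler0.
have -> : \sum_(i < q) u.2 0 i *: rho_y R p q i.+1 =
   aff (sco u.2 *: D) (\sum_(j < q) (u.2 0 j *+ (j != 0%N :> nat)) *: chain_vec R n (p + q - 3 - j)).
  rewrite /sco scaler_suml -aff_sum; apply: eq_bigr => i _.
  rewrite /rho_y eqSS; case: eqP => _.
    by rewrite mulr1n mulr0n scale0r /aff scale_block_mx !scaler0.
  rewrite mulr1n mulr0n scale0r /aff scale_block_mx !scaler0.
  by congr (block_mx _ (_ *: chain_vec _ _ _) _ _); lia.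
by rewrite affD.
Qed.

Lemma chain_upX k (i j : 'I_n) : i != (j + k)%N :> nat -> (U ^+ k) i j = 0.
Proof.
elim: k i j => [|k IH] i j ne; first by rewrite expr0 mxE; move: ne; rewrite addn0 -val_eqE  => /negbTE ->.
rewrite exprSr -mulmxE mxE big1 // => l _.
case: (eqVneq (i : nat) (l + k)%N) => [e|/IH -> //]; last by rewrite mul0r.
rewrite [U l j]mxE; case: eqP => [e'|_]; last by rewrite mulr0.
by move: ne; rewrite e e' addSnnS eqxx.
Qed.

Lemma chain_downX k (i j : 'I_n) : j != (i + k)%N :> nat -> (D ^+ k) i j = 0.
Proof.
elim: k i j => [|k IH] i j ne; first by rewrite expr0 mxE; move: ne; rewrite addn0 -val_eqE eq_sym /= => /negbTE ->.
rewrite exprS -mulmxE mxE big1 // => l _.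
case: (eqVneq (j : nat) (l + k)%N) => [e|/IH -> //]; last by rewrite mulr0.
rewrite [D i l]mxE; case: eqP => [e'|_]; last by rewrite mul0r.
by move: ne; rewrite e e' addSnnS eqxx.
Qed.

Lemma chain_upX0 k : (n <= k)%N -> U ^+ k = 0.
Proof.
move=> le; apply/matrixP => i j; rewrite mxE chain_upX //.
by have := ltn_ord i; lia.
Qed.

Lemma chain_downX0 k : (n <= k)%N -> D ^+ k = 0.
Proof.
move=> le; apply/matrixP => i j; rewrite mxE chain_downX //.
by have := ltn_ord j; lia.
Qed.

Lemma chain_UD : U * D = 0.
Proof.
apply/matrixP => i j; rewrite -mulmxE !mxE big1 // => l _; rewrite !mxE -natrM mulnb.
by case: (boolP (_ && _)) => [/andP[/andP[/eqP ? ?] /andP[/eqP ? ?]]|]; first lia.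
Qed.

Lemma chain_DU : D * U = 0.
Proof.
apply/matrixP => i j; rewrite -mulmxE !mxE big1 // => l _; rewrite !mxE -natrM mulnb.
by case: (boolP (_ && _)) => [/andP[/andP[/eqP ? ?] /andP[/eqP ? ?]]|]; first lia.
Qed.

Lemma TmX u k : Tm u ^+ k.+1 = sco u.1 ^+ k.+1 *: U ^+ k.+1 + sco u.2 ^+ k.+1 *: D ^+ k.+1.
Proof.
elim: k => [|k IH]; first by rewrite !expr1.
rewrite exprS IH /Tm mulrDl !mulrDr -!mulmxE -!scalemxAl -!scalemxAr !mulmxE.
have -> : U * D ^+ k.+1 = 0 by rewrite exprS mulrA chain_UD mul0r.
have -> : D * U ^+ k.+1 = 0 by rewrite exprS mulrA chain_DU mul0r.
rewrite !scaler0.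
by rewrite addr0 add0r !scalerA -!exprS.
Qed.

Lemma Tm_nil u k : (n <= k)%N -> Tm u ^+ k = 0.
Proof.
case: k => [|k] le; last by rewrite TmX chain_upX0 // chain_downX0 // !scaler0 addr0.
by apply/matrixP => i; have := ltn_ord i; lia.
Qed.

Lemma Tm_mul u v : Tm u * Tm v = (sco u.1 * sco v.1) *: (U * U) + (sco u.2 * sco v.2) *: (D * D).
Proof.
rewrite /Tm mulrDl !mulrDr -!mulmxE -!scalemxAl -!scalemxAr !mulmxE chain_UD chain_DU.
by rewrite !scaler0 addr0 add0r !scalerA.
Qed.

Lemma Tm_comm u v : Tm u * Tm v = Tm v * Tm u.
Proof. by rewrite !Tm_mul mulrC [sco u.2 * _]mulrC. Qed.

Lemma Tm_nil2 u v i j : (n <= i + j)%N -> Tm u ^+ i * Tm v ^+ j = 0.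
Proof.
case: i => [|i]; first by rewrite add0n => le; rewrite (Tm_nil v le) mulr0.
case: j => [|j]; first by rewrite addn0 => le; rewrite (Tm_nil u le) mul0r.
move=> le; rewrite !TmX mulrDl !mulrDr -!mulmxE -!scalemxAl -!scalemxAr !mulmxE.
have -> : U ^+ i.+1 * D ^+ j.+1 = 0.
  by rewrite exprSr exprS mulrA -[_ * U * D]mulrA chain_UD mulr0 mul0r.
have -> : D ^+ i.+1 * U ^+ j.+1 = 0.
  by rewrite exprSr exprS mulrA -[_ * D * U]mulrA chain_DU mulr0 mul0r.
by rewrite -!exprD (chain_upX0 le) (chain_downX0 le) !scaler0 !addr0.
Qed.

Lemma rho_nilpotent u : rho u ^+ (p + q - 3 + 1) = 0.
Proof. by rewrite rhoE; apply: aff_nil; apply: Tm_nil. Qed.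

Lemma expm_rho u : expm (rho u) = gaff (expm (Tm u)) (phim (Tm u) *m Vm u).
Proof. by rewrite rhoE; apply: aff_expm; apply: Tm_nil. Qed.

Lemma scoD m (a b : 'rV[R]_m) : sco (a + b) = sco a + sco b.
Proof. by rewrite /sco -big_split /=; apply: eq_bigr => i _; rewrite mxE mulrnDl. Qed.

Lemma scoZ m c (b : 'rV[R]_m) : sco (c *: b) = c * sco b.
Proof. by rewrite /sco mulr_sumr; apply: eq_bigr => i _; rewrite mxE mulrnAr. Qed.

Lemma TmD u v : Tm u + Tm v = Tm (u + v).
Proof. by rewrite /Tm /= !scoD !scalerDl addrACA. Qed.

Lemma expm_Tm u v : expm (Tm u) * expm (Tm v) = expm (Tm (u + v)).
Proof. by rewrite expmD ?TmD //; [exact: Tm_comm | move=> i j; exact: Tm_nil2]. Qed.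

Lemma Vm_surj u (w : 'cV[R]_n) : exists u', Tm u' = Tm u /\ Vm u' = w.
Proof.
pose c (k : nat) : R := if insub k is Some i then w i 0 else 0.
pose a : 'rV[R]_p := \row_i (if i == 0%N :> nat then u.1 0 i else c (i - 1)%N).
pose b : 'rV[R]_q := \row_j (if j == 0%N :> nat then u.2 0 j else 
   if ((p + q - 3 - j).+1 < p)%N || (p + q - 3 < j)%N then 0 else c (p + q - 3 - j)%N).
exists (a, b); split.
  rewrite /Tm /=; congr (_ *: _ + _ *: _); rewrite /sco; apply: eq_bigr => i _;
  by rewrite mxE; case: eqP.
apply/colP => k; rewrite /Vm mxE !summxE /=.
have ck : c k = w k 0 by rewrite /c; case: insubP => [i _ /val_inj -> //|]; rewrite ltn_ord.
have kn := ltn_ord k.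
have [lt|ge] := ltnP k.+1 p.
  rewrite (bigD1 (Ordinal lt)) //= !big1 => [|j|i /eqP ne]; rewrite ?mxE /=.
  - by rewrite /= subn1 /= eqxx mulr1 !addr0 mulr1n.
  - move=> _; case: (eqVneq (j : nat) 0%N) => _; rewrite ?mulr0n ?mul0r //.
    case: ifP => [_|/negP h]; first by rewrite mulr1n mul0r.
    case: eqP => [e|]; rewrite ?mulr0 //.
    by exfalso; apply: h; rewrite -e lt.
  - case: (eqVneq (i : nat) 0%N) => [|i0]; rewrite ?mulr0n ?mul0r //.
    case: eqP => [e|]; rewrite ?mulr0 //.
    by exfalso; apply: ne; apply: val_inj => /=; lia.
have ltq : (p + q - 3 - k < q)%N by lia.
rewrite big1 ?add0r => [|i _].
  rewrite (bigD1 (Ordinal ltq)) //= big1 => [|j /eqP ne]; rewrite !mxE /=.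
    have -> : (p + q - 3 - (p + q - 3 - k))%N = k by lia.
    case: eqP => e /=; first by lia.
    have -> : ((k.+1 < p)%N || (p + q - 3 < p + q - 3 - k)%N) = false by lia.
    by rewrite eqxx mulr1 addr0 mulr1n.
  case: (eqVneq (j : nat) 0%N) => [|j0]; rewrite ?mulr0n ?mul0r //.
  case: ifP => [_|h]; first by rewrite mulr1n mul0r.
  case: eqP => [e|]; rewrite ?mulr0 //.
  exfalso; apply: ne; apply: val_inj => /=. have := ltn_ord j. lia.
rewrite !mxE; case: (eqVneq (i : nat) 0%N) => [|i0]; rewrite ?mulr0n ?mul0r //.
case: eqP => [e|]; rewrite ?mulr0 //.
by have := ltn_ord i; lia.
Qed.

Lemma expm_rho_mul u v : exists w, expm (rho u) * expm (rho v) = expm (rho w).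
Proof.
rewrite !expm_rho gaffM mulmxE expm_Tm.
set x := (X in gaff _ X).
have [B hB] := phim_inv (Tm_nil (u + v) (leqnn n)).
have [w [hT hV]] := Vm_surj (u + v) (B *m x).
by exists w; rewrite expm_rho hT hV mulmxA mulmxE hB mul1mx.
Qed.

Lemma rhoN u : rho (- u) = - rho u.
Proof.
rewrite /rho opprD -!sumrN; congr (_ + _); apply: eq_bigr => i _; by rewrite /= mxE scaleNr.
Qed.

Lemma expm_rhoN u : expm (rho u) * expm (rho (- u)) = 1.
Proof.
have e : (rho u - rho u : 'M[R]_(p + q - 3 + 1)) = 0 by rewrite subrr.
rewrite rhoN expmD ?e ?expm0 //; first by rewrite mulrN mulNr.
move=> i j le; rewrite exprNn -signr_odd.
have z : rho u ^+ i * rho u ^+ j = 0.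
  by rewrite -exprD -(subnK le) exprD rho_nilpotent mulr0.
by case: odd; rewrite ?expr1 ?expr0 ?mulN1r ?mul1r ?mulrN z ?oppr0.
Qed.
End AffineForm.

Section Faithful.
Variable R : realType.
Variables p q : nat.
Hypotheses (hp : (2 < p)%N) (hq : (2 < q)%N).
Let n := (p + q - 3)%N.
Notation U := (chain_up R n p).
Notation D := (chain_down R n p).
Notation rx := (rho_x R p q).
Notation ry := (rho_y R p q).
Implicit Types (u v : 'rV[R]_p * 'rV[R]_q).

Lemma affM m (A B : 'M[R]_m) x y : aff A x * aff B y = aff (A * B) (A *m y).
Proof. by rewrite /aff -mulmxE mulmx_block !mulmx0 !mul0mx !addr0. Qed.

Lemma chain_up_vec k :
  U *m chain_vec R n k = if (k.+3 <= p)%N then chain_vec R n k.+1 else 0.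
Proof.
apply/colP => i; rewrite !mxE.
transitivity (\sum_(l < n) ((l == k :> nat) && (i == k.+1 :> nat) && (i.+2 <= p)%N)%:R : R).
  apply: eq_bigr => l _; rewrite !mxE -natrM mulnb; congr (nat_of_bool _)%:R.
  case: (eqVneq (l : nat) k) => [->|]; by rewrite ?andbT ?andbF.
have [e|ne] := eqVneq (i : nat) k.+1; last first.
  rewrite big1 => [|l _]; last by rewrite andbF.
  by case: ifP; rewrite !mxE // (negbTE ne).
have lk : (k < n)%N by have := ltn_ord i; lia.
rewrite (bigD1 (Ordinal lk)) //= eqxx big1 ?addr0 => [|l]; last first.
  by rewrite -val_eqE /= => /negbTE ->.
by rewrite e; case: ifP; rewrite !mxE ?e ?eqxx.
Qed.

Lemma chain_down_vec k : (k < n)%N ->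
  D *m chain_vec R n k =
  if (0 < k)%N && (p <= k.+1)%N then chain_vec R n k.-1 else 0.
Proof.
move=> lk; apply/colP => i; rewrite !mxE.
rewrite (bigD1 (Ordinal lk)) //= big1 ?addr0 => [|l]; last first.
  by rewrite -val_eqE /= => /negbTE ne; rewrite !mxE ne mulr0.
rewrite !mxE /= eqxx mulr1.
case: ifP => [/andP[k0 pk]|h]; rewrite !mxE; first by congr (nat_of_bool _)%:R; lia.
by case: (boolP (_ && _)) => [/andP[/eqP e ?]|//]; lia.
Qed.

Lemma rx1 : rx 1 = aff U 0. Proof. by []. Qed.
Lemma rxE i : (1 < i)%N -> rx i = aff 0 (chain_vec R n (i - 2)).
Proof. by case: i => [|[]]. Qed.
Lemma ry1 : ry 1 = aff D 0. Proof. by []. Qed.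
Lemma ryE i : (1 < i)%N -> ry i = aff 0 (chain_vec R n (p + q - 2 - i)).
Proof. by case: i => [|[]]. Qed.

Definition rhoL (a : 'rV[R]_p) := \sum_(i < p) a 0 i *: rx i.+1.
Definition rhoR (b : 'rV[R]_q) := \sum_(i < q) b 0 i *: ry i.+1.

Lemma rhoLR u : rho u = rhoL u.1 + rhoR u.2. Proof. by []. Qed.

Lemma rhoL_lin c a b : rhoL (c *: a + b) = c *: rhoL a + rhoL b.
Proof.
rewrite /rhoL scaler_sumr -big_split; apply: eq_bigr => i _ /=.
by rewrite !mxE scalerDl scalerA.
Qed.
Lemma rhoR_lin c a b : rhoR (c *: a + b) = c *: rhoR a + rhoR b.
Proof.
rewrite /rhoR scaler_sumr -big_split; apply: eq_bigr => i _ /=.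
by rewrite !mxE scalerDl scalerA.
Qed.
Lemma rhoL0 : rhoL 0 = 0.
Proof. by rewrite /rhoL big1 // => i _; rewrite mxE scale0r. Qed.
Lemma rhoR0 : rhoR 0 = 0.
Proof. by rewrite /rhoR big1 // => i _; rewrite mxE scale0r. Qed.
Lemma rhoLZ c a : rhoL (c *: a) = c *: rhoL a.
Proof. by rewrite -[c *: a]addr0 rhoL_lin rhoL0 addr0. Qed.
Lemma rhoRZ c a : rhoR (c *: a) = c *: rhoR a.
Proof. by rewrite -[c *: a]addr0 rhoR_lin rhoR0 addr0. Qed.
Lemma rhoLD a b : rhoL (a + b) = rhoL a + rhoL b.
Proof. by rewrite -[a]scale1r rhoL_lin !scale1r. Qed.
Lemma rhoRD a b : rhoR (a + b) = rhoR a + rhoR b.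
Proof. by rewrite -[a]scale1r rhoR_lin !scale1r. Qed.
Lemma rhoL_sum (I : finType) (F : I -> 'rV[R]_p) : rhoL (\sum_i F i) = \sum_i rhoL (F i).
Proof. by elim/big_rec2: _ => [|i x y _ <-]; rewrite ?rhoL0 ?rhoLD. Qed.
Lemma rhoR_sum (I : finType) (F : I -> 'rV[R]_q) : rhoR (\sum_i F i) = \sum_i rhoR (F i).
Proof. by elim/big_rec2: _ => [|i x y _ <-]; rewrite ?rhoR0 ?rhoRD. Qed.

Lemma rhoL_basis k : rhoL (lp_basis R p k) = if (0 < k <= p)%N then rx k else 0.
Proof.
rewrite /rhoL; case: ifP => [/andP[k0 kp]|h].
  have lk : (k.-1 < p)%N by lia.
  rewrite (bigD1 (Ordinal lk)) //= big1 => [|i].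
    by rewrite mxE /= prednK // eqxx scale1r addr0.
  rewrite -val_eqE /= => ne; rewrite mxE; case: eqP => [e|]; rewrite ?scale0r //.
  by move: ne; rewrite -e eqxx.
rewrite big1 // => i _; rewrite mxE; case: eqP => [e|]; rewrite ?scale0r //.
by have := ltn_ord i; lia.
Qed.
Lemma rhoR_basis k : rhoR (lp_basis R q k) = if (0 < k <= q)%N then ry k else 0.
Proof.
rewrite /rhoR; case: ifP => [/andP[k0 kp]|h].
  have lk : (k.-1 < q)%N by lia.
  rewrite (bigD1 (Ordinal lk)) //= big1 => [|i].
    by rewrite mxE /= prednK // eqxx scale1r addr0.
  rewrite -val_eqE /= => ne; rewrite mxE; case: eqP => [e|]; rewrite ?scale0r //.
  by move: ne; rewrite -e eqxx.
rewrite big1 // => i _; rewrite mxE; case: eqP => [e|]; rewrite ?scale0r //.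
by have := ltn_ord i; lia.
Qed.

Lemma aff0N m (x : 'cV[R]_m) : - aff 0 x = aff 0 (- x).
Proof. by rewrite -[- aff 0 x]scaleN1r affZ scaler0 scaleN1r. Qed.

Lemma rx_bracket i j : (0 < i <= p)%N -> (0 < j <= p)%N ->
  rhoL (lp_basis_bracket R p i j) = rx i * rx j - rx j * rx i.
Proof.
move=> /andP[i0 ip] /andP[j0 jp]; rewrite /lp_basis_bracket.
have N a : rhoL (- a) = - rhoL a by rewrite -[- a]scaleN1r rhoLZ scaleN1r.
have [i1|i1] := eqVneq i 1%N; have [j1|j1] := eqVneq j 1%N; rewrite /= ?andbF.
- by subst; rewrite rhoL0 subrr.
- subst i; have j2 : (1 < j)%N by lia.
  rewrite j2 rhoL_basis rx1 (rxE j2) !affM mulr0 mul0r mul0mx aff00 subr0 chain_up_vec.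
  case: ifP => h1; case: ifP => h2; try lia; rewrite ?aff00 // rxE //.
  by congr (aff _ (chain_vec _ _ _)); lia.
- subst j; have i2 : (1 < i)%N by lia.
  rewrite i2 N rhoL_basis rx1 (rxE i2) !affM mulr0 mul0r mul0mx aff00 sub0r chain_up_vec.
  congr (- _); case: ifP => h1; case: ifP => h2; try lia; rewrite ?aff00 // rxE //.
  by congr (aff _ (chain_vec _ _ _)); lia.
- have i2 : (1 < i)%N by lia.
  have j2 : (1 < j)%N by lia.
  by rewrite rhoL0 (rxE i2) (rxE j2) !affM !mul0mx !mulr0 subrr.
Qed.

Lemma ry_bracket i j : (0 < i <= q)%N -> (0 < j <= q)%N ->
  rhoR (lp_basis_bracket R q i j) = ry i * ry j - ry j * ry i.
Proof.
move=> /andP[i0 ip] /andP[j0 jp]; rewrite /lp_basis_bracket.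
have N a : rhoR (- a) = - rhoR a by rewrite -[- a]scaleN1r rhoRZ scaleN1r.
have [i1|i1] := eqVneq i 1%N; have [j1|j1] := eqVneq j 1%N; rewrite /= ?andbF.
- by subst; rewrite rhoR0 subrr.
- subst i; have j2 : (1 < j)%N by lia.
  rewrite j2 rhoR_basis ry1 (ryE j2) !affM mulr0 mul0r mul0mx aff00 subr0 chain_down_vec; last by rewrite /n; lia.
  case: ifP => h1; case: ifP => h2; try lia; rewrite ?aff00 // ryE //.
  by congr (aff _ (chain_vec _ _ _)); lia.
- subst j; have i2 : (1 < i)%N by lia.
  rewrite i2 N rhoR_basis ry1 (ryE i2) !affM mulr0 mul0r mul0mx aff00 sub0r chain_down_vec; last by rewrite /n; lia.
  congr (- _); case: ifP => h1; case: ifP => h2; try lia; rewrite ?aff00 // ryE //.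
  by congr (aff _ (chain_vec _ _ _)); lia.
- have i2 : (1 < i)%N by lia.
  have j2 : (1 < j)%N by lia.
  by rewrite rhoR0 (ryE i2) (ryE j2) !affM !mul0mx !mulr0 subrr.
Qed.

Lemma rxy i j : (0 < i <= p)%N -> (0 < j <= q)%N -> rx i * ry j = 0 /\ ry j * rx i = 0.
Proof.
move=> /andP[i0 ip] /andP[j0 jp].
have hU : (1 < j)%N -> U *m chain_vec R n (p + q - 2 - j) = 0.
  by move=> j2; rewrite chain_up_vec; case: ifP => //; lia.
have hD : (1 < i)%N -> D *m chain_vec R n (i - 2) = 0.
  by move=> i2; rewrite chain_down_vec; [case: ifP => //; lia | rewrite /n; lia].
have [i1|i1] := eqVneq i 1%N; have [j1|j1] := eqVneq j 1%N.
- by subst; rewrite rx1 ry1 !affM !mulmx0 chain_UD chain_DU aff00.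
- subst i; have j2 : (1 < j)%N by lia.
  by rewrite rx1 (ryE j2) !affM mulr0 mul0r hU // mul0mx aff00.
- subst j; have i2 : (1 < i)%N by lia.
  by rewrite ry1 (rxE i2) !affM mulr0 mul0r hD // mul0mx aff00.
- have i2 : (1 < i)%N by lia.
  have j2 : (1 < j)%N by lia.
  by rewrite (rxE i2) (ryE j2) !affM !mul0mx !mulr0 aff00.
Qed.

Lemma prod_sum2 m k1 k2 (A : 'I_k1 -> 'M[R]_m) (B : 'I_k2 -> 'M[R]_m) a b :
  (\sum_i a i *: A i) * (\sum_j b j *: B j) = \sum_i \sum_j (a i * b j) *: (A i * B j).
Proof.
rewrite big_distrlr /=; apply: eq_bigr => i _; apply: eq_bigr => j _.
by rewrite -!mulmxE -scalemxAl -scalemxAr scalerA.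
Qed.

Lemma rhoL_bracket a b : rhoL (lp_bracket a b) = rhoL a * rhoL b - rhoL b * rhoL a.
Proof.
rewrite !prod_sum2 [X in _ - X]exchange_big /= -sumrB rhoL_sum.
apply: eq_bigr => i _; rewrite -sumrB rhoL_sum; apply: eq_bigr => j _.
by rewrite rhoLZ rx_bracket ?ltn_ord // [b 0 j * _]mulrC scalerBr.
Qed.
Lemma rhoR_bracket a b : rhoR (lp_bracket a b) = rhoR a * rhoR b - rhoR b * rhoR a.
Proof.
rewrite !prod_sum2 [X in _ - X]exchange_big /= -sumrB rhoR_sum.
apply: eq_bigr => i _; rewrite -sumrB rhoR_sum; apply: eq_bigr => j _.
by rewrite rhoRZ ry_bracket ?ltn_ord // [b 0 j * _]mulrC scalerBr.
Qed.

Lemma rhoLR0 a b : rhoL a * rhoR b = 0 /\ rhoR b * rhoL a = 0.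
Proof.
rewrite !prod_sum2; split; rewrite big1 // => i _; rewrite big1 // => j _.
  by have [-> _] := @rxy i.+1 j.+1 (ltn_ord i) (ltn_ord j); rewrite scaler0.
by have [_ ->] := @rxy j.+1 i.+1 (ltn_ord j) (ltn_ord i); rewrite scaler0.
Qed.

Theorem rho_bracket u v : rho (lpq_bracket u v) = rho u * rho v - rho v * rho u.
Proof.
rewrite !rhoLR /= rhoL_bracket rhoR_bracket !mulrDl !mulrDr.
have [-> ->] := rhoLR0 u.1 v.2; have [-> ->] := rhoLR0 v.1 u.2.
by rewrite !addr0 !add0r opprD addrACA.
Qed.

Lemma sco0 m (a : 'rV[R]_m) (i : 'I_m) : i = 0%N :> nat -> sco a = a 0 i.
Proof.
move=> i0; rewrite /sco (bigD1 i) //= i0 mulr1n big1 ?addr0 // => j.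
by rewrite -val_eqE /= i0 => /negbTE ->; rewrite mulr0n.
Qed.

Let n3 : (2 < n)%N. Proof. by rewrite /n; lia. Qed.
Let i0 : 'I_n := Ordinal (ltn_trans (ltnW (ltnSn 1)) n3 : (0 < n)%N).
Let i1 : 'I_n := Ordinal (ltn_trans (ltnSn 1) n3 : (1 < n)%N).
Let lt1 : (p - 2 < n)%N. Proof. by rewrite /n; lia. Qed.
Let lt2 : (p - 1 < n)%N. Proof. by rewrite /n; lia. Qed.

Lemma Tm_powE u k : (k != 1)%N ->
  (Tm u ^+ k) i1 i0 = 0 /\ (Tm u ^+ k) (Ordinal lt1) (Ordinal lt2) = 0.
Proof.
case: k => [|[|k]] // _; first by rewrite expr0 !mxE -!val_eqE /=; case: eqP => // ?; lia.
rewrite TmX; split; rewrite mxE [X in X + _]mxE [X in _ + X]mxE;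
  by rewrite chain_upX ?chain_downX ?mulr0 ?addr0 //=; lia.
Qed.

Lemma Tm_1 u : (Tm u) i1 i0 = sco u.1 /\ (Tm u) (Ordinal lt1) (Ordinal lt2) = sco u.2.
Proof.
rewrite !mxE /=.
have -> : (3 <= p)%N by []. 
have -> : (p <= (p - 2).+2)%N by lia.
have -> : (p - 1 == (p - 2).+1)%N by lia.
have -> : (p - 2 == (p - 1).+1)%N = false by lia.
by rewrite /= ?andbF ?mulr1 ?mulr0 ?addr0 ?add0r ?mulr1.
Qed.

Lemma expm_Tm_entry u : (expm (Tm u)) i1 i0 = sco u.1 /\
  (expm (Tm u)) (Ordinal lt1) (Ordinal lt2) = sco u.2.
Proof.
rewrite /expm !summxE.
have n1 : (1 < n)%N by lia.
split; rewrite (bigD1 (Ordinal n1)) //= big1 ?addr0 => [|k ne].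
- by rewrite invr1 scale1r expr1; have [-> _] := Tm_1 u.
- by rewrite mxE; have [-> _] := Tm_powE u ne; rewrite mulr0.
- by rewrite invr1 scale1r expr1; have [_ ->] := Tm_1 u.
- by rewrite mxE; have [_ ->] := Tm_powE u ne; rewrite mulr0.
Qed.

Lemma Vm_x u (k : 'I_n) (i : 'I_p) : i = k.+1 :> nat ->
  (\sum_(i < p) (u.1 0 i *+ (i != 0%N :> nat)) *: chain_vec R n (i - 1)) k 0 = u.1 0 i.
Proof.
move=> e; rewrite summxE (bigD1 i) //= big1 ?addr0 => [|j ne].
  by rewrite !mxE e subn1 /= eqxx mulr1 mulr1n.
rewrite !mxE; case: (eqVneq (j : nat) 0%N) => [|j0]; rewrite ?mulr0n ?mul0r //.
case: eqP => [e'|]; rewrite ?mulr0 //.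
by move: ne; rewrite -val_eqE /=; lia.
Qed.

Lemma Vm_x0 u (k : 'I_n) : (p <= k.+1)%N ->
  (\sum_(i < p) (u.1 0 i *+ (i != 0%N :> nat)) *: chain_vec R n (i - 1)) k 0 = 0.
Proof.
move=> e; rewrite summxE big1 // => j _.
rewrite !mxE; case: (eqVneq (j : nat) 0%N) => [|j0]; rewrite ?mulr0n ?mul0r //.
by case: eqP => [e'|]; rewrite ?mulr0 //; have := ltn_ord j; lia.
Qed.

Lemma Vm_y u (k : 'I_n) (j : 'I_q) : (j + k)%N = n ->
  (\sum_(j < q) (u.2 0 j *+ (j != 0%N :> nat)) *: chain_vec R n (p + q - 3 - j)) k 0 = u.2 0 j.
Proof.
move=> e; have kn := ltn_ord k; rewrite summxE (bigD1 j) //= big1 ?addr0 => [|i ne].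
  rewrite !mxE -/n; have -> : (n - j)%N = k by lia.
  have -> : (j != 0%N :> nat) by lia.
  by rewrite eqxx mulr1.
rewrite !mxE; case: (eqVneq (i : nat) 0%N) => [|j0]; rewrite ?mulr0n ?mul0r //.
case: eqP => [e'|]; rewrite ?mulr0 //.
by move: ne e e' (ltn_ord i); rewrite -val_eqE /= /n; lia.
Qed.

Lemma Vm_y0 u (k : 'I_n) : (k + 2 < p)%N ->
  (\sum_(j < q) (u.2 0 j *+ (j != 0%N :> nat)) *: chain_vec R n (p + q - 3 - j)) k 0 = 0.
Proof.
move=> e; rewrite summxE big1 // => i _.
rewrite !mxE; case: (eqVneq (i : nat) 0%N) => [|j0]; rewrite ?mulr0n ?mul0r //.
by case: eqP => [e'|]; rewrite ?mulr0 //; have := ltn_ord i; lia.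
Qed.

Theorem rho_kernel u : rho u = 0 <-> central_ideal u.
Proof.
split=> [|[c ->]]; last first.
  rewrite rhoLR /= rhoLZ rhoRZ rhoL_basis rhoR_basis !leqnn !andbT.
  have -> : (0 < p)%N by lia.
  have -> : (0 < q)%N by lia.
  rewrite rxE ?ryE; try lia.
  have -> : (p + q - 2 - q)%N = (p - 2)%N by lia.
  by rewrite scaleNr subrr.
rewrite rhoE -aff00 => /aff_inj[hT hV].
have [s0 t0] := Tm_1 u; rewrite hT !mxE in s0 t0.
have pl : (p - 1 < p)%N by lia.
have ql : (q - 1 < q)%N by lia.
exists (u.1 0 (Ordinal pl)).
have hk k : Vm u k 0 = 0 by rewrite hV mxE.
case: u hV s0 t0 hk {hT} => a b /= _ s0 t0 hk; congr pair; apply/rowP => i; rewrite !mxE.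
  have [e|ne] := eqVneq i.+1 p.
    by rewrite mulr1; congr (a _ _); apply: val_inj => /=; lia.
  rewrite mulr0.
  have [z|nz] := eqVneq (i : nat) 0%N; first by rewrite -(sco0 a z).
  have lk : (i.-1 < n)%N by have := ltn_ord i; rewrite /n; lia.
  have := hk (Ordinal lk); rewrite /Vm mxE (@Vm_x (a, b) _ i) /=; last by lia.
  by rewrite (@Vm_y0 (a, b)) ?addr0 //=; have := ltn_ord i; lia.
have [z|nz] := eqVneq (i : nat) 0%N.
  rewrite -(sco0 b z) -t0; case: eqP => [|_]; last by rewrite mulr0.
  by rewrite z; lia.
have li := ltn_ord i.
have lk : (n - i < n)%N by rewrite /n; lia.
have := hk (Ordinal lk); rewrite /Vm mxE (@Vm_y (a, b) _ i) /=; last by rewrite /n; lia.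
have [e|ne] := eqVneq i.+1 q.
  rewrite (@Vm_x (a, b) _ (Ordinal pl)) /=; last by rewrite /n; lia.
  by move=> /eqP; rewrite mulr1 addr_eq0 => /eqP ->; rewrite opprK.
by rewrite (@Vm_x0 (a, b)) /= ?add0r ?mulr0 // /n; lia.
Qed.

Lemma rhoB u v : rho (u - v) = rho u - rho v.
Proof.
have hL a : rhoL (- a) = - rhoL a by rewrite -[- a]scaleN1r rhoLZ scaleN1r.
have hR a : rhoR (- a) = - rhoR a by rewrite -[- a]scaleN1r rhoRZ scaleN1r.
rewrite !rhoLR /= !rhoLD !rhoRD hL hR.
by rewrite opprD addrACA.
Qed.

Theorem expm_rho_eq u v : expm (rho u) = expm (rho v) <-> central_ideal (u - v).
Proof.
rewrite -rho_kernel rhoB; split=> [|/eqP]; last by rewrite subr_eq0 => /eqP ->.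
rewrite !expm_rho => /gaff_inj[hE].
have [a1 a2] := expm_Tm_entry u; have [b1 b2] := expm_Tm_entry v.
rewrite -hE a1 in b1; rewrite -hE a2 in b2. 
have hT : Tm u = Tm v by rewrite /Tm b1 b2.
rewrite hT; have [B hB] := phim_inv (Tm_nil v (leqnn n)).
have hB' : B *m phim (Tm v) = 1%:M by apply: mulmx1C.
move=> /(congr1 (mulmx B)); rewrite !mulmxA hB' !mul1mx => hV.
by rewrite !rhoE hT hV subrr.
Qed.
End Faithful.

Section MatrixContinuity.
Variable R : realType.
Variable X : topologicalType.

Lemma cont_mx m n (f : X -> 'M[R]_(m, n)) :
  (forall i j, continuous (fun x => f x i j)) -> continuous f.
Proof.
move=> cf x A [P PM PA]; apply: (@filterS _ _ _ [set y | forall i j, P i j (f y i j)]).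
  by move=> y Py; apply: PA.
apply: filter_forall => i; apply: filter_forall => j.
exact: (cf i j x).
Qed.

Lemma cont_entry m n (f : X -> 'M[R]_(m, n)) i j :
  continuous f -> continuous (fun x => f x i j).
Proof. by move=> cf x; exact: (continuous_comp (cf x) (@coord_continuous _ _ _ i j (f x))). Qed.

Lemma cont_mulmx m n k (f : X -> 'M[R]_(m, n)) (g : X -> 'M[R]_(n, k)) :
  continuous f -> continuous g -> continuous (fun x => f x *m g x).
Proof.
move=> cf cg; apply: cont_mx => i j.
rewrite (_ : (fun x => _) = (fun x => \sum_l f x i l * g x l j)); last first.
  by apply/funext => x; rewrite mxE.
apply: (@continuous_big R 'I_n +%R 0 predT add_continuous X (index_enum 'I_n)
  (fun l x => f x i l * g x l j)) => l _ x.
by apply: (@continuousM _ _ (fun x => f x i l) (fun x => g x l j)); exact: cont_entry.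
Qed.

Lemma cont_addmx m n (f g : X -> 'M[R]_(m, n)) :
  continuous f -> continuous g -> continuous (fun x => f x + g x).
Proof.
move=> cf cg; apply: cont_mx => i j.
rewrite (_ : (fun x => _) = (fun x => f x i j + g x i j)); last first.
  by apply/funext => x; rewrite mxE.
by move=> x; apply: (@continuousD _ R _ (fun x => f x i j) (fun x => g x i j)); exact: cont_entry.
Qed.

Lemma cont_oppmx m n (f : X -> 'M[R]_(m, n)) :
  continuous f -> continuous (fun x => - f x).
Proof.
move=> cf; apply: cont_mx => i j.
rewrite (_ : (fun x => _) = (fun x => - f x i j)); last first.
  by apply/funext => x; rewrite mxE.
by move=> x; apply: (@continuousN _ R _ (fun x => f x i j)); exact: cont_entry.
Qed.

Lemma cont_exp n (f : X -> 'M[R]_n) k : continuous f -> continuous (fun x => f x ^+ k).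
Proof.
move=> cf; elim: k => [|k IH].
  by under eq_fun do rewrite expr0; exact: cst_continuous.
under eq_fun do rewrite exprS -mulmxE.
exact: cont_mulmx.
Qed.

Lemma cont_geom n k (f : X -> 'M[R]_n) :
  continuous f -> continuous (fun x => \sum_(i < k) (1 - f x) ^+ i).
Proof.
move=> cf; elim: k => [|k IH].
  by under eq_fun do rewrite big_ord0; exact: cst_continuous.
under eq_fun do rewrite big_ord_recr /=.
apply: cont_addmx => //; apply: cont_exp; apply: cont_addmx; first exact: cst_continuous.
exact: cont_oppmx.
Qed.
End MatrixContinuity.

Section CentralProductGroup.
Variable R : realType.

(* The map rho induces an isomorphism of g_{p,q} onto a Lie algebra of nilpotent
   matrices (rho_bracket, rho_kernel, rho_nilpotent), hence exp(rho(g_{p,q})),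
   with the topology of matrices, is the simply connected Lie group with Lie
   algebra g_{p,q}.  By expm_rho_eq, exp is a bijection of g_{p,q} onto it. *)
Definition is_exp_rho (p q : nat) (M : 'M[R]_(p + q - 3 + 1)) : bool :=
  `[< exists u : 'rV[R]_p * 'rV[R]_q, M = expm (rho u) >].

Definition central_product_group (p q : nat) : Type :=
  {M : 'M[R]_(p + q - 3 + 1) | @is_exp_rho p q M}.

Variables p q : nat.
Local Notation G := (central_product_group p q).

HB.instance Definition _ := [isSub of G for sval].
HB.instance Definition _ := [Choice of G by <:].
HB.instance Definition _ := Topological.copy G
  (initial_topology (val : G -> 'M[R]_(p + q - 3 + 1))).

Local Notation N := (p + q - 3 + 1)%N.

Lemma cpg_exp (x : G) : exists u, val x = expm (rho u).
Proof. exact/asboolP/(valP x). Qed.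

Fact cpg_mul_proof (x y : G) : @is_exp_rho p q (val x *m val y).
Proof.
apply/asboolP; have [u ->] := cpg_exp x; have [v ->] := cpg_exp y.
by have [w] := expm_rho_mul u v; exists w.
Qed.

Fact cpg_one_proof : @is_exp_rho p q 1%:M.
Proof.
apply/asboolP; exists 0; have -> : rho 0 = 0 :> 'M[R]_N; last by rewrite expm0.
by rewrite /rho !big1 ?addr0 // => i _; rewrite mxE scale0r.
Qed.

Lemma invmx_expm (u : 'rV[R]_p * 'rV[R]_q) : invmx (expm (rho u)) = expm (rho (- u)).
Proof.
have h := expm_rhoN u; have [hu _] := mulmx1_unit h.
by rewrite -[RHS](mulKmx hu) [_ *m expm _]h mulmx1.
Qed.

Fact cpg_inv_proof (x : G) : @is_exp_rho p q (invmx (val x)).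
Proof.
apply/asboolP; have [u ->] := cpg_exp x.
by exists (- u); rewrite invmx_expm.
Qed.

Definition cpg_mul (x y : G) : G := exist (@is_exp_rho p q) _ (cpg_mul_proof x y).
Definition cpg_one : G := exist (@is_exp_rho p q) _ cpg_one_proof.
Definition cpg_inv (x : G) : G := exist (@is_exp_rho p q) _ (cpg_inv_proof x).

Lemma cpg_unitmx (x : G) : val x \in unitmx.
Proof.
by have [u ->] := cpg_exp x; have [] := mulmx1_unit (expm_rhoN u).
Qed.

Fact cpg_mulA : associative cpg_mul.
Proof. by move=> x y z; apply: val_inj; rewrite /= mulmxA. Qed.
Fact cpg_mul1g : left_id cpg_one cpg_mul.
Proof. by move=> x; apply: val_inj; rewrite /= mul1mx. Qed.
Fact cpg_mulg1 : right_id cpg_one cpg_mul.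
Proof. by move=> x; apply: val_inj; rewrite /= mulmx1. Qed.
Fact cpg_mulVg : left_inverse cpg_one cpg_inv cpg_mul.
Proof. by move=> x; apply: val_inj; rewrite /= mulVmx ?cpg_unitmx. Qed.
Fact cpg_mulgV : right_inverse cpg_one cpg_inv cpg_mul.
Proof. by move=> x; apply: val_inj; rewrite /= mulmxV ?cpg_unitmx. Qed.

HB.instance Definition _ := isGroup.Build G
  cpg_mulA cpg_mul1g cpg_mulg1 cpg_mulVg cpg_mulgV.

Lemma cpg_val_continuous : continuous (val : G -> 'M[R]_N).
Proof. exact: initial_continuous. Qed.

Fact cpg_mul_continuous : continuous (fun x : G * G => (x.1 * x.2)%g).
Proof.
apply: continuous_comp_initial.
apply: (@cont_mulmx R _ _ _ _ (fun x : G * G => val x.1) (fun x => val x.2)) => x.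
  by apply: (@continuous_comp _ _ _ (@fst G G) val); [exact: cvg_fst|exact: cpg_val_continuous].
by apply: (@continuous_comp _ _ _ (@snd G G) val); [exact: cvg_snd|exact: cpg_val_continuous].
Qed.

Lemma cpg_inv_geom (x : G) : invmx (val x) = \sum_(i < N) (1 - val x) ^+ i.
Proof.
have h : val x *m (\sum_(i < N) (1 - val x) ^+ i) = 1%:M.
  have [u ->] := cpg_exp x;
  exact: (geom_inv (expm_unipotent (rho_nilpotent u))).
by rewrite -[RHS](mulKmx (cpg_unitmx x)) h mulmx1.
Qed.

Fact cpg_inv_continuous : continuous (fun x : G => (x^-1)%g).
Proof.
apply: continuous_comp_initial.
rewrite (_ : _ \o _ = (fun x : G => \sum_(i < N) (1 - val x) ^+ i)); last first.
  by apply/funext => x; rewrite -cpg_inv_geom.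
exact/cont_geom/cpg_val_continuous.
Qed.

HB.instance Definition _ := isTopologicalGroup.Build G
  cpg_mul_continuous cpg_inv_continuous.

End CentralProductGroup.

(* Main.v *)
(* The group G_{p,q} is E / antidiag, where E is the product of two copies of the
   group L of pairs (s, f), with s real and f a polynomial on which s acts by
   translation.  A filling of a word is obtained from a homotopy, that is, a
   sequence of moves by relators of length at most 4 at distance O(n) from 1.

   By induction on k, null-homotopic words of length n in one copy of l_k have
   area O(n^(k-1)).  For k = 3 they are contracted by an isotropic homotopy in
   the product of two Heisenberg groups.  In general, words in both factors reduce
   to words in the first one: if w has central value, then w together with its
   mirror image in the second factor is contracted by the dilations of l_k in
   n^(k-2) steps, because the central terms of the two factors cancel.

   For the step from k - 1 to k, a word whose total exponent in the top generator
   a = 'X^(k-2) is bounded can be pushed into l_(k-1), at cost O(n^(k-2)) by the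
   induction hypothesis for the product of two copies of l_(k-1).  Each element is
   written in a normal form, a product of k - 1 blocks x^s a^t x^(-s) (whose
   exponents t solve a Vandermonde system) and a power of x.  It costs O(n^(k-2))
   to multiply the normal form by a letter: two blocks commute at this cost,
   because x^s a x^(-s) is homotopic to a diagonal path of length n^(k-3) followed
   by a word in the other factor.  The n letters together cost O(n^(k-1)).

   Finally, by Baire every compact generating set has a power which contains a
   given compact set, which makes the bound independent of the presentation. *)

Require Import Defs.
From HB Require Import structures.
From mathcomp Require Import all_boot all_order all_algebra.
From mathcomp Require Import all_classical all_reals all_analysis.
From mathcomp Require Import ring lra zify finmap.
Set Implicit Arguments.
Unset Strict Implicit.
Unset Printing Implicit Defensive.

(** * Words and homotopies *)

(** A word of length n in l_k passes through points whose central coordinate has order n^(k-1), one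
    power of n more than any other coordinate. Contracting it by dilations inside a single l_k
    therefore takes n^(k-1) steps across n letters, that is, n^k relators. The saving of one power
    rests on letters that are bounded only modulo the antidiagonal: a letter of E may have huge
    constant terms in its two factors as long as their sum is bounded. Paths along which the two
    central coordinates cancel move as if the centre were absent, and n^(k-2) steps are enough for
    them. Homotopies are made in E, where the two factors commute exactly and equality modulo the
    antidiagonal is explicit; lengths, distances and areas are carried to the given group only at
    the end. In the polynomial model, conjugation by x is a translation, so that the estimates
    become weighted bounds on coefficients, which a translation by O(n) preserves up to a
    constant. *)

Lemma cat_split T (u v u1 u2 : seq T) : u ++ v = u1 ++ u2 ->
  (exists w, u = u1 ++ w /\ u2 = w ++ v) \/ (exists w, u1 = u ++ w /\ v = w ++ u2).
Proof.
elim: u u1 => [|x u IH] [|y u1] /= e.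
- by left; exists [::].
- by right; exists (y :: u1).
- by left; exists (x :: u).
- case: e => -> /IH[[w [-> ->]]|[w [-> ->]]]; [left|right]; by exists w.
Qed.

(* Words in E represent elements of the quotient of E by this subgroup. *)
Record central_subgroup (E : groupType) := CentralSubgroup {
  csub :> E -> Prop;
  csub1 : csub 1%g;
  csubM : forall x y, csub x -> csub y -> csub (x * y)%g;
  csubV : forall x, csub x -> csub (x^-1)%g;
  csubC : forall a x, csub a -> (a * x = x * a)%g }.

Section Homotopy.
Variables (E : groupType) (A : central_subgroup E).
Let A1 : A 1%g := csub1 A.
Let AM x y : A x -> A y -> A (x * y)%g := @csubM E A x y.
Let AV x : A x -> A (x^-1)%g := @csubV E A x.
Let AC a x : A a -> (a * x = x * a)%g := @csubC E A a x.

Implicit Types (S T : E -> Prop) (u v w : seq E) (x y : E) (g h : nat -> E) (d e N : nat).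

Definition eqA x y : Prop := A (x^-1 * y)%g.

Definition wval w : E := (\prod_(x <- w) x)%g.

Definition wover S w : Prop := forall x, x \in w -> S x.

Definition ball S d (g : E) : Prop :=
  exists w, [/\ wover S w, size w <= d & eqA (wval w) g].

Definition rad S d u : Prop := forall u1 u2, u = u1 ++ u2 -> ball S d (wval u1).

(* With htpy S d N w [::], w has a filling of area N and diameter d by relators
   of length at most 4. *)
Inductive htpy S d : nat -> seq E -> seq E -> Prop :=
| htpy_refl N w : htpy S d N w w
| htpy_step N u r r' v w : rad S d u -> size r + size r' <= 4 ->
    wover S r -> wover S r' -> eqA (wval r) (wval r') ->
    htpy S d N (u ++ r' ++ v) w -> htpy S d N.+1 (u ++ r ++ v) w.

Lemma eqA_refl x : eqA x x. Proof. by rewrite /eqA mulVg. Qed.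
Lemma eqA_sym x y : eqA x y -> eqA y x.
Proof. by move/AV; rewrite /eqA invgM invgK. Qed.
Lemma eqAM x x' y y' : eqA x x' -> eqA y y' -> eqA (x * y)%g (x' * y')%g.
Proof.
move=> h1 h2; rewrite /eqA.
have -> : ((x * y)^-1 * (x' * y') = (y^-1 * y') * (x^-1 * x'))%g; last exact: AM.
by rewrite invgM -!mulgA; congr (_ * _)%g; rewrite mulgA (AC _ h1).
Qed.

Lemma wval_nil : wval [::] = 1%g. Proof. by rewrite /wval big_nil. Qed.
Lemma wval1 x : wval [:: x] = x. Proof. by rewrite /wval big_seq1. Qed.
Lemma wval_cons x w : wval (x :: w) = (x * wval w)%g.
Proof. by rewrite /wval big_cons. Qed.
Lemma wval_cat u v : wval (u ++ v) = (wval u * wval v)%g.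
Proof. by rewrite /wval big_cat. Qed.
Lemma wval_rcons w x : wval (rcons w x) = (wval w * x)%g.
Proof. by rewrite -cats1 wval_cat wval1. Qed.
Lemma wval_nseq n x : wval (nseq n x) = (x ^+ n)%g.
Proof. by elim: n => [|n IH]; rewrite ?wval_nil //= wval_cons IH expgS. Qed.

Lemma wover_cons S x w : S x -> wover S w -> wover S (x :: w).
Proof. by move=> h1 h2 y; rewrite inE => /predU1P[->|/h2]. Qed.
Lemma wover1 S x : S x -> wover S [:: x].
Proof. by move=> h; apply: wover_cons. Qed.
Lemma wover_cat S u v : wover S u -> wover S v -> wover S (u ++ v).
Proof. by move=> h1 h2 y; rewrite mem_cat => /orP[/h1|/h2]. Qed.
Lemma wover_catl S u v : wover S (u ++ v) -> wover S u.
Proof. by move=> h y hy; apply: h; rewrite mem_cat hy. Qed.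
Lemma wover_nseq S n x : S x -> wover S (nseq n x).
Proof. by move=> h y; rewrite mem_nseq => /andP[_ /eqP ->]. Qed.
Lemma wover_sub S T w : (forall x, S x -> T x) -> wover S w -> wover T w.
Proof. by move=> h hw x /hw /h. Qed.

Lemma ball1 S d : ball S d 1%g.
Proof. by exists [::]; split=> //; rewrite wval_nil; apply: eqA_refl. Qed.
Lemma ballM S d e x y : ball S d x -> ball S e y -> ball S (d + e) (x * y)%g.
Proof.
move=> [w [h1 h2 h3]] [w' [h1' h2' h3']]; exists (w ++ w'); split.
- exact: wover_cat.
- by rewrite size_cat leq_add.
- by rewrite wval_cat; apply: eqAM.
Qed.
Lemma ball_word S w : wover S w -> ball S (size w) (wval w).
Proof. by move=> h; exists w; split=> //; apply: eqA_refl. Qed.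
Lemma ball_letter S x : S x -> ball S 1 x.
Proof. by move=> h; have := ball_word (wover1 h); rewrite wval1. Qed.
Lemma ball_sub S T d e x : (forall y, S y -> T y) -> d <= e -> ball S d x -> ball T e x.
Proof.
move=> h le [w [h1 h2 h3]]; exists w; split=> //; [exact: wover_sub h1|exact: leq_trans le].
Qed.

Lemma rad_nil S d : rad S d [::].
Proof. by case=> [|x u1] u2 //= _; rewrite wval_nil; apply: ball1. Qed.
Lemma rad_sub S T d e u : (forall y, S y -> T y) -> d <= e -> rad S d u -> rad T e u.
Proof. by move=> h le hr u1 u2 /hr; apply: ball_sub. Qed.
Lemma rad_le S d e u : d <= e -> rad S d u -> rad S e u.
Proof. by move=> le; apply: rad_sub. Qed.
Lemma rad_prefix S d u v : rad S d (u ++ v) -> rad S d u.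
Proof. by move=> h u1 u2 e; apply: (h u1 (u2 ++ v)); rewrite e catA. Qed.
Lemma rad_val S d u : rad S d u -> ball S d (wval u).
Proof. by move=> h; apply: (h u [::]); rewrite cats0. Qed.
Lemma rad_word S u : wover S u -> rad S (size u) u.
Proof.
move=> h u1 u2 e; apply: (@ball_sub S S (size u1)) => //.
  by rewrite e size_cat leq_addr.
by apply: ball_word; move: h; rewrite e; apply: wover_catl.
Qed.
Lemma rad_short S d u : wover S u -> size u <= d -> rad S d u.
Proof. by move=> h le; apply: rad_le le _; apply: rad_word. Qed.

Lemma rad_cat S d e u v : ball S d (wval u) -> rad S (d + e) u -> rad S e v ->
  rad S (d + e) (u ++ v).
Proof.
move=> hb hu hv u1 u2 /cat_split[[w [eu _]]|[w [-> hw]]]; first exact: hu eu.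
by rewrite wval_cat; apply: ballM => //; apply: (hv w u2).
Qed.
Lemma rad_cat' S d e u v : rad S d u -> rad S e v -> rad S (d + e) (u ++ v).
Proof.
move=> hu hv; apply: rad_cat => //; first exact: rad_val.
by apply: rad_le hu; rewrite leq_addr.
Qed.

Lemma htpy_leN S d N N' u v : N <= N' -> htpy S d N u v -> htpy S d N' u v.
Proof.
move=> le h; elim: h N' le => [N1 w|N1 u' r r' v' w h1 h2 h3 h4 h5 _ IH] [|N'] // le.
- exact: htpy_refl.
- exact: htpy_refl.
- by apply: (@htpy_step _ _ _ _ _ r') => //; apply: IH.
Qed.

Lemma htpy_trans S d N1 N2 u v w :
  htpy S d N1 u v -> htpy S d N2 v w -> htpy S d (N1 + N2) u w.
Proof.
move=> h; elim: h w => [N w w' h|N u' r r' v' w h1 h2 h3 h4 h5 _ IH w' h].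
  by apply: htpy_leN h; rewrite leq_addl.
by rewrite addSn; apply: (@htpy_step _ _ _ _ _ r') => //; apply: IH.
Qed.

Lemma htpy_base S d u v r r' : rad S d u -> size r + size r' <= 4 ->
  wover S r -> wover S r' -> eqA (wval r) (wval r') ->
  htpy S d 1 (u ++ r ++ v) (u ++ r' ++ v).
Proof. by move=> *; apply: (@htpy_step _ _ _ _ _ r') => //; apply: htpy_refl. Qed.

Lemma htpy_sym S d N u v : htpy S d N u v -> htpy S d N v u.
Proof.
elim=> [N' w|N' u' r r' v' w h1 h2 h3 h4 h5 _ IH]; first exact: htpy_refl.
rewrite -addn1; apply: htpy_trans IH _; apply: htpy_base => //; first by rewrite addnC.
exact: eqA_sym.
Qed.

Lemma htpy_sub S T d e N u v : (forall y, S y -> T y) -> d <= e ->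
  htpy S d N u v -> htpy T e N u v.
Proof.
move=> hs le; elim=> [N' w|N' u' r r' v' w h1 h2 h3 h4 h5 _ IH]; first exact: htpy_refl.
apply: (@htpy_step _ _ _ _ _ r') => //; first exact: rad_sub h1.
  exact: wover_sub h3.
exact: wover_sub h4.
Qed.

Lemma htpy_cong S d e N u v w w' : rad S e u -> htpy S d N w w' ->
  htpy S (e + d) N (u ++ w ++ v) (u ++ w' ++ v).
Proof.
move=> hu; elim=> [N' w1|N' u' r r' v' w1 h1 h2 h3 h4 h5 _ IH]; first exact: htpy_refl.
have E1 (s : seq E) : u ++ (u' ++ s ++ v') ++ v = (u ++ u') ++ s ++ (v' ++ v) by rewrite !catA.
rewrite E1; apply: (@htpy_step _ _ _ _ _ r') => //; last by rewrite -E1.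
exact: rad_cat'.
Qed.

Lemma htpy_catr S d N v w w' : htpy S d N w w' -> htpy S d N (w ++ v) (w' ++ v).
Proof. by move=> h; apply: (@htpy_cong S d 0 N [::] v) => //; apply: rad_nil. Qed.
Lemma htpy_catl S d e N u w w' : rad S e u -> htpy S d N w w' ->
  htpy S (e + d) N (u ++ w) (u ++ w').
Proof. by move=> hu h; have := htpy_cong [::] hu h; rewrite !cats0. Qed.

(** The word spelled by the path [g 0], ..., [g m]: homotopies of words are described below by the
    vertices that the paths visit, and [pw_word] recovers any word from its prefixes. *)
Definition pw (g : nat -> E) m : seq E := [seq ((g j)^-1 * g j.+1)%g | j <- iota 0 m].

Lemma size_pw g m : size (pw g m) = m. Proof. by rewrite size_map size_iota. Qed.
Lemma pwS g m : pw g m.+1 = rcons (pw g m) ((g m)^-1 * g m.+1)%g.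
Proof. by rewrite /pw -[in LHS]addn1 iotaD map_cat /= cats1. Qed.
Lemma wval_pw g m : wval (pw g m) = ((g 0)^-1 * g m)%g.
Proof.
elim: m => [|m IH]; first by rewrite wval_nil mulVg.
by rewrite pwS wval_rcons IH mulgA mulgK.
Qed.
Lemma wover_pw S g m : (forall j, j < m -> S ((g j)^-1 * g j.+1)%g) -> wover S (pw g m).
Proof. by move=> h x /mapP[j]; rewrite mem_iota => /andP[_ lt] ->; apply: h. Qed.
Lemma pw_take g m i : take i (pw g m) = pw g (minn i m).
Proof. by rewrite /pw -map_take take_iota. Qed.
Lemma rad_pw S d g m : (forall j, j <= m -> ball S d ((g 0)^-1 * g j)%g) -> rad S d (pw g m).
Proof.
move=> h u1 u2 e; have -> : u1 = take (size u1) (pw g m) by rewrite e take_size_cat.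
by rewrite pw_take wval_pw; apply: h; rewrite geq_minr.
Qed.
Lemma pw_word w : pw (fun j => wval (take j w)) (size w) = w.
Proof.
elim/last_ind: w => [//|w x IH]; rewrite size_rcons pwS; congr rcons.
  rewrite -[RHS]IH; apply/eq_in_map => j; rewrite mem_iota add0n => /andP[_ lt].
  rewrite -cats1 !take_cat lt; case: ltnP => // le.
  have -> : j.+1 - size w = 0 by lia.
  by rewrite take0 cats0 [take j.+1 w]take_oversize.
by rewrite -cats1 take_size_cat // take_oversize ?size_cat ?addn1 // wval_cat wval1 mulKg.
Qed.

(** The last rung is pushed back to the first one across [m] squares, each of them a relator of
    length 4. Only the side [g] has to stay in a ball, since every relator is applied after a prefix
    of it. *)
Lemma ladder S d m (g h : nat -> E) :
  (forall j, j < m -> S ((g j)^-1 * g j.+1)%g) ->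
  (forall j, j < m -> S ((h j)^-1 * h j.+1)%g) ->
  (forall j, j <= m -> S ((g j)^-1 * h j)%g) ->
  (forall j, j <= m -> ball S d ((g 0)^-1 * g j)%g) ->
  htpy S d m (pw g m ++ [:: ((g m)^-1 * h m)%g]) (((g 0)^-1 * h 0)%g :: pw h m).
Proof.
elim: m => [|m IH] hg hh hc hb; first exact: htpy_refl.
rewrite [pw h _]pwS -rcons_cons -[rcons _ _]cats1 -addn1 addnC; apply: htpy_trans; last first.
  by apply: htpy_catr; apply: IH => j lt; first [exact: hg (ltnW _) | apply: hg; lia
   | apply: hh; lia | apply: hc; lia | apply: hb; lia].
rewrite pwS -cats1 -!catA; apply: (@htpy_base S d (pw g m) [::] [:: _; _] [:: _; _]) => //.
- by apply: rad_pw => j le; apply: hb; lia.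
- by apply: wover_cons; [exact: hg | apply: wover1; exact: hc].
- by apply: wover_cons; [exact: hc | apply: wover1; exact: hh].
- by rewrite !wval_cons wval_nil !mulg1 !mulgA !mulgK; apply: eqA_refl.
Qed.

Definition winv w : seq E := rev [seq (x^-1)%g | x <- w].

Lemma size_winv w : size (winv w) = size w. Proof. by rewrite size_rev size_map. Qed.
Lemma winv_rcons w x : winv (rcons w x) = (x^-1)%g :: winv w.
Proof. by rewrite /winv map_rcons rev_rcons. Qed.
Lemma winv_cons w x : winv (x :: w) = rcons (winv w) (x^-1)%g.
Proof. by rewrite /winv /= rev_cons. Qed.
Lemma winv_nseq n x : winv (nseq n x) = nseq n (x^-1)%g.
Proof. by rewrite /winv map_nseq; elim: n => //= n IH; rewrite rev_cons IH; elim: n {IH} => //= n ->. Qed.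
Lemma winvK : involutive winv.
Proof. by move=> w; rewrite /winv map_rev revK mapK //; exact: invgK. Qed.
Lemma wval_winv w : wval (winv w) = ((wval w)^-1)%g.
Proof.
by elim: w => [|x w IH]; rewrite ?wval_nil ?invg1 // winv_cons wval_rcons IH wval_cons invgM.
Qed.

Definition symm S := forall x, S x -> S (x^-1)%g.

Lemma wover_winv S w : symm S -> wover S w -> wover S (winv w).
Proof. by move=> hs hw x; rewrite mem_rev => /mapP[y /hw/hs hy ->]. Qed.

Lemma ballV S d x : symm S -> ball S d x -> ball S d (x^-1)%g.
Proof.
move=> hs [w [h1 h2 h3]]; exists (winv w); split; [exact: wover_winv|by rewrite size_winv|].
rewrite wval_winv /eqA invgK; have := AV h3; rewrite invgM invgK => h.
have -> : (wval w * x^-1 = x * (x^-1 * wval w) * x^-1)%g by rewrite mulVKg.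
by rewrite -(AC _ h) mulgK.
Qed.

Lemma htpy_wV S d w : symm S -> wover S w -> rad S d w -> htpy S d (size w) (w ++ winv w) [::].
Proof.
move=> hs; elim/last_ind: w => [|w x IH] hw hr; first exact: htpy_refl.
have hx : S x by apply: hw; rewrite mem_rcons mem_head.
have hw' : wover S w by move=> y hy; apply: hw; rewrite mem_rcons inE hy orbT.
have hr' : rad S d w by move: hr; rewrite -cats1; apply: rad_prefix.
rewrite size_rcons winv_rcons -cats1 -catA.
apply: (@htpy_step S d _ w [:: x; (x^-1)%g] [::]) => //.
- by apply: wover_cons => //; apply: wover1; exact: hs.
- by rewrite !wval_cons wval_nil mulg1 mulgV; apply: eqA_refl.
- exact: IH.
Qed.

Lemma swap1 S d x v : S x -> wover S v -> rad S d v ->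
  (forall y, y \in v -> eqA (x * y)%g (y * x)%g) ->
  htpy S d (size v) (x :: v) (rcons v x).
Proof.
move=> hx; elim/last_ind: v => [|v y IH] hv hr hc; first exact: htpy_refl.
have hy : S y by apply: hv; rewrite mem_rcons mem_head.
have hv' : wover S v by move=> z hz; apply: hv; rewrite mem_rcons inE hz orbT.
have hr' : rad S d v by move: hr; rewrite -cats1; apply: rad_prefix.
rewrite size_rcons -addn1; apply: (@htpy_trans _ _ _ _ _ (rcons v x ++ [:: y])).
  rewrite -rcons_cons -cats1; apply: htpy_catr; apply: IH => // z hz.
  by apply: hc; rewrite mem_rcons inE hz orbT.
rewrite -!cats1 -!catA; apply: (@htpy_base S d v [::] [:: _; _] [:: _; _]) => //.
- by apply: wover_cons => //; apply: wover1.
- by apply: wover_cons => //; apply: wover1.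
- by rewrite !wval_cons wval_nil !mulg1; apply: hc; rewrite mem_rcons mem_head.
Qed.

Lemma swap S d e u v : wover S u -> wover S v -> rad S d u -> rad S e v ->
  (forall x y, x \in u -> y \in v -> eqA (x * y)%g (y * x)%g) ->
  htpy S (d + e) (size u * size v) (u ++ v) (v ++ u).
Proof.
elim/last_ind: u => [|u x IH] hu hv hr he hc; first by rewrite cats0; exact: htpy_refl.
have hx : S x by apply: hu; rewrite mem_rcons mem_head.
have hu' : wover S u by move=> z hz; apply: hu; rewrite mem_rcons inE hz orbT.
have hr' : rad S d u by move: hr; rewrite -cats1; apply: rad_prefix.
rewrite size_rcons mulSn; apply: (@htpy_trans _ _ _ _ _ (u ++ rcons v x)).
  rewrite cat_rcons; apply: htpy_catl => //; apply: swap1 => // y hy.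
  by apply: hc => //; rewrite mem_rcons mem_head.
rewrite -!cats1 !catA; apply: htpy_catr; apply: IH => // y z hy hz.
by apply: hc => //; rewrite mem_rcons inE hy orbT.
Qed.

Lemma nseq_rcons n x : nseq n.+1 x = rcons (nseq n x) x.
Proof. by elim: n => //= n <-. Qed.

(** Every new copy of [z] is cut into [x] and [y], and this [y] then crosses the copies of [x]
    already present; this is the quadratic area of a triangle in a flat. *)
Lemma pow_split S n x y z : S x -> S y -> S z -> eqA z (x * y)%g -> eqA (x * y)%g (y * x)%g ->
  htpy S (2 * n) (n * n) (nseq n z) (nseq n x ++ nseq n y).
Proof.
move=> hx hy hz e1 e2; elim: n => [|n IH]; first exact: htpy_refl.
apply: (@htpy_leN _ _ (n * n + (1 + n))); first by lia.
have r2 : rad S 2 [:: x; y] by apply: rad_short => //; apply: wover_cons => //; apply: wover1.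
apply: (@htpy_trans _ _ _ _ _ (z :: nseq n x ++ nseq n y)).
  rewrite /= -cat1s -[z :: _ ++ _]cat1s.
  apply: (@htpy_sub S S (1 + 2 * n)) => //; first by lia.
  by apply: htpy_catl => //; apply: rad_short => //; apply: wover1.
apply: (@htpy_trans _ _ _ _ _ (x :: y :: nseq n x ++ nseq n y)).
  apply: (@htpy_base S _ [::] _ [:: z] [:: x; y]) => //; first exact: rad_nil.
  - exact: wover1.
  - by apply: wover_cons => //; apply: wover1.
  - by rewrite wval1 !wval_cons wval_nil mulg1.
apply: (@htpy_sub S S (1 + n)) => //; first by lia.
rewrite /= -[X in htpy _ _ _ X]cat1s -[x :: _ ++ _]cat1s.
apply: htpy_catl; first by apply: rad_short => //; apply: wover1.
have -> : nseq n x ++ y :: nseq n y = rcons (nseq n x) y ++ nseq n y by rewrite cat_rcons.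
rewrite -cat_cons; apply: htpy_catr; apply: (@htpy_leN _ _ (size (nseq n x))).
  by rewrite size_nseq.
apply: swap1 => //.
- exact: wover_nseq.
- by apply: rad_short; [exact: wover_nseq | rewrite size_nseq].
- by move=> t; rewrite mem_nseq => /andP[_ /eqP ->]; apply: eqA_sym.
Qed.

(** The cost is linear, not quadratic, because every intermediate power is itself a letter; the
    extra move inserts the letter [x ^+ 0]. *)
Lemma collapse S n x : (forall i, i <= n -> S (x ^+ i)%g) ->
  htpy S 0 n.+1 (nseq n x) [:: (x ^+ n)%g].
Proof.
move=> h; suff H i : i <= n -> htpy S 0 i.+1 (nseq n x) ((x ^+ i)%g :: nseq (n - i) x).
  by have := H n (leqnn _); rewrite subnn.
elim: i => [|i IH] le.
  rewrite subn0; apply: (@htpy_base S 0 [::] (nseq n x) [::] [:: _]) => //; first exact: rad_nil.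
  - by apply: wover1; apply: h.
  - by rewrite wval_nil wval1; apply: eqA_refl.
rewrite -addn1; apply: htpy_trans (IH (ltnW le)) _.
have -> : n - i = (n - i.+1).+1 by lia.
apply: (@htpy_base S 0 [::] _ [:: _; _] [:: _]) => //; first exact: rad_nil.
- apply: wover_cons; first exact: h (ltnW le).
  by apply: wover1; rewrite -[x]expg1; apply: h; lia.
- by apply: wover1; apply: h.
- by rewrite wval1 !wval_cons wval_nil mulg1 -expgSr; apply: eqA_refl.
Qed.

(** Each letter is factored in turn, and its first half then crosses the second halves accumulated
    so far. *)
Lemma split_word S (a b : E -> E) w : wover S w ->
  (forall x, x \in w -> [/\ S (a x), S (b x) & eqA x (a x * b x)%g]) ->
  (forall x y, x \in w -> y \in w -> eqA (a x * b y)%g (b y * a x)%g) ->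
  htpy S (2 * size w) (size w * size w) w (map a w ++ map b w).
Proof.
elim/last_ind: w => [|w x IH] hw hab hc; first exact: htpy_refl.
have hx : x \in rcons w x by rewrite mem_rcons mem_head.
have hi y : y \in w -> y \in rcons w x by move=> hy; rewrite mem_rcons inE hy orbT.
have hw' : wover S w by move=> z hz; apply: hw; apply: hi.
have [ha hb e] := hab _ hx.
have oa : wover S (map a w) by move=> z /mapP[y /hi/hab[? _ _] ->].
have ob : wover S (map b w) by move=> z /mapP[y /hi/hab[_ ? _] ->].
rewrite size_rcons; set n := size w.
apply: (@htpy_leN _ _ (1 + (n * n + n))); first by lia.
apply: (@htpy_trans _ _ _ _ _ (w ++ [:: a x; b x])).
  rewrite -cats1; apply: (@htpy_base S _ w [::] [:: x] [:: _; _]) => //.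
  - by apply: rad_short => //; rewrite /n; lia.
  - by apply: wover1; exact: hw.
  - by apply: wover_cons => //; apply: wover1.
  - by rewrite wval1 !wval_cons wval_nil mulg1.
apply: (@htpy_trans _ _ _ _ _ ((map a w ++ map b w) ++ [:: a x; b x])).
  apply: htpy_catr; apply: (@htpy_sub S S (2 * n)) => //; first by rewrite /n; lia.
  by apply: IH => // [y /hi|y z /hi ? /hi ?]; [apply: hab | apply: hc].
have -> : [:: a x; b x] = [:: a x] ++ [:: b x] by [].
rewrite !map_rcons -!cats1 -!catA; rewrite [map b w ++ _]catA [[:: a x] ++ map b w ++ _]catA.
apply: (@htpy_sub S S (n + n)) => //; first by lia.
apply: htpy_cong; first by apply: rad_short => //; rewrite size_map.
rewrite cats1; apply: htpy_sym; apply: (@htpy_leN _ _ (size (map b w))).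
  by rewrite size_map.
apply: swap1 => //.
  by apply: rad_short => //; rewrite size_map.
by move=> z /mapP[y /hi hy ->]; apply: hc.
Qed.

Lemma htpy_null S d w : wover S w -> rad S d w -> (forall x, x \in w -> eqA x 1%g) ->
  htpy S d (size w) w [::].
Proof.
elim/last_ind: w => [|w x IH] hw hr h1; first exact: htpy_refl.
have hi y : y \in w -> y \in rcons w x by move=> hy; rewrite mem_rcons inE hy orbT.
have hx : x \in rcons w x by rewrite mem_rcons mem_head.
have hr' : rad S d w by move: hr; rewrite -cats1; apply: rad_prefix.
rewrite size_rcons -cats1; apply: (@htpy_step S d _ w [:: x] [::] [::]) => //.
- by apply: wover1; apply: hw.
- by rewrite wval1 wval_nil; apply: h1.
- rewrite !cats0; apply: IH => // y /hi hy; [exact: hw | exact: h1].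
Qed.

(* The rows of the grid g are successively deformed into each other; the moving
   endpoints contribute a conjugation. *)
Lemma rows_null S d m N (g : nat -> nat -> E) : symm S -> g 0 0 = 1%g ->
  (forall i j, i <= N -> j < m -> S ((g i j)^-1 * g i j.+1)%g) ->
  (forall i j, i < N -> j <= m -> S ((g i j)^-1 * g i.+1 j)%g) ->
  (forall i j, i <= N -> j <= m -> ball S d (g i j)) ->
  (forall i, i < N -> eqA ((g i 0)^-1 * g i.+1 0)%g ((g i m)^-1 * g i.+1 m)%g) ->
  (forall j, j < m -> eqA ((g N j)^-1 * g N j.+1)%g 1%g) ->
  htpy S (3 * d) (N.+1 * m.+3) (pw (g 0) m) [::].
Proof.
move=> hs g0 hh hv hb he hn.
pose Ew i := pw (fun i => g i 0) i.
have hE i : i <= N -> wover S (Ew i).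
  by move=> le; apply: wover_pw => j lt; apply: hv; lia.
have rE i : i <= N -> rad S d (Ew i).
  by move=> le; apply: rad_pw => j lt; rewrite g0 invg1 mul1g; apply: hb; lia.
have hrow i : i <= N -> wover S (pw (g i) m).
  by move=> le; apply: wover_pw => j lt; apply: hh.
have b2 i j : i <= N -> j <= m -> ball S (d + d) ((g i 0)^-1 * g i j)%g.
  by move=> le lj; apply: ballM; [apply: ballV => //|]; apply: hb.
have rrow i : i <= N -> rad S (2 * d) (pw (g i) m).
  by move=> le; rewrite mul2n -addnn; apply: rad_pw => j lt; apply: b2.
have rER i : i <= N -> rad S (3 * d) (Ew i ++ pw (g i) m).
  by move=> le; rewrite mulSn; apply: rad_cat'; [apply: rE|apply: rrow].
have main i : i <= N ->
  htpy S (3 * d) (i * m.+2) (pw (g 0) m) (Ew i ++ pw (g i) m ++ winv (Ew i)).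
  elim: i => [|i IH] le; first by rewrite cats0; apply: htpy_refl.
  apply: (@htpy_leN _ _ (i * m.+2 + (1 + m))); first by lia.
  apply: htpy_trans (IH (ltnW le)) _.
  set a := ((g i m)^-1 * g i.+1 m)%g; set b := ((g i 0)^-1 * g i.+1 0)%g.
  have Sa : S a by apply: hv.
  have Sb : S b by apply: hv.
  (* The two ends of the row move by the same increment modulo [A], so [a] followed by the inverse
     of [b] may be inserted; the ladder then turns [a] into a [b] on the left, which prolongs the
     conjugating path. *)
  apply: (@htpy_trans _ _ _ _ _ (Ew i ++ (pw (g i) m ++ [:: a]) ++ [:: (b^-1)%g] ++ winv (Ew i))).
    rewrite catA -!catA catA [Ew i ++ pw _ _ ++ _]catA.
    apply: (@htpy_base S _ (Ew i ++ pw (g i) m) _ [::] [:: _; _]) => //.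
    - by apply: rER; lia.
    - by apply: wover_cons => //; apply: wover1; apply: hs.
    - rewrite wval_nil !wval_cons wval_nil mulg1 -(mulgV b).
      by apply: eqAM (eqA_refl _); apply: he.
  have -> : Ew i.+1 ++ pw (g i.+1) m ++ winv (Ew i.+1) =
     Ew i ++ (b :: pw (g i.+1) m) ++ [:: (b^-1)%g] ++ winv (Ew i).
    by rewrite /Ew pwS winv_rcons cat_rcons.
  have -> : 3 * d = d + 2 * d by lia.
  apply: htpy_cong; first by apply: rE; lia.
  by apply: ladder => j lt; [apply: hh|apply: hh|apply: hv|rewrite mul2n -addnn; apply: b2]; lia.
apply: (@htpy_leN _ _ (N * m.+2 + (m + N))); first by lia.
apply: htpy_trans (main N (leqnn N)) _; apply: (@htpy_trans _ _ _ _ _ (Ew N ++ winv (Ew N))).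
  have -> : 3 * d = d + 2 * d by lia.
  apply: htpy_catl; first exact: rE.
  rewrite -[X in htpy _ _ _ _ X]cat0s; apply: htpy_catr.
  have {1}-> : m = size (pw (g N) m) by rewrite size_pw.
  apply: htpy_null; [exact: hrow|exact: rrow|] => x /mapP[j].
  by rewrite mem_iota => /andP[_ lt] ->; apply: hn.
apply: (@htpy_sub S S d) => //; first by lia.
have {1}-> : N = size (Ew N) by rewrite size_pw.
by apply: htpy_wV => //; [apply: hE | apply: rE].
Qed.

Lemma row_change S d m (g h : nat -> E) :
  (forall j, j < m -> S ((g j)^-1 * g j.+1)%g) ->
  (forall j, j < m -> S ((h j)^-1 * h j.+1)%g) ->
  (forall j, j <= m -> S ((g j)^-1 * h j)%g) ->
  (forall j, j <= m -> ball S d ((g 0)^-1 * g j)%g) ->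
  g 0 = h 0 -> g m = h m -> htpy S d m.+2 (pw g m) (pw h m).
Proof.
move=> hg hh hc hb e0 em.
have S1 : S 1%g by have := hc 0 (leq0n _); rewrite e0 mulVg.
apply: (@htpy_leN _ _ (1 + m + 1)); first by lia.
apply: htpy_trans; last first.
  apply: (@htpy_base S d [::] (pw h m) [:: 1%g] [::]) => //; first exact: rad_nil.
    exact: wover1.
  by rewrite wval1 wval_nil; apply: eqA_refl.
apply: htpy_trans; last first.
  have := ladder hg hh hc hb; rewrite e0 em !mulVg; apply.
rewrite -[X in htpy _ _ _ X]cats0; apply: (@htpy_base S d (pw g m) [::] [::] [:: _]) => //.
- exact: rad_pw.
- by apply: wover1.
- by rewrite wval1 wval_nil; apply: eqA_refl.
Qed.

(** No bound on the points is required: the left column followed by a row joins 1 to any of them by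
    at most [N + m] letters. *)
Lemma rows_null_grid S m N (g : nat -> nat -> E) : symm S -> g 0 0 = 1%g ->
  (forall i j, i <= N -> j < m -> S ((g i j)^-1 * g i j.+1)%g) ->
  (forall i j, i < N -> j <= m -> S ((g i j)^-1 * g i.+1 j)%g) ->
  (forall i, i < N -> eqA ((g i 0)^-1 * g i.+1 0)%g ((g i m)^-1 * g i.+1 m)%g) ->
  (forall j, j < m -> eqA ((g N j)^-1 * g N j.+1)%g 1%g) ->
  htpy S (3 * (N + m)) (N.+1 * m.+3) (pw (g 0) m) [::].
Proof.
move=> hs g0 hh hv he hn; apply: rows_null => // i j le lj.
have -> : g i j = (wval (pw (fun i => g i 0) i) * wval (pw (g i) j))%g.
  by rewrite !wval_pw g0 invg1 mul1g mulVKg.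
apply: (@ball_sub S S (i + j)) => //; first by rewrite leq_add.
apply: ballM.
  rewrite -{1}(size_pw (fun i => g i 0) i); apply: ball_word.
  by apply: wover_pw => l lt; apply: hv => //; exact: leq_trans le.
rewrite -{1}(size_pw (g i) j); apply: ball_word.
by apply: wover_pw => l lt; apply: hh => //; exact: leq_trans lj.
Qed.

Lemma pw_mull x g m : pw (fun j => (x * g j)%g) m = pw g m.
Proof. by apply: eq_map => j; rewrite invgM -!mulgA mulKg. Qed.

Lemma pw_const g m x : (forall j, j < m -> ((g j)^-1 * g j.+1)%g = x) -> pw g m = nseq m x.
Proof.
elim: m => [//|m IH] h; rewrite pwS nseq_rcons h // IH // => j lt; apply: h.
exact: ltnW.
Qed.
End Homotopy.

Import Order.TTheory GRing.Theory Num.Theory.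
Import numFieldNormedType.Exports.

Local Open Scope ring_scope.

Ltac nlia := repeat match goal with
  | H : ?T |- _ => lazymatch T with
     | nat => fail | is_true (leq _ _) => fail | @eq nat _ _ => fail
     | _ => clear H end
  end; lia.

(** * The groups l_k as groups of polynomials *)

Section Translation.
Variable R : archiRealFieldType.
Implicit Types (s t c : R) (f g : {poly R}).

Definition tr s f : {poly R} := f \Po ('X + s%:P).

Lemma tr0 f : tr 0 f = f. Proof. by rewrite /tr addr0 comp_polyXr. Qed.
Lemma tr_add s t f : tr s (tr t f) = tr (s + t) f.
Proof.
rewrite /tr -comp_polyA comp_polyD comp_polyX comp_polyC -addrA; congr (_ \Po (_ + _)).
by rewrite -polyCD.
Qed.
Lemma trD s f g : tr s (f + g) = tr s f + tr s g. Proof. exact: comp_polyD. Qed.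
Lemma trN s f : tr s (- f) = - tr s f. Proof. exact: raddfN. Qed.
Lemma trB s f g : tr s (f - g) = tr s f - tr s g. Proof. exact: raddfB. Qed.
Lemma trZ s c f : tr s (c *: f) = c *: tr s f. Proof. exact: comp_polyZ. Qed.
Lemma trC s c : tr s c%:P = c%:P. Proof. exact: comp_polyC. Qed.
Lemma tr_0 s : tr s 0 = 0. Proof. exact: comp_poly0. Qed.
Lemma tr_sum s I (r : seq I) P F : tr s (\sum_(i <- r | P i) F i) = \sum_(i <- r | P i) tr s (F i).
Proof. exact: raddf_sum. Qed.
Lemma size_tr s f : size (tr s f) = size f.
Proof. by rewrite size_comp_poly2 // size_XaddC. Qed.
Lemma trXn s k : tr s 'X^k = ('X + s%:P) ^+ k.
Proof. by rewrite /tr comp_Xn_poly. Qed.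

Lemma coef_XaddCn s k i : (('X + s%:P) ^+ k)`_i = s ^+ (k - i) *+ 'C(k, i) :> R.
Proof.
rewrite exprDn coef_sum.
under eq_bigr => j _ do rewrite -polyC_exp coefMn mulrC coefCM coefXn.
have [lt|le] := ltnP k i.
  rewrite bin_small // mulr0n big1 // => j _.
  by have -> : (i == k - j)%N = false; [apply/negbTE; lia | rewrite mulr0 mul0rn].
have lt : (k - i < k.+1)%N by lia.
rewrite (bigD1 (Ordinal lt)) //= subKn // eqxx mulr1 bin_sub // big1 ?addr0 // => j ne.
have -> : (i == k - j)%N = false; last by rewrite mulr0 mul0rn.
apply/negP => /eqP e; move/eqP: ne; apply; apply: val_inj => /=.
by have := ltn_ord j; lia.
Qed.

Lemma coef_tr K s f i : (size f <= K)%N ->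
  (tr s f)`_i = \sum_(j < K) f`_j * (s ^+ (j - i) *+ 'C(j, i)).
Proof.
move=> le; have {1}-> : f = \sum_(j < K) f`_j *: 'X^j.
  rewrite -{1}[f]coefK poly_def -(big_mkord predT (fun j => f`_j *: 'X^j)).
  rewrite -[RHS](big_mkord predT (fun j => f`_j *: 'X^j)) (big_cat_nat (leq0n _) le) /=.
  rewrite [X in _ + X]big_nat [X in _ + X]big1 ?addr0 // => j /andP[h _].
  by rewrite nth_default // scale0r.
rewrite tr_sum coef_sum; apply: eq_bigr => j _.
by rewrite trZ trXn coefZ coef_XaddCn.
Qed.

Lemma tr_coef_top K s f : (size f <= K.+1)%N -> (tr s f)`_K = f`_K.
Proof.
move=> le; rewrite (coef_tr _ _ le) big_ord_recr /= subnn expr0 binn mulr1 big1 ?add0r // => j _.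
by rewrite bin_small ?ltn_ord // mulr0n mulr0.
Qed.

(* Weighted coefficient bound: a polynomial of size n ^ (k - 1 - i) in degree i
   satisfies it with B proportional to n ^ (k - 1). *)
Definition wb (n B : R) f := forall i, (0 < i)%N -> `|f`_i| * n ^+ i <= B.

(** An upper bound for the sum over [j < K] of [(1 + c) ^+ j], where [(1 + c) ^+ j] dominates each
    term of the binomial expansion that a translation by at most [c * n] produces. *)
Definition trK (K : nat) c : R := K%:R * (1 + c) ^+ K.

Lemma trK_ge0 K c : 0 <= c -> 0 <= trK K c.
Proof. by move=> c0; rewrite mulr_ge0 ?ler0n // exprn_ge0 // addr_ge0. Qed.

Lemma bin_exp_le j i c : 0 <= c -> c ^+ (j - i) *+ 'C(j, i) <= (1 + c) ^+ j.
Proof.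
move=> c0; have [lt|le] := ltnP j i.
  by rewrite bin_small // mulr0n exprn_ge0 // addr_ge0.
have lt : (j - i < j.+1)%N by lia.
rewrite exprDn (bigD1 (Ordinal lt)) //= expr1n mul1r bin_sub // lerDl.
by apply: sumr_ge0 => l _; rewrite expr1n mul1r mulrn_wge0 // exprn_ge0.
Qed.

(** Since [s] is at most [c * n], its powers are absorbed by the weights and [n] disappears from the
    constant. The constant coefficient of [f], which [wb] does not control, is subtracted; it
    contributes to degree 0 only. *)
Lemma tr_bound K n B c s f i : (size f <= K)%N -> 0 <= c -> 0 < n -> `|s| <= c * n ->
  wb n B f -> 0 <= B -> `|(tr s f)`_i - (f`_i *+ (i == 0)%N)| * n ^+ i <= trK K c * B.
Proof.
move=> le c0 n0 hs hB B0.
have -> : (tr s f)`_i - (f`_i *+ (i == 0)%N) =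
    \sum_(j < K) (f`_j *+ (0 < j)%N) * (s ^+ (j - i) *+ 'C(j, i)).
  rewrite (coef_tr _ _ le); have [i0|i0] := eqVneq i 0%N; last first.
    rewrite mulr0n subr0; apply: eq_bigr => j _; case: posnP => [->|_]; last by rewrite mulr1n.
    by rewrite bin_small ?lt0n // !mulr0n mulr0 mul0r.
  rewrite i0 mulr1n; case: K le => [|K] le.
    by rewrite !big_ord0 nth_default ?subr0 //; lia.
  rewrite !big_ord_recl /= expr0 bin0 mulr1 mulr0n mul0r add0r addrC addKr.
  by apply: eq_bigr => j _; rewrite mulr1n.
apply: (@le_trans _ _ ((\sum_(j < K) (1 + c) ^+ j * B))).
  apply: (@le_trans _ _ (\sum_(j < K) `|(f`_j *+ (0 < j)%N) * (s ^+ (j - i) *+ 'C(j, i))| * n ^+ i)).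
    by rewrite -mulr_suml ler_wpM2r ?exprn_ge0 ?(ltW n0) //; apply: ler_norm_sum.
  apply: ler_sum => j _; case: (posnP j) => [->|j0].
    by rewrite mulr0n mul0r normr0 mul0r mulr_ge0 // exprn_ge0 // addr_ge0.
  rewrite mulr1n normrM normrMn normrX.
  have [lt|leij] := ltnP j i.
    by rewrite bin_small // mulr0n mulr0 mul0r mulr_ge0 // exprn_ge0 // addr_ge0.
  apply: (@le_trans _ _ ((`|f`_j| * n ^+ j) * (c ^+ (j - i) *+ 'C(j, i)))).
    rewrite -!mulrA ler_wpM2l // mulrnAl mulrnAr lerMn2r; apply/orP; right.
    rewrite -[in X in _ <= X](subnK leij) exprD mulrAC ler_wpM2r ?exprn_ge0 ?(ltW n0) //.
    rewrite addnK mulrC -exprMn lerXn2r ?nnegrE ?normr_ge0 ?mulr_ge0 //; exact: ltW.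
  rewrite mulrC; apply: ler_pM => //.
  - by rewrite mulrn_wge0 // exprn_ge0.
  - by rewrite mulr_ge0 // exprn_ge0 // ltW.
  - exact: bin_exp_le.
  - exact: hB.
rewrite -mulr_suml ler_wpM2r // /trK mulr_natl -[X in _ *+ X]card_ord -sumr_const.
apply: ler_sum => j _; apply: ler_weXn2l; last exact: ltnW.
by rewrite lerDl.
Qed.

Lemma tr_wb K n B c s f : (size f <= K)%N -> 0 <= c -> 0 < n -> `|s| <= c * n ->
  wb n B f -> 0 <= B -> wb n (trK K c * B) (tr s f).
Proof.
move=> le c0 n0 hs hB B0 i i0; have := tr_bound i le c0 n0 hs hB B0.
by rewrite gtn_eqF // mulr0n subr0.
Qed.

Lemma wbD n B B' f g : 0 <= n -> wb n B f -> wb n B' g -> wb n (B + B') (f + g).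
Proof.
move=> n0 hf hg i i0; rewrite coefD.
apply: le_trans (lerD (hf i i0) (hg i i0)); rewrite -mulrDl ler_wpM2r ?exprn_ge0 //.
exact: ler_normD.
Qed.
Lemma wbN n B f : wb n B f -> wb n B (- f).
Proof. by move=> h i i0; rewrite coefN normrN; apply: h. Qed.
Lemma wbZ n B c f : wb n B f -> wb n (`|c| * B) (c *: f).
Proof. by move=> h i i0; rewrite coefZ normrM -mulrA ler_wpM2l //; apply: h. Qed.
Lemma wb_le n B B' f : B <= B' -> wb n B f -> wb n B' f.
Proof. by move=> le h i i0; apply: le_trans le; apply: h. Qed.

End Translation.

(* (s, f) stands for f x^s, where x^s translates polynomials by s; the group
   l_k is formed by the (s, f) with deg f <= k - 2, with x_2 = 'X^(k-2) up to a
   scalar, and its center consists of the constants. *)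
Definition filiform (R : archiRealFieldType) : Type := (R * {poly R})%type.

Section Filiform.
Variable R : archiRealFieldType.
Local Notation L := (filiform R).
HB.instance Definition _ := Choice.on L.

Definition fmul (g h : L) : L := (g.1 + h.1, g.2 + tr g.1 h.2).
Definition fone : L := (0, 0).
Definition finv (g : L) : L := (- g.1, - tr (- g.1) g.2).

Fact fmulA : associative fmul.
Proof. by move=> x y z; rewrite /fmul /= trD tr_add !addrA. Qed.
Fact fmul1 : left_id fone fmul.
Proof. by case=> s f; rewrite /fmul /= tr0 !add0r. Qed.
Fact fmulr1 : right_id fone fmul.
Proof. by case=> s f; rewrite /fmul /= tr_0 !addr0. Qed.
Fact fmulV : left_inverse fone finv fmul.
Proof. by case=> s f; rewrite /fmul /= !addNr. Qed.
Fact fmulrV : right_inverse fone finv fmul.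
Proof. by case=> s f; rewrite /fmul /= trN tr_add !subrr tr0 subrr. Qed.

HB.instance Definition _ := isGroup.Build L fmulA fmul1 fmulr1 fmulV fmulrV.

Lemma fmulE (s t : R) (f g : {poly R}) :
  (((s, f) : L) * ((t, g) : L))%g = (s + t, f + tr s g) :> L.
Proof. by []. Qed.
Lemma finvE (s : R) (f : {poly R}) : (((s, f) : L)^-1)%g = (- s, - tr (- s) f) :> L.
Proof. by []. Qed.
Lemma fdivE (s t : R) (f g : {poly R}) :
  (((s, f) : L)^-1 * ((t, g) : L))%g = (t - s, tr (- s) (g - f)) :> L.
Proof. by rewrite finvE fmulE trB addrC [- tr _ _ + _]addrC. Qed.
Lemma foneE : 1%g = (0, 0) :> L. Proof. by []. Qed.
Lemma fexp (s : R) n : (((s, 0) : L) ^+ n)%g = (s *+ n, 0) :> L.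
Proof.
by elim: n => [|n IH]; rewrite ?expgS ?IH //= fmulE tr_0 addr0 mulrS.
Qed.
Lemma fexpv (f : {poly R}) n : (((0, f) : L) ^+ n)%g = (0, f *+ n) :> L.
Proof.
by elim: n => [|n IH]; rewrite ?expgS ?IH //= fmulE tr0 addr0 mulrS.
Qed.

Local Notation E := (L * L)%type.

Lemma pmulE (a b c d : L) : (((a, b) : E) * ((c, d) : E))%g = ((a * c)%g, (b * d)%g) :> E.
Proof. by []. Qed.
Lemma pinvE (a b : L) : (((a, b) : E)^-1)%g = ((a^-1)%g, (b^-1)%g) :> E.
Proof. by []. Qed.

(* The central product identifies (0, c) in both factors. *)
Definition antidiag (e : E) : Prop :=
  exists c : R, e = ((0, c%:P), (0, - c%:P)).

Lemma antidiag1 : antidiag 1%g.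
Proof. by exists 0; rewrite polyC0 oppr0. Qed.
Lemma antidiagM x y : antidiag x -> antidiag y -> antidiag (x * y)%g.
Proof.
move=> [c ->] [d ->]; exists (c + d); rewrite pmulE !fmulE !addr0 !tr0.
by rewrite polyCD opprD.
Qed.
Lemma antidiagV x : antidiag x -> antidiag (x^-1)%g.
Proof.
move=> [c ->]; exists (- c); rewrite pinvE !finvE !oppr0 !tr0.
by rewrite polyCN.
Qed.
Lemma antidiagC a x : antidiag a -> (a * x = x * a)%g.
Proof.
case: x => [[s f] [t g]] [c ->]; rewrite !pmulE !fmulE !tr0 trN !trC !add0r !addr0.
by rewrite addrC [- c%:P + g]addrC.
Qed.

Definition antidiags := CentralSubgroup antidiag1 antidiagM antidiagV antidiagC.

Definition lettX (l : L) : E := (l, 1%g).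
Definition lettY (l : L) : E := (1%g, l).

Lemma lettXM l m : (lettX l * lettX m)%g = lettX (l * m)%g.
Proof. by rewrite /lettX pmulE mulg1. Qed.
Lemma lettXV l : ((lettX l)^-1)%g = lettX (l^-1)%g.
Proof. by rewrite /lettX pinvE invg1. Qed.
Lemma lettXY l m : (lettX l * lettY m)%g = (lettY m * lettX l)%g.
Proof. by rewrite /lettX /lettY !pmulE !mulg1 !mul1g. Qed.

Lemma wval_map_lettX w : wval [seq lettX l | l <- w] = lettX (wval w).
Proof.
elim: w => [|l w IH]; first by rewrite !wval_nil.
by rewrite /= !wval_cons IH lettXM.
Qed.

Section Letters.
Variables p q : nat.

(* Only the sum of the constant terms is defined modulo antidiag. *)
Definition bd0 (C : R) (e : E) : Prop :=
  [/\ [/\ `|e.1.1| <= C & `|e.2.1| <= C], [/\ (size e.1.2 < p)%N & (size e.2.2 < q)%N],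
   [/\ wb 1 C e.1.2 & wb 1 C e.2.2] & `|e.1.2`_0 + e.2.2`_0| <= C].

(** [bd0 C] is not stable under inversion with the same [C], because an inverse involves a
    translation; homotopies need a symmetric set of letters. *)
Definition bd C e : Prop := bd0 C e \/ bd0 C (e^-1)%g.

Lemma bd_sym C : symm (bd C).
Proof. by move=> x [h|h]; [right; rewrite invgK|left]. Qed.
Lemma bd0_le C C' e : C <= C' -> bd0 C e -> bd0 C' e.
Proof.
move=> le [[h1 h2] h [h3 h4] h5]; split=> //; last exact: le_trans h5 le.
  by split; [exact: le_trans h1 le|exact: le_trans h2 le].
by split; apply: wb_le le _.
Qed.
Lemma bd_le C C' e : C <= C' -> bd C e -> bd C' e.
Proof. by move=> le [h|h]; [left|right]; apply: bd0_le h. Qed.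

End Letters.

(** In contrast with [bd0], the constant term is bounded too: this describes the letters of the
    words to be filled, [bd] the letters that homotopies may use. *)
Definition box (k : nat) (C : R) (l : L) : Prop :=
  [/\ `|l.1| <= C, (size l.2 < k)%N & forall i, `|l.2`_i| <= C].

Lemma box_le k k' C C' l : (k <= k')%N -> C <= C' -> box k C l -> box k' C' l.
Proof.
move=> lk le [h1 h2 h3]; split; [exact: le_trans le|exact: leq_trans lk|].
by move=> i; apply: le_trans le.
Qed.

Lemma wb1 (C : R) (f : {poly R}) : (forall i, `|f`_i| <= C) -> wb 1 C f.
Proof. by move=> h i _; rewrite expr1n mulr1. Qed.

Lemma bd_box p q k k' C l m : (k <= p)%N -> (k' <= q)%N ->
  box k C l -> box k' C m -> bd p q (C + C) (l, m).
Proof.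
move=> kp kq [h1 h2 h3] [h1' h2' h3']; left.
have C0 : 0 <= C by apply: le_trans h1.
have le : C <= C + C by rewrite lerDl.
split=> /=.
- by split; [exact: le_trans h1 le|exact: le_trans h1' le].
- by split; [exact: leq_trans h2 kp|exact: leq_trans h2' kq].
- by split; apply: wb_le le _; apply: wb1.
- by apply: le_trans (ler_normD _ _) _; apply: lerD.
Qed.

Lemma box1 k C : (0 < k)%N -> 0 <= C -> box k C 1%g.
Proof. by move=> k0 C0; split=> /=; rewrite ?normr0 ?size_poly0 // => i; rewrite coef0 normr0. Qed.

End Filiform.

(** * Growth of coefficients along words, and dilations *)

Section Bounds.
Variable R : archiRealFieldType.
Local Notation L := (filiform R).
Implicit Types (s t c : R) (f g : {poly R}).

Lemma nat_above (x : R) : exists n : nat, x <= n%:R.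
Proof.
exists (Num.bound `|x|); apply: le_trans (ler_norm x) _.
by apply/ltW/archi_boundP.
Qed.

Definition fb (n B : R) f := forall i, `|f`_i| * n ^+ i <= B.

Lemma fb_wb n B f : fb n B f -> wb n B f. Proof. by move=> h i _; apply: h. Qed.
Lemma fb_le n B B' f : B <= B' -> fb n B f -> fb n B' f.
Proof. by move=> le h i; apply: le_trans le; apply: h. Qed.
Lemma fbD (n : R) B B' f g : 0 <= n -> fb n B f -> fb n B' g -> fb n (B + B') (f + g).
Proof.
move=> n0 hf hg i; rewrite coefD.
apply: le_trans (lerD (hf i) (hg i)); rewrite -mulrDl ler_wpM2r ?exprn_ge0 //.
exact: ler_normD.
Qed.
Lemma fb_ge0 n B f : fb n B f -> 0 <= n -> 0 <= B.
Proof. by move=> h n0; apply: le_trans (h 0%N); rewrite mulr_ge0 // exprn_ge0. Qed.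

Lemma tr_fb K (n : R) B c s f : (size f <= K)%N -> 0 <= c -> 0 < n -> `|s| <= c * n ->
  fb n B f -> fb n ((1 + trK K c) * B) (tr s f).
Proof.
move=> le c0 n0 hs hB i; have B0 := fb_ge0 hB (ltW n0).
have h := tr_bound i le c0 n0 hs (fb_wb hB) B0.
rewrite -(subrK (f`_i *+ (i == 0)%N) (tr s f)`_i).
apply: le_trans (_ : (`|(tr s f)`_i - f`_i *+ (i == 0)%N| + `|f`_i *+ (i == 0)%N|) * n ^+ i <= _).
  by rewrite ler_wpM2r ?exprn_ge0 ?(ltW n0) //; apply: ler_normD.
rewrite mulrDl [in X in _ <= X]addrC mulrDl mul1r; apply: lerD => //.
case: eqP => _; first by rewrite mulr1n.
by rewrite mulr0n normr0 mul0r.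
Qed.

Lemma ltn_le_pred a k : (a < k)%N -> (a <= k.-1)%N. Proof. by case: k. Qed.

Lemma size_polyDlt f g k : (size f < k)%N -> (size g < k)%N -> (size (f + g)%R < k)%N.
Proof. by move=> h1 h2; apply: leq_ltn_trans (size_polyD _ _) _; rewrite gtn_max h1. Qed.
Lemma size_polyBlt f g k : (size f < k)%N -> (size g < k)%N -> (size (f - g)%R < k)%N.
Proof. by move=> h1 h2; apply: size_polyDlt => //; rewrite size_polyN. Qed.

Lemma box_fb k C n (l : L) : 1 <= n -> (1 < k)%N -> box k C l -> fb n (C * n ^+ (k - 2)) l.2.
Proof.
move=> n1 k1 [_ hs hb] i; have n0 : 0 <= n by lra.
have C0 : 0 <= C by apply: le_trans (hb 0%N).
have [le|lt] := leqP (size l.2) i.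
  by rewrite nth_default // normr0 mul0r mulr_ge0 // exprn_ge0.
by apply: ler_pM => //; [exact: exprn_ge0 | apply: ler_weXn2l => //; nlia].
Qed.

(** A letter translated by O(n) adds at most a multiple of n^(k-2-i) in degree [i], and there are at
    most [n] letters. *)
Lemma word_bound k (r : nat) : (1 < k)%N -> exists C : nat, forall (n : nat) (w : seq L),
  (0 < n)%N -> (size w <= n)%N -> (forall l, l \in w -> box k r%:R l) ->
  [/\ `|(wval w).1| <= r%:R * n%:R, (size (wval w).2 < k)%N &
      fb n%:R (C%:R * n%:R ^+ (k - 1)) (wval w).2].
Proof.
move=> k1; pose c : R := (1 + trK k r%:R) * r%:R.
have c0 : 0 <= c by rewrite mulr_ge0 ?addr_ge0 ?trK_ge0 ?ler0n.
have [C hC] := nat_above c; exists C => n w n0 le hw.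
have n1 : 1 <= n%:R :> R by rewrite ler1n.
have n0' : 0 < n%:R :> R by rewrite ltr0n.
suff: [/\ `|(wval w).1| <= r%:R * (size w)%:R, (size (wval w).2 < k)%N &
      fb n%:R ((size w)%:R * (c * n%:R ^+ (k - 2))) (wval w).2].
  move=> [h1 h2 h3]; split=> //.
    by apply: le_trans h1 _; rewrite ler_wpM2l ?ler0n // ler_nat.
  apply: fb_le h3; have -> : (k - 1 = (k - 2).+1)%N by nlia.
  rewrite exprS [leRHS]mulrCA; apply: ler_pM; first exact: ler0n.
  - by rewrite mulr_ge0 // exprn_ge0.
  - by rewrite ler_nat.
  - by apply: ler_wpM2r => //; rewrite exprn_ge0.
elim/last_ind: w le hw => [_ _|w l IH].
  rewrite wval_nil foneE /= normr0 size_poly0 mulr0; split=> //; first nlia.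
  by move=> i; rewrite coef0 normr0 !mul0r.
rewrite size_rcons => le hw.
have [|l0 hl0|h1 h2 h3] := IH; [nlia|by apply: hw; rewrite mem_rcons inE hl0 orbT|].
have hl : box k r%:R l by apply: hw; rewrite mem_rcons mem_head.
have [hl1 hl2 _] := hl.
rewrite wval_rcons; case: (wval w) h1 h2 h3 => s f h1 h2 h3; case: l hl hl1 hl2 {hw} => t g hl hl1 hl2.
rewrite fmulE /=; split.
- by apply: le_trans (ler_normD _ _) _; rewrite -natr1 mulrDr mulr1; apply: lerD.
- by apply: size_polyDlt => //; rewrite size_tr.
- rewrite -natr1 mulrDl mul1r; apply: fbD => //.
  rewrite /c -mulrA; apply: tr_fb; rewrite ?ler0n //; first exact: ltnW.
    apply: le_trans h1 _; rewrite ler_wpM2l ?ler0n // ler_nat; nlia.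
  exact: (box_fb n1 k1 hl).
Qed.

(* The dilation of l_k for which x and 'X^(k-2) have weight 1. *)
Definition dilp k t f : {poly R} := \poly_(i < k.-1) (t ^+ (k.-1 - i) * f`_i).
Definition dil k t (l : L) : L := (t * l.1, dilp k t l.2).

Lemma coef_dilp k t f i : (dilp k t f)`_i = if (i < k.-1)%N then t ^+ (k.-1 - i) * f`_i else 0.
Proof. by rewrite coef_poly. Qed.

Lemma size_dilp k t f : (0 < k)%N -> (size (dilp k t f) < k)%N.
Proof. by move=> k0; rewrite (leq_ltn_trans (size_poly _ _)) // ltn_predL. Qed.

Lemma dilM k t (l m : L) : (0 < k)%N -> (size l.2 < k)%N -> (size m.2 < k)%N ->
  dil k t (l * m)%g = (dil k t l * dil k t m)%g.
Proof.
move=> k0; case: l m => s f [u g] /= hf hg; rewrite /dil /= fmulE mulrDr; congr (_, _).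
have hg' : (size g <= k.-1)%N by rewrite -ltnS prednK.
have hd : (size (dilp k t g) <= k.-1)%N by exact: size_poly.
apply/polyP => i; rewrite coefD !coef_dilp coefD !(coef_tr _ _ hg') !(coef_tr _ _ hd).
case: ltnP => le; last first.
  rewrite add0r big1 // => j _; rewrite bin_small ?mulr0n ?mulr0 //.
  by apply: leq_trans (ltn_ord j) _.
rewrite mulrDr; congr (_ + _); rewrite mulr_sumr; apply: eq_bigr => j _.
rewrite coef_dilp ltn_ord; have [lt|leij] := ltnP j i.
  by rewrite bin_small // !mulr0n !mulr0.
rewrite exprMn -[in RHS]mulr_natr -[in LHS]mulr_natr.
have -> : (k.-1 - i = (k.-1 - j) + (j - i))%N by have := ltn_ord j; nlia.
by rewrite exprD; ring.
Qed.

Lemma dil1 k (l : L) : (size l.2 < k)%N -> dil k 1 l = l.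
Proof.
case: l => s f /= h; rewrite /dil /= mul1r; congr (_, _).
apply/polyP => i; rewrite coef_dilp expr1n mul1r; case: ltnP => // le.
by rewrite nth_default // (leq_trans (ltn_le_pred h)).
Qed.

Lemma dil0 k (l : L) : dil k 0 l = 1%g.
Proof.
rewrite /dil mul0r foneE; congr (_, _); apply/polyP => i; rewrite coef_dilp coef0.
by case: ltnP => // lt; rewrite expr0n subn_eq0 leqNgt lt mul0r.
Qed.

Lemma wval_dil k t (w : seq L) : (0 < k)%N -> (forall l, l \in w -> (size l.2 < k)%N) ->
  (size (wval w).2 < k)%N /\ wval [seq dil k t l | l <- w] = dil k t (wval w).
Proof.
move=> k0; elim: w => [|l w IH] hw.
  rewrite !wval_nil /= size_poly0; split=> //; rewrite /dil mulr0; congr (_, _).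
  by apply/polyP => i; rewrite coef_dilp !coef0 mulr0 if_same.
have [|h1 h2] := IH; first by move=> m hm; apply: hw; rewrite inE hm orbT.
have hl : (size l.2 < k)%N by apply: hw; rewrite mem_head.
rewrite /= !wval_cons h2 dilM //; split=> //.
by apply: size_polyDlt => //; rewrite size_tr.
Qed.

Lemma box_dil k C t (l : L) : 0 <= t <= 1 -> box k C l -> box k C (dil k t l).
Proof.
move=> /andP[t0 t1] [h1 h2 h3]; have C0 : 0 <= C by apply: le_trans h1.
split=> /=.
- by rewrite normrM (ger0_norm t0); apply: le_trans h1; rewrite ler_piMl.
- by apply: size_dilp; nlia.
- move=> i; rewrite coef_dilp; case: ifP => _; last by rewrite normr0.
  rewrite normrM normrX (ger0_norm t0); apply: le_trans (h3 i).
  by rewrite ler_piMl // exprn_ile1.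
Qed.

Definition bar (l : L) : L := (l.1, - l.2).
Lemma barM (l m : L) : bar (l * m)%g = (bar l * bar m)%g.
Proof. by rewrite /bar !fmulE /= trN opprD. Qed.
Lemma barK : involutive bar. Proof. by case=> s f; rewrite /bar /= opprK. Qed.
Lemma box_bar k C l : box k C l -> box k C (bar l).
Proof.
move=> [h1 h2 h3]; split=> //=; first by rewrite size_polyN.
by move=> i; rewrite coefN normrN.
Qed.

Local Notation E := (L * L)%type.
(** The mirrored letter: [bar] is an automorphism that negates polynomials, so that the constant
    terms of the two factors always add up to 0. *)
Definition lettM (l : L) : E := (l, bar l).
Lemma lettMM l m : (lettM l * lettM m)%g = lettM (l * m)%g.
Proof. by rewrite /lettM pmulE barM. Qed.
Lemma lettM1 : lettM 1%g = 1%g.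
Proof. by rewrite /lettM /bar /= oppr0. Qed.
Lemma lettMV l : ((lettM l)^-1)%g = lettM (l^-1)%g.
Proof. by apply: mulg1_eq; rewrite lettMM mulgV lettM1. Qed.
Lemma wval_map_lettM w : wval [seq lettM l | l <- w] = lettM (wval w).
Proof.
elim: w => [|l w IH]; first by rewrite !wval_nil lettM1.
by rewrite /= !wval_cons IH lettMM.
Qed.
Lemma wval_map_bar w : wval [seq bar l | l <- w] = bar (wval w).
Proof.
elim: w => [|l w IH]; first by rewrite !wval_nil /bar /= oppr0.
by rewrite /= !wval_cons IH barM.
Qed.

Lemma bd_lettM p q C (l : L) : `|l.1| <= C -> (size l.2 < p)%N -> (size l.2 < q)%N ->
  wb 1 C l.2 -> bd p q C (lettM l).
Proof.
move=> h1 h2 h3 h4; left; split=> /=; rewrite ?size_polyN //.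
  by split=> //; apply: wbN.
by rewrite coefN subrr normr0; apply: le_trans h1.
Qed.

Lemma sub_exp_le (t t' : R) e : 0 <= t <= 1 -> 0 <= t' <= 1 ->
  `|t' ^+ e - t ^+ e| <= e%:R * `|t' - t|.
Proof.
move=> /andP[t0 t1] /andP[t0' t1'].
elim: e => [|e IH]; first by rewrite !expr0 subrr normr0 mul0r.
have -> : t' ^+ e.+1 - t ^+ e.+1 = (t' - t) * t' ^+ e + t * (t' ^+ e - t ^+ e) by rewrite !exprS; ring.
apply: le_trans (ler_normD _ _) _; rewrite -natr1 [leRHS]mulrDl mul1r [leRHS]addrC; apply: lerD; last first.
  rewrite normrM (ger0_norm t0); apply: le_trans IH; by rewrite ler_piMl.
by rewrite normrM normrX (ger0_norm t0') ler_piMr // exprn_ile1.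
Qed.

(* The velocity of the dilations at a point of word length n is of order
   n ^ (k - 2) apart from the constant term. *)
Lemma dil_step k (r C : nat) : (2 < k)%N -> exists D : nat,
  forall (n : nat) (l : L) (t t' : R), (0 < n)%N ->
  0 <= t <= 1 -> 0 <= t' <= 1 -> `|t' - t| <= (n ^ (k - 2))%:R^-1 ->
  `|l.1| <= r%:R * n%:R -> fb n%:R (C%:R * n%:R ^+ (k - 1)) l.2 ->
  let m := ((dil k t l)^-1 * dil k t' l)%g in
  [/\ `|m.1| <= D%:R, (size m.2 < k)%N & wb 1 D%:R m.2].
Proof.
move=> k2; have K0 : 0 <= trK k (r%:R : R) by rewrite trK_ge0.
have [D hD] := nat_above (r%:R + trK k r%:R * (k%:R * C%:R)).
have hr : (0 : R) <= trK k r%:R * (k%:R * C%:R) by apply: mulr_ge0 => //; apply: mulr_ge0.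
exists D => n [s f] t t' n0 ht ht' htt hs hf m.
have n1 : 1 <= n%:R :> R by rewrite ler1n.
have n0' : 0 < n%:R :> R by rewrite ltr0n.
have N0 : 0 < n%:R ^+ (k - 2) :> R by rewrite exprn_gt0.
have htn : `|t' - t| * n%:R ^+ (k - 2) <= 1.
  by rewrite natrX in htt; rewrite -ler_pdivlMr // mul1r.
rewrite {}/m /dil fdivE /= in hs hf *; split.
- rewrite -mulrBl normrM; apply: le_trans (_ : r%:R <= _); last by apply: le_trans hD; rewrite lerDl.
  apply: le_trans (_ : `|t' - t| * (r%:R * n%:R) <= _); first by rewrite ler_wpM2l.
  rewrite mulrCA ler_piMr ?ler0n //; apply: le_trans htn; rewrite ler_wpM2l //.
  by rewrite -[X in X <= _]expr1 ler_weXn2l //; nlia.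
- by rewrite size_tr; apply: size_polyBlt; apply: size_dilp; nlia.
have h : wb n%:R (k%:R * C%:R * n%:R) (dilp k t' f - dilp k t f).
  move=> i i0; rewrite coefB !coef_dilp; case: ltnP => lt; last first.
    by rewrite subrr normr0 mul0r !mulr_ge0.
  rewrite -mulrBl normrM -[leLHS]mulrA.
  apply: le_trans (_ : k%:R * `|t' - t| * (C%:R * n%:R ^+ (k - 1)) <= _).
    apply: ler_pM => //; try by rewrite mulr_ge0 // exprn_ge0 // ltW.
    by apply: le_trans (sub_exp_le _ ht ht') _; rewrite ler_wpM2r // ler_nat; nlia.
  have -> : (k - 1 = (k - 2).+1)%N by nlia.
  rewrite exprS; have -> : k%:R * `|t' - t| * (C%:R * (n%:R * n%:R ^+ (k - 2))) =
    (k%:R * C%:R * n%:R) * (`|t' - t| * n%:R ^+ (k - 2)) by ring.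
  by rewrite ler_piMr // !mulr_ge0.
have hsz : (size (dilp k t' f - dilp k t f)%R <= k)%N.
  by apply: ltnW; apply: size_polyBlt; apply: size_dilp; nlia.
have hts : `|- (t * s)| <= r%:R * n%:R.
  rewrite normrN normrM; apply: le_trans hs; rewrite ler_piMl //.
  by case/andP: ht => t0 t1; rewrite ger0_norm.
have h3 := tr_wb hsz (ler0n _ r) n0' hts h.
move=> i i0; rewrite expr1n mulr1; have := h3 _ i i0; rewrite !mulr_ge0 ?ler0n // => /(_ isT).
move=> {h3} h3; apply: le_trans (_ : trK k r%:R * (k%:R * C%:R) <= _); last first.
  by apply: le_trans hD; rewrite lerDr.
(* The weighted bound still contains one factor [n]. It is compensated by [n ^ i] because [0 < i];
   in degree 0 nothing would compensate it, hence the need for cancellation between the factors. *)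
rewrite -(ler_pM2r n0'); apply: le_trans (_ : _ * n%:R ^+ i <= _); last by apply: le_trans h3 _; rewrite -!mulrA.
by rewrite ler_wpM2l // -[X in X <= _]expr1 ler_weXn2l //; nlia.
Qed.
End Bounds.

(** * Reduction to words in one factor *)

Section Filling.
Variable R : archiRealFieldType.
Local Notation L := (filiform R).
Local Notation E := (L * L)%type.
Variables p q : nat.
Local Notation bdn C := (bd p q (C%:R : R)).

(** A single constant controls the letters, the diameter and the area, so that constants simply add
    up when homotopies are composed. *)
Definition cheap (C n N : nat) (w w' : seq E) : Prop :=
  htpy (antidiags R) (bdn C) (C * n) (C * N) w w'.

Lemma bdn_le C C' e : (C <= C')%N -> bdn C e -> bdn C' e.
Proof. by move=> le; apply: bd_le; rewrite ler_nat. Qed.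

Lemma cheap_le C C' n N N' w w' : (C <= C')%N -> (N <= N')%N ->
  cheap C n N w w' -> cheap C' n N' w w'.
Proof.
move=> le leN h; apply: (@htpy_leN _ _ _ _ (C * N)); first by rewrite leq_mul.
by apply: htpy_sub h => [y|]; [apply: bdn_le | rewrite leq_mul2r le orbT].
Qed.

Lemma cheap_trans C1 C2 n N w1 w2 w3 :
  cheap C1 n N w1 w2 -> cheap C2 n N w2 w3 -> cheap (C1 + C2) n N w1 w3.
Proof.
move=> h1 h2; rewrite /cheap [((C1 + C2) * N)%N]mulnDl.
apply: htpy_trans; [apply: htpy_sub h1 => [y|] | apply: htpy_sub h2 => [y|]].
- by apply: bdn_le; rewrite leq_addr.
- by rewrite leq_mul2r leq_addr orbT.
- by apply: bdn_le; rewrite leq_addl.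
- by rewrite leq_mul2r leq_addl orbT.
Qed.

Lemma cheap_sym C n N w1 w2 : cheap C n N w1 w2 -> cheap C n N w2 w1.
Proof. exact: htpy_sym. Qed.

Lemma cheap_cong C D n N u v w w' : wover (bdn D) u -> (size u <= D * n)%N ->
  cheap C n N w w' -> cheap (C + D) n N (u ++ w ++ v) (u ++ w' ++ v).
Proof.
move=> hu hs h; apply: (@htpy_leN _ _ _ _ (C * N)); first by rewrite leq_mul2r leq_addr orbT.
rewrite mulnDl [(C * n + _)%N]addnC; apply: htpy_cong.
  apply: rad_short => //; apply: wover_sub hu => y; apply: bdn_le; exact: leq_addl.
by apply: htpy_sub h => // y; apply: bdn_le; rewrite leq_addr.
Qed.

(** The whole path is dilated from [t = 1] to [t = 0] in n^(k-2) steps, which is slow enough for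
    [dil_step] to bound the rungs. The end of the path does move, but through constants, and the
    mirrored increments of these lie in [antidiag]. *)
Lemma mirror k (r : nat) : (2 < k)%N -> (k <= p)%N -> (k <= q)%N -> exists C : nat,
  forall n (w : seq L), (0 < n)%N -> (size w <= n)%N ->
  (forall l, l \in w -> box k (r%:R : R) l) -> (wval w).1 = 0 ->
  (exists c, (wval w).2 = c%:P) ->
  cheap C n (n ^ (k - 1)) (map (@lettM R) w) [::].
Proof.
move=> k2 kp kq.
have k0 : (0 < k)%N by nlia.
have k1 : (1 < k)%N by nlia.
have [B hB] := @word_bound R k r k1; have [D hD] := @dil_step R k r B k2.
exists (8 + D + (r + r))%N => n w n0 le hw w1 [c w2].
set C := (8 + D + (r + r))%N.
have n1 : 1 <= n%:R :> R by rewrite ler1n.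
pose N := (n ^ (k - 2))%N.
have N0 : (0 < N)%N by rewrite expn_gt0 n0.
pose t i : R := (N - i)%:R / N%:R.
have N0' : 0 < N%:R :> R by rewrite ltr0n.
have ht i : 0 <= t i <= 1.
  by rewrite /t divr_ge0 ?ler0n // ler_pdivrMr // mul1r ler_nat leq_subr.
have t0 : t 0%N = 1 by rewrite /t subn0 divff // gt_eqF.
have tN : t N = 0 by rewrite /t subnn mul0r.
have htt i : (i < N)%N -> `|t i.+1 - t i| <= (n ^ (k - 2))%:R^-1.
  move=> lt; rewrite /t -mulrBl -(subnSK lt) -[(N - i.+1).+1%:R]natr1 opprD.
  by rewrite addrA subrr add0r mulN1r normrN ger0_norm ?invr_ge0 ?ler0n.
pose g i j := lettM (dil k (t i) (wval (take j w))).
have hsz j l : l \in take j w -> (size l.2 < k)%N by move=> /mem_take /hw[].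
have hg i j : g i j = wval [seq lettM (dil k (t i) l) | l <- take j w].
  have [_ h] := wval_dil (t i) k0 (@hsz j).
  by rewrite /g -h -wval_map_lettM -map_comp.
have hl l i : l \in w -> bdn C (lettM (dil k (t i) l)).
  move=> /hw hb; have := bd_box kp kq (box_dil (ht i) hb) (box_bar (box_dil (ht i) hb)).
  by rewrite -natrD; apply: bdn_le; rewrite leq_addl.
have hrow i m : (m <= size w)%N -> pw (g i) m = [seq lettM (dil k (t i) l) | l <- take m w].
  move=> lem; rewrite -[RHS]pw_word size_map size_take_min (minn_idPl lem).
  apply/eq_in_map => j; rewrite mem_iota /= add0n => lt.
  by rewrite !hg -!map_take !take_takel //; apply: ltnW.
have hbd i j : (j < size w)%N -> bdn C ((g i j)^-1 * g i j.+1)%g.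
  move=> lt; rewrite !hg (take_nth 1%g lt) map_rcons wval_rcons mulKg; apply: hl.
  exact: mem_nth.
have E0 : map (@lettM R) w = pw (g 0%N) (size w).
  rewrite hrow // take_size t0; apply/eq_in_map => l /hw[_ h _].
  by rewrite dil1.
have d1 u : dil k u 1%g = 1%g :> L.
  rewrite /dil /= mulr0; congr (_, _).
  by apply/polyP => i'; rewrite coef_dilp !coef0 mulr0 if_same.
rewrite E0; apply: (@htpy_leN _ _ _ _ (N.+1 * (size w).+3)).
  have -> : (k - 1 = (k - 2).+1)%N by nlia.
  rewrite expnS -/N; apply: (@leq_trans (8 * (n * N))%N); last first.
    by rewrite leq_mul2r; apply/orP; right; rewrite /C; nlia.
  apply: (@leq_trans ((2 * N) * (4 * n))%N); last by nlia.
  by apply: leq_mul; nlia.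
apply: (@htpy_sub _ _ (bdn C) _ (3 * n)%N) => //.
  by rewrite leq_mul2r; apply/orP; right; rewrite /C; nlia.
apply: rows_null => //.
- exact: bd_sym.
- by rewrite /g take0 wval_nil d1 lettM1.
- by move=> i j _ lt; apply: hbd.
- move=> i j lt lej; rewrite /g lettMV lettMM.
  have hwj l : l \in take j w -> box k r%:R l by move=> /mem_take /hw.
  have szj : (size (take j w) <= n)%N by rewrite size_take_min (leq_trans (geq_minr _ _)).
  have [h1 h2 h3] := hB _ _ n0 szj hwj.
  have [h4 h5 h6] := hD n _ _ _ n0 (ht i) (ht i.+1) (htt i lt) h1 h3.
  apply: (@bdn_le D); first by rewrite /C; nlia.
  by apply: bd_lettM => //; [exact: leq_trans h5 kp|exact: leq_trans h5 kq].
- move=> i j _ lej; rewrite hg.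
  have hov : wover (bdn C) [seq lettM (dil k (t i) l) | l <- take j w].
    by move=> x /mapP[l /mem_take hlw ->]; apply: hl.
  apply: (@ball_sub _ _ (bdn C) _ j); rewrite // ?(leq_trans lej) //.
  by have := ball_word (antidiags R) hov; rewrite size_map size_take_min (minn_idPl lej).
- move=> i lt; rewrite /g take0 wval_nil take_size.
  have dc u : dil k u (wval w) = (0, (u ^+ k.-1 * c)%:P).
    case: (wval w) w1 w2 => s f /= -> ->; rewrite /dil /= mulr0; congr (_, _).
    apply/polyP => i'; rewrite coef_dilp !coefC; case: i' => [|i'] /=.
      by rewrite subn0; case: ltnP => //; nlia.
    by rewrite mulr0 if_same.
  rewrite !d1 !dc mulVg /eqA invg1 mul1g lettMV lettMM fdivE subrr oppr0 tr0 -polyCB.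
  by eexists.
- by move=> j lt; rewrite /g tN !dil0 mulVg; apply: eqA_refl.
Qed.

Lemma cheap_scale m e C n w w' : (0 < m)%N -> cheap C (m * n) ((m * n) ^ e) w w' ->
  cheap (C * m ^ e.+1) n (n ^ e) w w'.
Proof.
move=> m0 h; have me : (0 < m ^ e)%N by rewrite expn_gt0 m0.
have mS : (m <= m ^ e.+1)%N by rewrite expnS leq_pmulr.
apply: (@htpy_leN _ _ _ _ (C * (m * n) ^ e)).
  by rewrite expnMn mulnA leq_mul2r leq_mul2l expnS leq_pmull ?orbT.
apply: htpy_sub h => [y|]; first by apply: bdn_le; rewrite leq_pmulr // expn_gt0 m0.
by rewrite mulnA leq_mul2r leq_mul2l mS !orbT.
Qed.

Lemma box_inv k (r : nat) : exists C : nat, (r <= C)%N /\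
  forall l : L, box k r%:R l -> box k C%:R (l^-1)%g.
Proof.
have [C hC] := nat_above ((1 + trK k (r%:R : R)) * r%:R); exists (r + C)%N.
split=> [|[s f] [/= h1 h2 h3]]; first exact: leq_addr.
have rC : r%:R <= (r + C)%:R :> R by rewrite ler_nat leq_addr.
rewrite finvE; split=> /=.
- by rewrite normrN; apply: le_trans rC.
- by rewrite size_polyN size_tr.
- have hf : fb 1 (r%:R : R) f by move=> i; rewrite expr1n mulr1.
  have hs : `|- s| <= r%:R * 1 by rewrite normrN mulr1.
  have := tr_fb (ltnW h2) (ler0n _ r) ltr01 hs hf.
  move=> h i; rewrite coefN normrN; have := h i; rewrite expr1n mulr1 => /le_trans; apply.
  by apply: le_trans hC _; rewrite ler_nat leq_addl.
Qed.

Lemma winv_map_lettX (w : seq L) : winv (map (@lettX R) w) = map (@lettX R) (winv w).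
Proof.
rewrite /winv map_rev -!map_comp; congr rev; apply: eq_map => l /=.
by rewrite lettXV.
Qed.

Lemma bd_lettX k (C : nat) l : (k <= p)%N -> (0 < q)%N -> box k (C%:R : R) l ->
  bdn (C + C) (lettX l).
Proof. by move=> kp q0 h; rewrite natrD; apply: (bd_box kp q0 h); apply: box1. Qed.
Lemma bd_lettY k (C : nat) l : (k <= q)%N -> (0 < p)%N -> box k (C%:R : R) l ->
  bdn (C + C) (lettY l).
Proof. by move=> kp q0 h; rewrite natrD; apply: (bd_box q0 kp _ h); apply: box1. Qed.

Lemma wover_lettX k (C : nat) w : (k <= p)%N -> (0 < q)%N ->
  (forall l, l \in w -> box k (C%:R : R) l) -> wover (bdn (C + C)) (map (@lettX R) w).
Proof. by move=> kp q0 h x /mapP[l hl ->]; apply: bd_lettX; last exact: h. Qed.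

Lemma wval_pair (w : seq E) : wval w = (wval (map fst w), wval (map snd w)).
Proof.
elim: w => [|[a b] w IH]; first by rewrite !wval_nil.
by rewrite /= !wval_cons IH.
Qed.

(** The ambient [p] and [q] stay fixed: a word in one copy of l_k may be filled with letters of both
    factors, and the exponent [k - 1] depends on this. *)
Definition null_fillable k := forall r : nat, exists C : nat, forall n (w : seq L),
  (0 < n)%N -> (size w <= n)%N -> (forall l, l \in w -> box k (r%:R : R) l) ->
  wval w = 1%g -> cheap C n (n ^ (k - 1)) (map (@lettX R) w) [::].

Definition fillable k k' := forall r : nat, exists C : nat, forall n (w : seq E),
  (0 < n)%N -> (size w <= n)%N ->
  (forall e, e \in w -> box k (r%:R : R) e.1 /\ box k' (r%:R : R) e.2) ->
  antidiag (wval w) -> cheap C n (n ^ (k - 1)) w [::].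

Lemma cheap_split n (C : nat) (a b : E -> E) w N : (0 < n)%N -> (size w <= n)%N ->
  wover (bdn C) w ->
  (forall x, x \in w -> [/\ bdn C (a x), bdn C (b x) & eqA (antidiags R) x (a x * b x)%g]) ->
  (forall x y, x \in w -> y \in w -> eqA (antidiags R) (a x * b y)%g (b y * a x)%g) ->
  (n ^ 2 <= N)%N -> cheap C.+2 n N w (map a w ++ map b w).
Proof.
move=> n0 hs hw h1 h2 hN; have h := split_word hw h1 h2.
apply: (@htpy_leN _ _ _ _ (size w * size w)).
  apply: leq_trans (_ : N <= _)%N; last by rewrite leq_pmull.
  by apply: leq_trans hN; rewrite -mulnn leq_mul.
apply: htpy_sub h => [y|]; first by apply: bdn_le; nlia.
by apply: leq_mul; nlia.
Qed.

Lemma cheap_catr C n N v w w' : cheap C n N w w' -> cheap C n N (w ++ v) (w' ++ v).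
Proof. exact: htpy_catr. Qed.

Lemma cheap_catl C D n N u w w' : wover (bdn D) u -> (size u <= D * n)%N ->
  cheap C n N w w' -> cheap (C + D) n N (u ++ w) (u ++ w').
Proof. by move=> h1 h2 h; have := cheap_cong [::] h1 h2 h; rewrite !cats0. Qed.

Lemma cheap_wV D n N u : wover (bdn D) u -> (size u <= D * n)%N -> (n <= N)%N ->
  cheap D n N (u ++ winv u) [::].
Proof.
move=> h1 h2 le; apply: (@htpy_leN _ _ _ _ (size u)).
  by apply: leq_trans h2 _; rewrite leq_mul.
by apply: htpy_wV => //; [exact: bd_sym|exact: rad_short].
Qed.

Lemma cheap_Vw D n N u : wover (bdn D) u -> (size u <= D * n)%N -> (n <= N)%N ->
  cheap D n N (winv u ++ u) [::].
Proof.
move=> h1 h2 le; have := @cheap_wV D n N (winv u); rewrite winvK size_winv; apply => //.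
by apply: wover_winv => //; apply: bd_sym.
Qed.

Lemma cheap_swap D n N u v : wover (bdn D) u -> wover (bdn D) v ->
  (size u <= D * n)%N -> (size v <= D * n)%N -> (n ^ 2 <= N)%N ->
  (forall x y, x \in u -> y \in v -> (x * y)%g = (y * x)%g) ->
  cheap (2 * D + D * D) n N (u ++ v) (v ++ u).
Proof.
move=> hu hv su sv hN hc; apply: (@htpy_leN _ _ _ _ (size u * size v)).
  apply: (@leq_trans (D * D * (n ^ 2))%N); last by apply: leq_mul => //; nlia.
  by apply: leq_trans (leq_mul su sv) _; rewrite -mulnn mulnACA.
apply: (@htpy_sub _ _ (bdn D) _ (D * n + D * n)%N) => [y||]; last first.
- apply: swap => //; [exact: rad_short|exact: rad_short|] => x y hx hy.
  by rewrite hc //; apply: eqA_refl.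
- by rewrite mulnDl -mulnDl addnn -mul2n leq_addr.
- by apply: bdn_le; nlia.
Qed.

(** Let [u] and [v] be the two components of [w]. After separating them, the word of [bar v] in the
    first factor is inserted next to its inverse. Together with [v] in the second factor it forms a
    mirrored word, which [mirror] contracts. What remains is [u] followed by the inverse of [bar v];
    it lies in the first factor and has value 1, as [u] and [v] have opposite central values. *)
Lemma fillable_null k k' : (2 < k')%N -> (k' <= k)%N -> (k <= p)%N -> (k' <= q)%N ->
  null_fillable k -> fillable k k'.
Proof.
move=> k2 kk kp kq hN r.
have p0 : (0 < p)%N by nlia.
have q0 : (0 < q)%N by nlia.
have k'p : (k' <= p)%N by exact: leq_trans kk kp.
have [Cm hm] := mirror r k2 k'p kq.
have [Ci [rCi hi]] := box_inv k r.
have [Cn hn] := hN Ci.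
have [Cf hf] : exists Cf : nat, forall n (w : seq E),
  (0 < n)%N -> (size w <= n)%N ->
  (forall e, e \in w -> box k (r%:R : R) e.1 /\ box k' (r%:R : R) e.2) ->
  antidiag (wval w) -> cheap Cf n (n ^ (k - 1)) w
     (map (@lettX R) (map fst w ++ winv (map (@bar R) (map snd w)))).
  eexists => n w n0 sw hw [c hc].
  have hv l : l \in map snd w -> box k' r%:R l by move=> /mapP[e /hw[_ h] ->].
  have hu l : l \in map fst w -> box k r%:R l by move=> /mapP[e /hw[h _] ->].
  have n2 : (n ^ 2 <= n ^ (k - 1))%N by rewrite leq_pexp2l //; nlia.
  have n1 : (n <= n ^ (k - 1))%N by apply: leq_trans n2; rewrite -mulnn leq_pmull.
  pose w1 := map fst w; pose w2 := map snd w; pose w2' := map (@bar R) w2.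
  have hv' l : l \in w2' -> box k' r%:R l by move=> /mapP[m hm' ->]; apply/box_bar/hv.
  have hX : wover (bdn (r + r).+1) (map (@lettX R) w1).
    by apply: wover_sub (wover_lettX kp q0 hu) => y; apply: bdn_le.
  have hX' : wover (bdn (r + r).+1) (map (@lettX R) w2').
    by apply: wover_sub (wover_lettX k'p q0 hv') => y; apply: bdn_le.
  have hXi : wover (bdn (r + r).+1) (winv (map (@lettX R) w2')).
    by apply: wover_winv => //; apply: bd_sym.
  have e1 : map (fun e => lettX e.1) w = map (@lettX R) w1 by rewrite /w1 -map_comp.
  have e2 : map (fun e => lettY e.2) w = map (@lettY R) w2 by rewrite /w2 -map_comp.
  have s1 : (size (map (@lettX R) w1) <= (r + r).+1 * n)%N.
    by rewrite !size_map; apply: leq_trans sw _; rewrite leq_pmull.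
  have s2 : (size (map (@lettX R) w2') <= (r + r).+1 * n)%N.
    by rewrite !size_map; apply: leq_trans sw _; rewrite leq_pmull.
  have hc2 : wval w2 = (0, - c%:P) by move: hc; rewrite wval_pair => -[].
  apply: cheap_trans.
    apply: (cheap_split (C := (r + r)%N) (a := fun e => lettX e.1) (b := fun e => lettY e.2) n0 sw) => //.
    - by move=> [a b] /hw[h1 h2]; rewrite natrD; apply: bd_box h1 h2.
    - move=> [a b] /hw[h1 h2]; split; [exact: bd_lettX h1|exact: bd_lettY h2|].
      by rewrite /lettX /lettY pmulE mulg1 mul1g; apply: eqA_refl.
    - by move=> [a b] [a' b'] _ _; rewrite lettXY; apply: eqA_refl.
  rewrite e1 e2 map_cat -winv_map_lettX.
  apply: cheap_trans.
    apply: cheap_catl hX s1 _; rewrite -[map (@lettY R) w2]cat0s; apply: cheap_catr.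
    by apply: cheap_sym; apply: cheap_Vw hX' s2 n1.
  rewrite -/w1 -/w2 -/w2' -[X in cheap _ _ _ _ X]cats0 -!catA.
  apply: cheap_catl hX s1 _.
  apply: cheap_catl hXi _ _; first by rewrite size_winv.
  apply: cheap_trans; last first.
    apply: cheap_le (hm n w2' n0 _ hv' _ _); [exact: leqnn| |by rewrite !size_map| |].
    - by rewrite leq_pexp2l //; nlia.
    - by rewrite wval_map_bar hc2.
    - by exists c; rewrite wval_map_bar hc2 /= opprK.
  apply: cheap_sym.
  have -> : map (@lettX R) w2' ++ map (@lettY R) w2 =
    map (fun e => lettX e.1) (map (@lettM R) w2') ++ map (fun e => lettY e.2) (map (@lettM R) w2').
    by rewrite -!map_comp; congr (_ ++ _); apply: eq_map => l /=; rewrite barK.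
  apply: (cheap_split (C := (r + r)%N) n0).
  - by rewrite !size_map.
  - move=> x /mapP[l /hv' hl ->]; rewrite natrD; apply: (bd_box k'p kq hl); exact: box_bar.
  - move=> x /mapP[l /hv' hl ->]; split; [exact: bd_lettX hl|by apply: bd_lettY kq p0 _; apply: box_bar|].
    by rewrite /lettX /lettY pmulE mulg1 mul1g; apply: eqA_refl.
  - by move=> [a b] [a' b'] _ _; rewrite lettXY; apply: eqA_refl.
  - exact: n2.
eexists => n w n0 sw hw hA; apply: cheap_trans (hf n w n0 sw hw hA) _.
have [c hc] := hA.
apply: (@cheap_scale 2) => //; apply: hn.
- by rewrite muln_gt0.
- by rewrite size_cat size_winv !size_map mul2n -addnn leq_add.
- move=> l; rewrite mem_cat => /orP[/mapP[e /hw[h _] ->]|].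
    by apply: box_le h => //; rewrite ler_nat.
  rewrite mem_rev => /mapP[m /mapP[m' /mapP[e /hw[_ h] ->] ->] ->].
  by apply: hi; apply: box_le (box_bar h).
- move: hc; rewrite wval_pair => -[h1 h2].
  rewrite wval_cat wval_winv wval_map_bar h1 h2 /bar /= opprK.
  exact: mulgV.
Qed.
End Filling.

(** * Words in the Heisenberg group *)

Section Heisenberg.
Variable R : archiRealFieldType.
Local Notation L := (filiform R).
Local Notation E := (L * L)%type.
Variables p q : nat.
Local Notation bdn C := (bd p q (C%:R : R)).
Implicit Types (s t a b c x : R).

Lemma leq_or_gtn m n : (m <= n)%N \/ (n < m)%N.
Proof. by case: leqP; [left|right]. Qed.

Definition lin a b : {poly R} := a *: 'X + b%:P.

Lemma coef_lin a b i : (lin a b)`_i = if i == 0%N then b else if i == 1%N then a else 0.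
Proof.
rewrite coefD coefZ coefX coefC.
by case: i => [|[|i]] /=; rewrite ?mulr0 ?mulr1 ?add0r ?addr0.
Qed.
Lemma size_lin a b : (size (lin a b) <= 2)%N.
Proof. by apply/leq_sizeP => i; rewrite coef_lin; case: i => [|[|]]. Qed.
Lemma tr_lin s a b : tr s (lin a b) = lin a (b + a * s).
Proof.
rewrite /lin trD trZ trC /tr comp_polyX scalerDr -!addrA; congr (_ + _).
by rewrite addrC -mul_polyC -polyCM -polyCD.
Qed.
Lemma linB a b c x : lin a b - lin c x = lin (a - c) (b - x).
Proof. by apply/polyP => i; rewrite coefB !coef_lin; case: i => [|[|i]] //=; rewrite subrr. Qed.
Lemma linD a b c x : lin a b + lin c x = lin (a + c) (b + x).
Proof.
by apply/polyP => i; rewrite [LHS]coefD !coef_lin; case: i => [|[|i]] //=; rewrite addr0.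
Qed.
Lemma lin_div s a b s' a' b' :
  (((s, lin a b) : L)^-1 * ((s', lin a' b') : L))%g =
  (s' - s, lin (a' - a) (b' - b - (a' - a) * s)) :> L.
Proof. by rewrite fdivE linB tr_lin mulrN. Qed.
Lemma linE (f : {poly R}) : (size f <= 2)%N -> f = lin f`_1 f`_0.
Proof.
move=> h; apply/polyP => i; rewrite coef_lin; case: i => [|[|i]] //=.
by rewrite nth_default // (leq_trans h).
Qed.
Lemma lin00 : lin 0 0 = 0.
Proof. by rewrite /lin scale0r polyC0 addr0. Qed.

Lemma bd_lin (C : nat) s a b s' a' b' : (2 < p)%N -> (2 < q)%N ->
  `|s| <= C%:R -> `|s'| <= C%:R -> `|a| <= C%:R -> `|a'| <= C%:R -> `|b + b'| <= C%:R ->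
  bdn C ((s, lin a b), (s', lin a' b')).
Proof.
move=> p2 q2 h1 h2 h3 h4 h5; left; split=> //=.
- by split; apply: leq_ltn_trans (size_lin _ _) _.
- split=> i i0; rewrite coef_lin expr1n mulr1 (gtn_eqF i0); case: ifP => _ //;
  by rewrite normr0 ler0n.
- by rewrite !coef_lin.
Qed.

(* Isotropic deformation, for ds /\ dth - dt /\ dph, of the loop (s, th): first
   ph = (c - s th) / n is switched on, then th is scaled to 0 while t moves
   from 0 to n, and finally s and ph are scaled to 0. *)
Definition iso_pt (n l1 l2 l3 s th c : R) : E :=
  (((1 - l3) * s, lin ((1 - l2) * th) ((1 - l3) * (c - l2 * (s * th)))),
   (n * l2, lin (l1 * (1 - l3) * ((c - s * th) / n)) 0)).

Definition phase (l1 l2 l3 : R) : Prop := exists2 x, 0 <= x <= 1 &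
  [\/ [/\ l1 = x, l2 = 0 & l3 = 0], [/\ l1 = 1, l2 = x & l3 = 0] | [/\ l1 = 1, l2 = 1 & l3 = x]].

Lemma phase_bounds l1 l2 l3 : phase l1 l2 l3 ->
  [/\ 0 <= l1 <= 1, 0 <= 1 - l2 <= 1 & 0 <= 1 - l3 <= 1].
Proof. by case=> x /andP[x0 x1] [[-> -> ->]|[-> -> ->]|[-> -> ->]]; split; apply/andP; split; lra. Qed.

(** The positions have order n, so each of [b] and [b'] can be large. Their sum is bounded in every
    phase because the deformation is isotropic: the terms that depend on the position cancel between
    the two factors. *)
Lemma iso_row (n l1 l2 l3 s th c sg al be : R) : 0 < n -> phase l1 l2 l3 ->
  exists a a' b b', [/\ ((iso_pt n l1 l2 l3 s th c)^-1 *
     iso_pt n l1 l2 l3 (s + sg) (th + be) (c + al + be * s))%g =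
     (((1 - l3) * sg, lin a b), (0, lin a' b')) :> E,
    a = (1 - l2) * be, a' = l1 * (1 - l3) * ((al - sg * (th + be)) / n) & b + b' = (1 - l2) * al].
Proof.
move=> n0 [x _ hx]; rewrite pinvE pmulE !lin_div; do 4 eexists; split.
- by rewrite -mulrBr addrAC subrr add0r subrr.
- by ring.
- by field; rewrite gt_eqF.
- by case: hx => -[-> -> ->]; field; rewrite gt_eqF.
Qed.

Lemma iso_col1 (n x d s th c : R) :
  ((iso_pt n x 0 0 s th c)^-1 * iso_pt n (x + d) 0 0 s th c)%g =
  ((0, lin 0 0), (0, lin (d * ((c - s * th) / n)) 0)) :> E.
Proof.
rewrite pinvE pmulE !lin_div; congr ((_, lin _ _), (_, lin _ _)); ring.
Qed.
Lemma iso_col2 (n x d s th c : R) :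
  ((iso_pt n 1 x 0 s th c)^-1 * iso_pt n 1 (x + d) 0 s th c)%g =
  ((0, lin (- (d * th)) 0), (n * d, lin 0 0)) :> E.
Proof.
rewrite pinvE pmulE !lin_div; congr ((_, lin _ _), (_, lin _ _)); ring.
Qed.
(** For [d] of order 1/n the two constant terms have order n; they are opposite and vanish modulo
    [antidiag]. *)
Lemma iso_col3 (n x d s th c : R) : 0 < n ->
  ((iso_pt n 1 1 x s th c)^-1 * iso_pt n 1 1 (x + d) s th c)%g =
  ((- (d * s), lin 0 (- (d * (c - s * th)))),
   (0, lin (- (d * ((c - s * th) / n))) (d * (c - s * th)))) :> E.
Proof.
move=> n0; rewrite pinvE pmulE !lin_div; congr ((_, lin _ _), (_, lin _ _)); try ring.
by field; rewrite gt_eqF.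
Qed.

Lemma null_fillable3 : (2 < p)%N -> (2 < q)%N -> null_fillable R p q 3.
Proof.
move=> p2 q2 r; have [B hB] := @word_bound R 3 r isT.
have [C hC] := nat_above (r%:R + r%:R * B%:R + r%:R * r%:R + B%:R : R).
(* The number 60 is generous: the radius found below is at most 12 n and the area at most 16 n^2. *)
exists (60 + C)%N => n w n0 sw hw w1.
have n1 : 1 <= n%:R :> R by rewrite ler1n.
have n0' : 0 < n%:R :> R by rewrite ltr0n.
have B0 : 0 <= B%:R :> R by [].
have r0 : 0 <= r%:R :> R by [].
(* Three phases of [n] steps each: truncated subtraction keeps a parameter at 0 before its phase,
   and [minn] keeps it at 1 afterwards. *)
pose l1 i : R := (minn i n)%:R / n%:R.
pose l2 i : R := (minn (i - n) n)%:R / n%:R.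
pose l3 i : R := (minn (i - n.*2) n)%:R / n%:R.
pose v j := wval (take j w).
pose s j := (v j).1; pose th j := (v j).2`_1; pose c j := (v j).2`_0.
have vb j : [/\ `|s j| <= r%:R * n%:R, (size (v j).2 <= 2)%N, `|th j| <= B%:R * n%:R &
    `|c j| <= B%:R * n%:R ^+ 2].
  have sj : (size (take j w) <= n)%N by rewrite size_take_min (leq_trans (geq_minr _ _)).
  have hj l : l \in take j w -> box 3 r%:R l by move=> /mem_take /hw.
  have [h1 h2 h3] := hB _ _ n0 sj hj; split=> //.
    by rewrite -(ler_pM2r n0') -mulrA -expr2; have := h3 1%N; rewrite expr1.
  by have := h3 0%N; rewrite expr0 mulr1.
have vE j : v j = (s j, lin (th j) (c j)).
  by have [_ h _ _] := vb j; rewrite -linE // /s; case: (v j).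
have dv j : (j < size w)%N -> exists sg al be, [/\ `|sg| <= r%:R, `|al| <= r%:R, `|be| <= r%:R &
   [/\ s j.+1 = s j + sg, th j.+1 = th j + be & c j.+1 = c j + al + be * s j]].
  move=> lt; pose l := nth 1%g w j; have [hl1 hl2 hl3] := hw _ (mem_nth 1%g lt : l \in w).
  have lE : l = (l.1, lin l.2`_1 l.2`_0) by rewrite -linE //; case: (l).
  exists l.1, l.2`_0, l.2`_1; split=> //.
  have : v j.+1 = (v j * ((l.1, lin l.2`_1 l.2`_0) : L))%g.
    by rewrite -lE /v (take_nth 1%g lt) wval_rcons.
  rewrite [v j.+1]vE [v j]vE fmulE tr_lin linD /= => -[-> e].
  have := congr1 (fun f : {poly R} => f`_1) e; have := congr1 (fun f : {poly R} => f`_0) e.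
  by rewrite /= !coef_lin /= => -> ->; rewrite addrA.
pose g i j := iso_pt n%:R (l1 i) (l2 i) (l3 i) (s j) (th j) (c j).
(* Here [c] and [s * th] have order n^2. Division by [n] makes this coordinate of order n, so it
   moves by O(1) in each of the [n] steps. *)
have phi j : `|(c j - s j * th j) / n%:R| <= (B%:R + r%:R * B%:R) * n%:R.
  rewrite normrM normfV (ger0_norm (ltW n0')) ler_pdivrMr //.
  have [h1 _ h3 h4] := vb j; apply: le_trans (ler_normB _ _) _.
  rewrite -mulrA -expr2 mulrDl; apply: lerD => //; rewrite normrM expr2 mulrACA; exact: ler_pM.
have lam i : (i <= 3 * n)%N -> phase (l1 i) (l2 i) (l3 i).
  move=> le; rewrite /phase /l1 /l2 /l3; have [li|li] := leq_or_gtn i n.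
    exists (i%:R / n%:R); first by rewrite divr_ge0 ?ler0n //= ler_pdivrMr // mul1r ler_nat.
    apply: Or31; split; first by rewrite (minn_idPl li).
      by rewrite (_ : (i - n = 0)%N) ?min0n ?mul0r //; nlia.
    by rewrite (_ : (i - n.*2 = 0)%N) ?min0n ?mul0r //; nlia.
  have [li2|li2] := leq_or_gtn i n.*2.
    exists ((i - n)%:R / n%:R).
      by rewrite divr_ge0 ?ler0n //= ler_pdivrMr // mul1r ler_nat; nlia.
    apply: Or32; split; first by rewrite (minn_idPr (ltnW li)) divff // gt_eqF.
      by rewrite (minn_idPl _) //; nlia.
    by rewrite (_ : (i - n.*2 = 0)%N) ?min0n ?mul0r //; nlia.
  exists ((i - n.*2)%:R / n%:R).
    by rewrite divr_ge0 ?ler0n //= ler_pdivrMr // mul1r ler_nat; nlia.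
  apply: Or33; split; first by rewrite (minn_idPr (ltnW li)) divff // gt_eqF.
    by rewrite (minn_idPr _) ?divff ?gt_eqF //; nlia.
  by rewrite (minn_idPl _) //; nlia.
have step i : (i < 3 * n)%N -> exists x, [\/
   [/\ (l1 i, l2 i, l3 i) = (x, 0, 0) & (l1 i.+1, l2 i.+1, l3 i.+1) = (x + n%:R^-1, 0, 0)],
   [/\ (l1 i, l2 i, l3 i) = (1, x, 0) & (l1 i.+1, l2 i.+1, l3 i.+1) = (1, x + n%:R^-1, 0)] |
   [/\ (l1 i, l2 i, l3 i) = (1, 1, x) & (l1 i.+1, l2 i.+1, l3 i.+1) = (1, 1, x + n%:R^-1)]].
  move=> lt; rewrite /l1 /l2 /l3.
  have nn : n%:R / n%:R = 1 :> R by rewrite divff // gt_eqF.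
  have [li|li] := leq_or_gtn i.+1 n; [|have [li2|li2] := leq_or_gtn i.+1 n.*2].
  - exists (i%:R / n%:R); apply: Or31.
    have -> : minn i n = i by nlia.
    have -> : minn i.+1 n = i.+1 by nlia.
    have -> : minn (i - n) n = 0%N by nlia.
    have -> : minn (i.+1 - n) n = 0%N by nlia.
    have -> : minn (i - n.*2) n = 0%N by nlia.
    have -> : minn (i.+1 - n.*2) n = 0%N by nlia.
    by rewrite !mul0r -[i.+1%:R]natr1 mulrDl mul1r.
  - exists ((i - n)%:R / n%:R); apply: Or32.
    have -> : minn i n = n by nlia.
    have -> : minn i.+1 n = n by nlia.
    have -> : minn (i - n) n = (i - n)%N by nlia.
    have -> : minn (i.+1 - n) n = (i - n).+1%N by nlia.
    have -> : minn (i - n.*2) n = 0%N by nlia.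
    have -> : minn (i.+1 - n.*2) n = 0%N by nlia.
    by rewrite !mul0r nn -[(i - n).+1%:R]natr1 mulrDl mul1r.
  - exists ((i - n.*2)%:R / n%:R); apply: Or33.
    have -> : minn i n = n by nlia.
    have -> : minn i.+1 n = n by nlia.
    have -> : minn (i - n) n = n by nlia.
    have -> : minn (i.+1 - n) n = n by nlia.
    have -> : minn (i - n.*2) n = (i - n.*2)%N by nlia.
    have -> : minn (i.+1 - n.*2) n = (i - n.*2).+1 by nlia.
    by rewrite nn -[(i - n.*2).+1%:R]natr1 mulrDl mul1r.
have hCr : r%:R + r%:R * B%:R <= C%:R :> R.
  by apply: le_trans hC; rewrite -addrA lerDl addr_ge0 // mulr_ge0.
have hCB : B%:R <= C%:R :> R by apply: le_trans hC; rewrite lerDr !addr_ge0 ?mulr_ge0.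
have hC1 : r%:R <= C%:R :> R by apply: le_trans hCr; rewrite lerDl mulr_ge0.
have hCrB : B%:R + r%:R * B%:R <= C%:R :> R.
  apply: le_trans hC; rewrite addrC lerD2r; apply: le_trans (_ : r%:R + r%:R * B%:R <= _).
    by rewrite lerDr.
  by rewrite lerDl mulr_ge0.
have hC0 : 0 <= C%:R :> R by [].
have up x : x <= C%:R -> x <= (60 + C)%:R.
  by move=> h; apply: le_trans h _; rewrite ler_nat leq_addl.
have up1 : 1 <= (60 + C)%:R :> R by rewrite -[1]/(1%:R) ler_nat.
have up0 : 0 <= (60 + C)%:R :> R by [].
have nV : n%:R * n%:R^-1 = 1 :> R by rewrite divff // gt_eqF.
have v0 : v 0%N = 1%g by rewrite /v take0 wval_nil.
have vm : v (size w) = 1%g by rewrite /v take_size w1.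
have G0 i : g 0%N i = lettX (v i).
  by rewrite vE /g /iso_pt /l1 /l2 /l3 !min0n !mul0r mulr0 !subr0 !mul1r lin00.
have E0 : map (@lettX R) w = pw (g 0%N) (size w).
  rewrite -[LHS]pw_word size_map; apply: eq_map => j.
  by rewrite !G0 -!map_take !wval_map_lettX.
rewrite E0; apply: (@htpy_leN _ _ _ _ ((3 * n).+1 * (size w).+3)%N).
  apply: (@leq_trans ((4 * n) * (4 * n))%N); first by apply: leq_mul; nlia.
  by rewrite mulnACA -mulnn leq_mul2r; apply/orP; right; nlia.
apply: (@htpy_sub _ _ (bdn (60 + C)) _ (3 * (3 * n + size w))%N) => //.
  by apply: (@leq_trans (60 * n)%N); [nlia | rewrite leq_mul2r leq_addr orbT].
apply: rows_null_grid.
- exact: bd_sym.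
- by rewrite G0 v0.
- move=> i j le lt; have [sg [al [be [h1 h2 h3 [e1 e2 e3]]]]] := dv j lt.
  rewrite /g e1 e2 e3.
  have ph := lam i le; have [a [a' [b [b' [-> ea ea' eb]]]]] :=
    iso_row (s j) (th j) (c j) sg al be n0' ph.
  have [b1 b2 b3] : [/\ 0 <= l1 i <= 1, 0 <= 1 - l2 i <= 1 & 0 <= 1 - l3 i <= 1].
    exact: phase_bounds ph.
  have small x y z : 0 <= x <= 1 -> `|y| <= z -> `|x * y| <= z.
    by move=> /andP[x0 x1] hy; rewrite normrM (ger0_norm x0); apply: le_trans hy; rewrite ler_piMl.
  apply: bd_lin => //.
  + by apply: up; apply: le_trans hC1; apply: small.
  + by rewrite normr0.
  + by rewrite ea; apply: up; apply: le_trans hC1; apply: small.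
  + rewrite ea' -mulrA; apply: up; apply: le_trans hCr; apply: (small) => //; apply: (small) => //.
    rewrite normrM normfV (ger0_norm (ltW n0')) ler_pdivrMr // mulrDl.
    apply: le_trans (ler_normB _ _) _; apply: lerD; first by apply: le_trans h2 _; rewrite ler_peMr.
    rewrite normrM -mulrA; apply: ler_pM => //; rewrite -e2; by have [] := vb j.+1.
  + by rewrite eb; apply: up; apply: le_trans hC1; apply: small.
- move=> i j lt le; rewrite /g.
  have [b1 b2 b3 b4] := vb j; have b5 := phi j.
  have dphi : `|n%:R^-1 * ((c j - s j * th j) / n%:R)| <= C%:R.
    apply: le_trans hCrB; rewrite mulrC normrM normfV (ger0_norm (ltW n0')) ler_pdivrMr //.
  have dsm x y : `|x| <= y * n%:R -> `|n%:R^-1 * x| <= y.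
    by move=> h; rewrite mulrC normrM normfV (ger0_norm (ltW n0')) ler_pdivrMr.
  have [x [[[-> -> ->] [-> -> ->]]|[[-> -> ->] [-> -> ->]]|[[-> -> ->] [-> -> ->]]]] := step i lt.
  + rewrite iso_col1; apply: bd_lin => //; rewrite ?addr0 ?normr0 //; exact: up.
  + rewrite iso_col2 nV; apply: bd_lin => //; rewrite ?addr0 ?normr0 ?normr1 ?normrN //.
    by apply: up; apply: le_trans hCB; apply: dsm.
  + rewrite iso_col3 //; apply: bd_lin => //; rewrite ?addNr ?normr0 ?normrN //.
      by apply: up; apply: le_trans hC1; apply: dsm.
    exact: up.
- move=> i lt; have -> : forall i, g i (size w) = g i 0%N.
    by move=> i'; rewrite /g /s /th /c v0 vm.
  have -> : forall i, g i (size w) = g i 0%N by move=> i'; rewrite /g /s /th /c v0 vm.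
  exact: eqA_refl.
(* In the last row [s], [th] and [ph] have been scaled to 0 and [t] equals [n] at every vertex, so
   the path is constant. *)
- move=> j lt; suff hj : forall j', g (3 * n)%N j' = g (3 * n)%N 0%N.
    by rewrite (hj j) (hj j.+1) mulVg; apply: eqA_refl.
  move=> j'; rewrite /g /iso_pt /l1 /l2 /l3.
  have -> : minn (3 * n) n = n by nlia.
  have -> : minn (3 * n - n) n = n by nlia.
  have -> : minn (3 * n - n.*2) n = n by nlia.
  by rewrite divff ?gt_eqF // subrr !mulr0 !mul0r.
Qed.
End Heisenberg.

(** * The induction step *)

Section Step.
Variable R : archiRealFieldType.
Local Notation L := (filiform R).
Local Notation E := (L * L)%type.
Variables p q k : nat.
Hypotheses (k3 : (3 < k)%N) (kp : (k <= p)%N) (kq : (k.-1 <= q)%N).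
Hypothesis fill : fillable R p q k.-1 k.-1.
Local Notation cheapk C n := (cheap p q C n (n ^ (k - 2))).
Local Notation bdn C := (bd p q (C%:R : R)).
Local Notation X w := (map (@lettX R) w).
Implicit Types (u v w : seq L) (l g h : L) (s t : R) (f : {poly R}).

Let k0 : (0 < k)%N. Proof. by nlia. Qed.
Let k1 : (1 < k)%N. Proof. by nlia. Qed.
Let q0 : (0 < q)%N. Proof. by nlia. Qed.
Let p0 : (0 < p)%N. Proof. by nlia. Qed.

Lemma expk2 (n e : nat) : (0 < n)%N -> (e <= 2)%N -> (n ^ e <= n ^ (k - 2))%N.
Proof. by move=> n0 he; rewrite leq_pexp2l //; nlia. Qed.
Lemma n_le_expk2 (n : nat) : (0 < n)%N -> (n <= n ^ (k - 2))%N.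
Proof. by move=> n0; rewrite -{1}(expn1 n); apply: expk2. Qed.

(* av t is the power x_2^t of the top generator, and th l the exponent of x_2 in l. *)
Definition th l : R := l.2`_(k - 2).
Definition top : {poly R} := 'X^(k - 2).
Definition av (t : R) : L := (0, t *: top).

Lemma tr_top s f : (size f < k)%N -> (tr s f)`_(k - 2) = f`_(k - 2).
Proof. by move=> h; apply: tr_coef_top; nlia. Qed.
Lemma thM g h : (size h.2 < k)%N -> th (g * h)%g = th g + th h.
Proof. by case: g h => s f [t g] /= hg; rewrite /th fmulE /= coefD tr_top. Qed.
Lemma thV g : (size g.2 < k)%N -> th (g^-1)%g = - th g.
Proof. by case: g => s f hf; rewrite /th finvE /= coefN tr_top. Qed.
Lemma th_av t : th (av t) = t.
Proof. by rewrite /th /av /= coefZ coefXn eqxx mulr1. Qed.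
Lemma lettX_avD s t : (lettX (av s) * lettX (av t))%g = lettX (av (s + t)).
Proof. by rewrite lettXM /av fmulE tr0 addr0 -scalerDl. Qed.
Lemma lettX_avX (i : nat) t : (lettX (av t) ^+ i)%g = lettX (av (i%:R * t)).
Proof.
elim: i => [|i IH]; first by rewrite mul0r /av scale0r.
by rewrite expgS IH lettX_avD -natr1 mulrDl mul1r addrC.
Qed.
Lemma size_top f : (size f < k)%N -> f`_(k - 2) = 0 -> (size f < k.-1)%N.
Proof.
move=> h f0; have -> : k.-1 = (k - 2).+1 by nlia.
rewrite ltnS; apply/leq_sizeP => i; rewrite leq_eqVlt => /orP[/eqP <- //|lt].
by rewrite nth_default // (leq_trans _ lt) // -ltnS; apply: leq_trans h _; nlia.
Qed.

Definition sizes u := forall l, l \in u -> (size l.2 < k)%N.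
(** The total variation of the exponent of the top generator along [u]; letters that are powers of x
    do not contribute, so long words can have a bounded total. *)
Definition tot u : R := \sum_(l <- u) `|th l|.

Lemma tot_cat u v : tot (u ++ v) = tot u + tot v. Proof. exact: big_cat. Qed.
Lemma tot_cons l u : tot (l :: u) = `|th l| + tot u. Proof. exact: big_cons. Qed.
Lemma tot_ge0 u : 0 <= tot u. Proof. exact: sumr_ge0. Qed.
Lemma tot_winv u : sizes u -> tot (winv u) = tot u.
Proof.
move=> h; rewrite /tot /winv big_rev big_map !big_seq; apply: eq_bigr => l /h hl.
by rewrite thV // normrN.
Qed.
Lemma tot_nseq0 n s : tot (nseq n ((s, 0) : L)) = 0.
Proof.
rewrite /tot big_nseq; elim: n => //= n ->.
by rewrite /th /= coef0 normr0 addr0.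
Qed.

Lemma th_wval u : sizes u -> (size (wval u).2 < k)%N /\ `|th (wval u)| <= tot u.
Proof.
elim: u => [_|l u IH hu].
  rewrite wval_nil /th foneE /= size_poly0 coef0 normr0; split=> //; exact: tot_ge0.
have [|h1 h2] := IH; first by move=> m hm; apply: hu; rewrite inE hm orbT.
have hl : (size l.2 < k)%N by apply: hu; rewrite mem_head.
rewrite wval_cons; split; first by apply: size_polyDlt => //; rewrite size_tr.
by rewrite thM // tot_cons; apply: le_trans (ler_normD _ _) _; rewrite lerD2l.
Qed.

Lemma pw_lettX (g : nat -> L) m : pw (fun j => lettX (g j)) m = X (pw g m).
Proof. by rewrite /pw -map_comp; apply: eq_map => j /=; rewrite lettXV lettXM. Qed.

Lemma box_av (r : nat) t : `|t| <= r%:R -> box k (r%:R : R) (av t).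
Proof.
move=> h; have r0 : 0 <= r%:R :> R by [].
split=> /=; first by rewrite normr0.
  apply: leq_ltn_trans (size_scale_leq _ _) _; rewrite size_polyXn; nlia.
by move=> i; rewrite coefZ coefXn; case: eqP => _; rewrite ?mulr1 // mulr0 normr0.
Qed.

Lemma box_mul (r s : nat) : exists C : nat, forall l m, box k (r%:R : R) l ->
  box k (s%:R : R) m -> box k (C%:R : R) (l * m)%g.
Proof.
have [C hC] := nat_above (r%:R + (1 + trK k (r%:R : R)) * s%:R); exists (r + s + C)%N.
move=> [a f] [b g] [/= h1 h2 h3] [/= h1' h2' h3']; rewrite fmulE; split=> /=.
- apply: le_trans (ler_normD _ _) _; apply: (@le_trans _ _ (r + s)%:R).
    by rewrite natrD lerD.
  by rewrite ler_nat leq_addr.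
- by apply: size_polyDlt => //; rewrite size_tr.
- have hg : fb 1 (s%:R : R) g by move=> i; rewrite expr1n mulr1.
  have ha : `|a| <= r%:R * 1 by rewrite mulr1.
  have h := tr_fb (ltnW h2') (ler0n _ r) ltr01 ha hg.
  move=> i; rewrite coefD; apply: le_trans (ler_normD _ _) _.
  apply: (@le_trans _ _ C%:R); last by rewrite ler_nat leq_addl.
  by apply: le_trans hC; apply: lerD => //; have := h i; rewrite expr1n mulr1.
Qed.

(* Multiplying the points of a path by the powers of 'X^(k-2) that cancel
   their exponents gives a path in the subgroup l_(k-1). *)
Lemma few_tops (r : nat) : exists C : nat, forall n u, (0 < n)%N -> (size u <= r * n)%N ->
  (forall l, l \in u -> box k (r%:R : R) l) -> tot u <= r%:R -> wval u = 1%g ->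
  cheapk C n (X u) [::].
Proof.
have [C1 hC1] := box_mul r r; have [C2 hC2] := box_mul C1 r.
have [C3 hC3] := fill C2.
exists (2 * (r.+3 + r + C2 + C2) + C3 * (r.+1) ^ (k - 2).+1)%N => n u n0 su hu ht hv.
have hs : sizes u by move=> l /hu[].
have hsj j : sizes (take j u) by move=> l /mem_take /hs.
pose g j := wval (take j u); pose h j := (g j * av (- th (g j)))%g.
(* Every prefix has its exponent bounded by [tot u], hence the correction at each vertex is a single
   letter. *)
have hth j : `|th (g j)| <= r%:R.
  have [_ h1] := th_wval (@hsj j); apply: le_trans h1 _; apply: le_trans ht.
  by rewrite -{2}(cat_take_drop j u) tot_cat lerDl tot_ge0.
have hav j : box k r%:R (av (- th (g j))) by apply: box_av; rewrite normrN.
have hav' j : box k r%:R (av (th (g j))) by apply: box_av.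
have avV t : ((av t)^-1)%g = av (- t).
  by rewrite /av finvE oppr0 tr0 scaleNr.
have gE : pw g (size u) = u by apply: pw_word.
have hdg j : (j < size u)%N -> box k r%:R ((g j)^-1 * g j.+1)%g.
  by move=> lt; rewrite /g (take_nth 1%g lt) wval_rcons mulKg; apply/hu/mem_nth.
have hdh j : (j < size u)%N -> box k.-1 C2%:R ((h j)^-1 * h j.+1)%g.
  move=> lt; have hE : ((h j)^-1 * h j.+1 = av (th (g j)) * ((g j)^-1 * g j.+1) * av (- th (g j.+1)))%g.
    by rewrite /h invgM avV opprK !mulgA.
  have b1 := hC1 _ _ (hav' j) (hdg j lt); have b2 := hC2 _ _ b1 (hav j.+1).
  rewrite hE; have [e1 e2 e3] := b2; split=> //; apply: size_top => //.
  have [_ sl _] := hdg j lt; have [_ sa _] := hav j.+1; have [sg _] := th_wval (@hsj j.+1).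
  have [sg' _] := th_wval (@hsj j).
  by rewrite -/(th _) (thM _ sa) (thM _ sl) (thM _ sg) (thV sg') !th_av addNKr subrr.
have g0 : g 0%N = 1%g by rewrite /g take0 wval_nil.
have gm : g (size u) = 1%g by rewrite /g take_size.
have th1 : th 1%g = 0 by rewrite /th foneE /= coef0.
have av0 : av 0 = 1%g by rewrite /av scale0r.
have h0 : h 0%N = 1%g by rewrite /h g0 th1 oppr0 av0 mulg1.
have hm : h (size u) = 1%g by rewrite /h gm th1 oppr0 av0 mulg1.
have sp : (size (pw h (size u)) <= r.+1 * n)%N.
  by rewrite size_pw; apply: leq_trans su _; rewrite leq_mul2r leqnSn orbT.
have hp l : l \in pw h (size u) -> box k.-1 C2%:R l.
  by move=> /mapP[j]; rewrite mem_iota /= => lt ->; apply: hdh.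
apply: (@cheap_trans _ _ _ _ _ _ _ _ (X (pw h (size u)))); last first.
  have -> : (k - 2 = k.-1 - 1)%N by nlia.
  apply: cheap_scale => //; apply: hC3.
  - by rewrite muln_gt0.
  - by rewrite size_map.
  - move=> e /mapP[l hl ->]; split; first exact: hp.
    by apply: box1 => //; nlia.
  - by rewrite wval_map_lettX wval_pw h0 hm mulVg; exact: antidiag1.
rewrite -{1}gE -!pw_lettX.
apply: (@htpy_leN _ _ _ _ (size u).+2).
  apply: (@leq_trans (r.+2 * n)%N).
    by apply: (@leq_trans (r * n + 2 * n)%N); [nlia | rewrite -mulnDl addn2].
  by apply: leq_mul; [nlia|exact: n_le_expk2].
apply: (@htpy_sub _ _ (bdn (r.+3 + r + C2 + C2)) _ (r * n)%N) => [y||].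
- by apply: bdn_le; nlia.
- by rewrite leq_mul2r; apply/orP; right; nlia.
apply: row_change.
- move=> j lt; rewrite lettXV lettXM; apply: (@bdn_le _ _ _ (r + r)%N); first by nlia.
  by apply: bd_lettX; last exact: hdg.
- move=> j lt; rewrite lettXV lettXM; apply: (@bdn_le _ _ _ (C2 + C2)%N); first by nlia.
  by apply: bd_lettX (hdh _ lt) => //; nlia.
- move=> j le; rewrite lettXV lettXM /h mulKg; apply: (@bdn_le _ _ _ (r + r)%N); first by nlia.
  by apply: bd_lettX; last exact: hav.
- move=> j le; rewrite g0 lettXV lettXM invg1 mul1g -wval_map_lettX.
  have sj : (size (X (take j u)) <= r * n)%N.
    by rewrite size_map size_take_min; apply: leq_trans (geq_minr _ _) su.
  apply: (@ball_sub _ _ (bdn (r + r)) _ _ _ _ _ sj); first by move=> y; apply: bdn_le; nlia.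
  by apply: ball_word; apply: (wover_lettX kp q0) => l /mem_take /hu.
- by rewrite g0 h0.
- by rewrite gm hm.
Qed.

Lemma box_le_nat (r C : nat) l : (r <= C)%N -> box k (r%:R : R) l -> box k (C%:R : R) l.
Proof. by move=> le; apply: box_le => //; rewrite ler_nat. Qed.

Lemma few_tops2 (r : nat) : exists C : nat, forall n u v, (0 < n)%N ->
  (size u <= r * n)%N -> (size v <= r * n)%N ->
  (forall l, l \in u ++ v -> box k (r%:R : R) l) -> tot u <= r%:R -> tot v <= r%:R ->
  wval u = wval v -> cheapk C n (X u) (X v).
Proof.
have [Ci [rCi hi]] := @box_inv R k r; have [C hC] := few_tops (Ci + r).
eexists => n u v n0 su sv hb tu tv e.
have hu l : l \in u -> box k r%:R l by move=> h; apply: hb; rewrite mem_cat h.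
have hv l : l \in v -> box k r%:R l by move=> h; apply: hb; rewrite mem_cat h orbT.
have hvi l : l \in winv v -> box k Ci%:R l.
  by rewrite mem_rev => /mapP[m /hv h ->]; apply: hi.
have ou : wover (bdn (r + r)) (X u) by apply: wover_lettX hu.
have ov : wover (bdn (r + r)) (X v) by apply: wover_lettX hv.
have su' : (size (X u) <= (r + r) * n)%N.
  by rewrite size_map; apply: leq_trans su _; rewrite leq_mul2r leq_addl orbT.
have sv' : (size (X v) <= (r + r) * n)%N.
  by rewrite size_map; apply: leq_trans sv _; rewrite leq_mul2r leq_addl orbT.
apply: cheap_trans.
  rewrite -[X u]cats0; apply: cheap_catl ou su' _; apply: cheap_sym.
  exact: cheap_Vw ov sv' (n_le_expk2 n0).
rewrite catA; apply: (@cheap_catr _ _ _ _ _ _ (X v) _ [::]).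
rewrite winv_map_lettX -map_cat; apply: hC => //.
- rewrite size_cat size_winv mulnDl leq_add //.
  by apply: leq_trans su _; rewrite leq_mul2r rCi orbT.
- move=> l; rewrite mem_cat => /orP[/hu|/hvi]; apply: box_le_nat.
    exact: leq_addl.
  exact: leq_addr.
- rewrite tot_cat tot_winv; last by move=> l /hv[].
  rewrite natrD lerD //; apply: le_trans tu _; by rewrite ler_nat.
- by rewrite wval_cat wval_winv e mulgV.
Qed.

(** The power x^s is spelled with exactly [n] letters whatever [s] is; these are bounded as long as
    [s] is O(n), and the length of a block does not depend on [s]. *)
Definition xs (n : nat) s : seq L := nseq n ((s / n%:R, 0) : L).
Definition T (n : nat) s v : seq L := xs n s ++ v ++ xs n (- s).

Lemma winv_xs n s : winv (xs n s) = xs n (- s).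
Proof. by rewrite /xs winv_nseq finvE tr_0 oppr0 mulNr. Qed.

Lemma box_x (r : nat) s : `|s| <= r%:R -> box k (r%:R : R) (s, 0).
Proof.
by move=> h; split=> //=; rewrite ?size_poly0 // => i; rewrite coef0 normr0.
Qed.

Lemma box_xs (r n : nat) s l : `|s| <= r%:R * n%:R -> l \in xs n s -> box k (r%:R : R) l.
Proof.
move=> h; rewrite mem_nseq => /andP[n0 /eqP ->]; apply: box_x.
by rewrite normrM normfV normr_nat ler_pdivrMr // ltr0n.
Qed.

Lemma wval_xs n s : (0 < n)%N -> wval (xs n s) = (s, 0) :> L.
Proof.
by move=> n0; rewrite wval_nseq fexp; congr (_, _); rewrite -[LHS]mulr_natr divfK // pnatr_eq0 -lt0n.
Qed.

Lemma wval_T n s v f : (0 < n)%N -> wval v = (0, f) -> wval (T n s v) = (0, tr s f).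
Proof.
move=> n0 hv; rewrite /T !wval_cat hv !wval_xs // !fmulE !tr0 !add0r !addr0.
by rewrite subrr.
Qed.

Lemma size_xs n s : size (xs n s) = n. Proof. exact: size_nseq. Qed.
Lemma tot_xs n s : tot (xs n s) = 0. Proof. exact: tot_nseq0. Qed.
Lemma tot_T n s v : tot (T n s v) = tot v.
Proof. by rewrite /T !tot_cat !tot_xs addr0 add0r. Qed.
Lemma size_T n s v : size (T n s v) = (n + size v + n)%N.
Proof. by rewrite /T !size_cat !size_xs addnA. Qed.

(** In positive degree a polynomial of weight n^(k-2) has coefficients of order n^(k-3) at most, so
    n^(k-3) bounded letters reach them. *)
Lemma wb_scale (n : nat) B f : (0 < n)%N -> 0 <= B -> wb n%:R (B * n%:R ^+ (k - 2)) f ->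
  wb 1 B ((n ^ (k - 3))%:R^-1 *: f).
Proof.
move=> n0 B0 h i i0; have n0' : 0 < n%:R :> R by rewrite ltr0n.
have n1 : 1 <= n%:R :> R by rewrite ler1n.
rewrite expr1n mulr1 coefZ normrM normfV normr_nat mulrC ler_pdivrMr; last first.
  by rewrite ltr0n expn_gt0 n0.
rewrite -(ler_pM2r n0'); apply: (@le_trans _ _ (`|f`_i| * n%:R ^+ i)).
  by rewrite ler_wpM2l // -[Z in Z <= _]expr1 ler_weXn2l.
apply: le_trans (h i i0) _; have -> : (k - 2 = (k - 3).+1)%N by nlia.
by rewrite exprSr natrX mulrA.
Qed.

Section Sweep.
Variables (n : nat) (mu c : R).
Let N := (n ^ (k - 3))%N.
Definition swf (s : nat) : {poly R} := c *: tr (s%:R * mu) top.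
(** Row [s] runs in [N] equal steps to the conjugate of the top generator in the first factor,
    compensated in the second one. The compensation omits [c *: top]: its degree then drops by one,
    so that a second factor containing l_(k-1) is enough. *)
Definition swpt (s i : nat) : E :=
  (((0 : R), (i%:R / N%:R) *: swf s), ((0 : R), - ((i%:R / N%:R) *: (swf s - c *: top)))).
Definition swx : E := (((mu, 0) : L), ((mu, 0) : L)).
Definition swb : {poly R} := c *: (tr mu top - top).
Definition swc (i : nat) : E := (((mu, 0) : L), ((mu, (i%:R / N%:R) *: swb) : L)).

Lemma swfS (s : nat) : tr mu (swf s) = swf s.+1.
Proof. by rewrite /swf trZ tr_add -natr1 mulrDl mul1r addrC. Qed.

Lemma swpt_row (s i : nat) : ((swpt s i)^-1 * swpt s i.+1)%g =
  (((0 : R), N%:R^-1 *: swf s), ((0 : R), - (N%:R^-1 *: (swf s - c *: top)))).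
Proof.
rewrite pinvE pmulE !fdivE !subrr !oppr0 !tr0; congr ((_, _), (_, _)).
  by rewrite -scalerBl -mulrBl -natr1 addrC addKr mul1r.
by rewrite -opprD -scalerBl -mulrBl -natr1 addrC addKr mul1r.
Qed.

(** Pushing a diagonal x across row [s] gives the next row and an error in the second factor. The
    error comes from the omitted term [c *: top], which is not invariant under translation, and it
    does not depend on [s]. *)
Lemma swpt_col (s i : nat) : ((swpt s.+1 i)^-1 * (swx * swpt s i))%g = swc i.
Proof.
have -> : (swx * swpt s i)%g = (((mu, tr mu ((i%:R / N%:R) *: swf s)) : L),
    ((mu, tr mu (- ((i%:R / N%:R) *: (swf s - c *: top)))) : L)).
  by rewrite /swx /swpt pmulE !fmulE !addr0 !add0r.
rewrite /swpt pinvE pmulE !fdivE !oppr0 !tr0 !addr0; congr ((_, _), (_, _)).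
  by rewrite trZ swfS subrr.
rewrite trN trZ trB trZ swfS opprK addrC -scalerBr; congr (_ *: _).
by rewrite /swb scalerBr opprB addrC addrA subrK.
Qed.
End Sweep.

Lemma wb_top (n : nat) : (0 < n)%N -> wb n%:R (n%:R ^+ (k - 2)) top.
Proof.
move=> n0 i _; rewrite coefXn; case: eqP => [->|_]; first by rewrite normr1 mul1r.
by rewrite normr0 mul0r exprn_ge0.
Qed.

Lemma size_Xtop : (size top <= k)%N.
Proof. by rewrite size_polyXn; nlia. Qed.

Lemma size_swf mu c (s : nat) : (size (swf mu c s) < k)%N.
Proof.
apply: leq_ltn_trans (size_scale_leq _ _) _; rewrite size_tr size_polyXn; nlia.
Qed.

Lemma size_swb mu c : (size (swb mu c) < k.-1)%N.
Proof.
have st : (size top < k)%N by rewrite size_polyXn; nlia.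
apply: leq_ltn_trans (size_scale_leq _ _) _; apply: size_top.
  by apply: size_polyBlt => //; rewrite size_tr.
by rewrite coefB tr_top // subrr.
Qed.

Lemma sweep_bounds (r : nat) : exists C : nat, forall n mu c (s i : nat), (0 < n)%N ->
  `|mu| <= r%:R -> `|c| <= r%:R -> (s <= n)%N -> (i <= n ^ (k - 3))%N ->
  [/\ bdn C ((swpt n mu c s i)^-1 * swpt n mu c s i.+1)%g,
      bdn C (swc n mu c i), bdn C (swx mu), bdn C (swpt n mu c 0 i) &
      bdn C (lettY ((mu, swb mu c) : L))].
Proof.
pose K : R := trK k (r%:R : R); have K0 : 0 <= K by apply: trK_ge0.
have [C1 hC1] := nat_above (r%:R * K + r%:R).
have [C2 hC2] := nat_above (r%:R * ((1 + K) * 1 + 1)).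
exists (C1 + r + (r + C2 + (r + C2)))%N => n mu c s i n0 hmu hc sn iN.
have n0' : 0 < n%:R :> R by rewrite ltr0n.
have N0 : (0 < n ^ (k - 3))%N by rewrite expn_gt0 n0.
have st : (size top < k)%N by rewrite size_polyXn; nlia.
have hb : box k.-1 (r + C2)%:R ((mu, swb mu c) : L).
  split=> /=; [by apply: le_trans hmu _; rewrite ler_nat leq_addr|exact: size_swb|].
  have h1 : fb 1 1 top by move=> j; rewrite coefXn expr1n mulr1; case: eqP; rewrite ?normr1 ?normr0.
  have hm : `|mu| <= r%:R * 1 by rewrite mulr1.
  have h2 := tr_fb size_Xtop (ler0n _ r) ltr01 hm h1.
  move=> j; rewrite coefZ normrM coefB; apply: (@le_trans _ _ C2%:R); last by rewrite ler_nat leq_addl.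
  apply: le_trans hC2; apply: ler_pM => //; apply: le_trans (ler_normB _ _) _.
  apply: lerD; first by have := h2 j; rewrite expr1n !mulr1.
  by have := h1 j; rewrite expr1n mulr1.
have x0 : 0 <= (i%:R / (n ^ (k - 3))%:R : R) <= 1.
  by rewrite divr_ge0 //= ler_pdivrMr ?ltr0n // mul1r ler_nat.
have hsc : box k.-1 (r + C2)%:R ((mu, (i%:R / (n ^ (k - 3))%:R) *: swb mu c) : L).
  have [h1 h2 h3] := hb; split=> //=; first exact: leq_ltn_trans (size_scale_leq _ _) _.
  move=> j; rewrite coefZ normrM; apply: le_trans (h3 j).
  by case/andP: x0 => x0 x1; rewrite ger0_norm // ler_piMl.
have hx : box k (r + C2)%:R ((mu, 0) : L) by apply: box_x; apply: le_trans hmu _; rewrite ler_nat leq_addr.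
have hx' : box k.-1 (r + C2)%:R ((mu, 0) : L).
  have [h1 h2 h3] := hx; split=> //=; rewrite size_poly0; nlia.
have le1 : (r + C2 + (r + C2) <= C1 + r + (r + C2 + (r + C2)))%N by rewrite leq_addl.
split.
- rewrite swpt_row; apply: (@bdn_le _ _ _ C1); first by rewrite -addnA leq_addr.
  have hs : `|s%:R * mu| <= r%:R * n%:R.
    by rewrite normrM normr_nat mulrC ler_pM // ler_nat.
  have hw : wb n%:R (r%:R * K * n%:R ^+ (k - 2)) (swf mu c s).
    have h := tr_wb size_Xtop (ler0n _ r) n0' hs (wb_top n0).
    apply: wb_le (wbZ c (h _)); last by rewrite exprn_ge0.
    by rewrite -mulrA ler_wpM2r // mulr_ge0 // exprn_ge0.
  have hw' : wb n%:R ((r%:R * K + r%:R) * n%:R ^+ (k - 2)) (swf mu c s - c *: top).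
    rewrite mulrDl; apply: wbD => //; apply: wbN; apply: wb_le (wbZ c (wb_top n0)).
    by rewrite ler_wpM2r // exprn_ge0.
  have Kr : 0 <= r%:R * K by apply: mulr_ge0.
  left; split=> /=; first by rewrite normr0.
  + split; first exact: leq_trans (leq_ltn_trans (size_scale_leq _ _) (size_swf _ _ _)) kp.
    rewrite size_polyN; apply: leq_trans kq; apply: leq_ltn_trans (size_scale_leq _ _) _.
    apply: size_top; first by apply: size_polyBlt; [exact: size_swf|exact: leq_ltn_trans (size_scale_leq _ _) _].
    by rewrite coefB !coefZ tr_top // subrr.
  + split; last apply: wbN; apply: wb_le hC1 _.
      apply: (@wb_le _ _ (r%:R * K)); first by rewrite lerDl.
      exact: wb_scale.
    by apply: wb_scale => //; rewrite addr_ge0.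
  + have t0 : top`_0 = 0 by rewrite coefXn; move: k3; case: (k) => [|[|[|?]]].
    move: (swf mu c s) => F.
    by rewrite coefN -coefB -scalerBr subKr !coefZ t0 !mulr0 normr0.
- by apply: bdn_le le1 _; rewrite natrD; apply: bd_box hx hsc.
- by apply: bdn_le le1 _; rewrite natrD; apply: bd_box hx hx'.
- apply: (@bdn_le _ _ _ (r + r)%N); first by nlia.
  have -> : swpt n mu c 0 i = lettX (av (i%:R / (n ^ (k - 3))%:R * c)).
    rewrite /swpt /swf mul0r tr0 subrr scaler0 oppr0 /av scalerA //.
  apply: (bd_lettX kp q0); apply: box_av.
  by rewrite normrM; case/andP: x0 => x0 x1; rewrite (ger0_norm x0); apply: le_trans hc; rewrite ler_piMl.
- by apply: bdn_le le1 _; apply: bd_lettY hb.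
Qed.

(* Conjugating 'X^(k-2) by x^s produces coefficients of order n ^ (k - 2); they
   are produced along a diagonal path of length n ^ (k - 3) only, and the rest
   is a word in the other factor. *)
Lemma cross_split (r : nat) : exists C : nat, forall n s c, (0 < n)%N ->
  `|s| <= r%:R * n%:R -> `|c| <= r%:R -> exists row B : seq E,
  [/\ cheapk C n (X (T n s [:: av c])) (row ++ B),
      wover (bdn C) row /\ wover (bdn C) B,
      rad (antidiags R) (bdn C) (C * n) row,
      (size row <= n ^ (k - 3))%N /\ (size B <= C * n)%N &
      forall x t, x \in row ++ B -> (lettX (av t) * x = x * lettX (av t))%g].
Proof.
have [C0 hC0] := sweep_bounds r; set C1 := (C0 + (r + r) + 4)%N.
exists (200 * C1 * C1)%N => n s c n0 hs hc.
set N := (n ^ (k - 3))%N; pose mu := s / n%:R.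
have n0' : 0 < n%:R :> R by rewrite ltr0n.
have hmu : `|mu| <= r%:R by rewrite normrM normfV normr_nat ler_pdivrMr.
have N0 : (0 < N)%N by rewrite expn_gt0 n0.
have NV : N%:R / N%:R = 1 :> R by rewrite divff // pnatr_eq0 -lt0n.
have NV' : N%:R * N%:R^-1 = 1 :> R by [].
have nN : (n * N = n ^ (k - 2))%N by rewrite -expnS; congr (_ ^ _)%N; nlia.
have n2 : (n ^ 2 <= n ^ (k - 2))%N by apply: expk2.
have n1 : (n <= n ^ (k - 2))%N by apply: n_le_expk2.
have NM : (N <= n ^ (k - 2))%N by rewrite -nN leq_pmull.
have leC : (C0 <= C1)%N by rewrite /C1; nlia.
have C1le : (C1 <= C1 * C1)%N by rewrite leq_pmulr // /C1 addn4.
have Ccle : (C1 <= 200 * C1 * C1)%N by nlia.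
have bnd i := @hC0 n mu c 0 i n0 hmu hc (leq0n n).
pose Q := swpt n mu c; pose row i := pw (Q i) N; pose kap := swc n mu c N.
have kapE : kap = (((mu, 0) : L), ((mu, swb mu c) : L)) by rewrite /kap /swc NV scale1r.
pose xX := lettX ((mu, 0) : L); pose xX' := lettX ((- mu, 0) : L).
pose yY' := lettY ((- mu, 0) : L); pose yB := lettY ((mu, swb mu c) : L).
have [_ bk bx _ bB] := bnd N (leqnn N).
have Sx : bdn C1 (swx mu) by apply: bdn_le leC _.
have Sk : bdn C1 kap by apply: bdn_le leC _.
have SB : bdn C1 yB by apply: bdn_le leC _.
have le2 : (r + r <= C1)%N by rewrite /C1; nlia.
have SX : bdn C1 xX by apply: bdn_le le2 _; apply: bd_lettX; last exact: box_x.
have SX' : bdn C1 xX'.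
  by apply: bdn_le le2 _; apply: bd_lettX; last apply: box_x; rewrite ?normrN.
have SY' : bdn C1 yY'.
  apply: bdn_le le2 _; apply: (@bd_lettY _ _ _ k.-1) => //.
  split=> /=; rewrite ?normrN ?size_poly0 //; first by nlia.
  by move=> i; rewrite coef0 normr0.
have Sav t : `|t| <= r%:R -> bdn C1 (lettX (av t)).
  by move=> ht; apply: bdn_le le2 _; apply: (bd_lettX kp q0); apply: box_av.
have Q0 i : Q 0%N i = lettX (av (i%:R / N%:R * c)).
  by rewrite /Q /swpt /swf mul0r tr0 subrr scaler0 oppr0 /av scalerA.
have Qi0 i : Q i 0%N = 1%g.
  by rewrite /Q /swpt mul0r !scale0r oppr0.
have Srow i j : (i <= n)%N -> (j < N)%N -> bdn C1 ((Q i j)^-1 * Q i j.+1)%g.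
  by move=> li lj; have [h _ _ _ _] := @hC0 n mu c i j n0 hmu hc li (ltnW lj); apply: bdn_le leC _.
have Sc j : (j <= N)%N -> bdn C1 (swc n mu c j).
  by move=> lj; have [_ h _ _ _] := bnd j lj; apply: bdn_le leC _.
have Qcol i j : ((Q i.+1 j)^-1 * (swx mu * Q i j))%g = swc n mu c j by exact: swpt_col.
(* The rows are long, but [Q i j] is obtained from [Q 0 j] by [i] letters on the left and [i] on the
   right, hence stays at distance O(n). *)
have Qball i j : (i <= n)%N -> (j <= N)%N -> ball (antidiags R) (bdn C1) (2 * n + 1) (Q i j).
  move=> li lj; apply: (@ball_sub _ _ (bdn C1) _ (i + i + 1)) => //; first by nlia.
  elim: i {li} => [|i IH].
    apply: ball_letter; have [_ _ _ h _] := bnd j lj; exact: bdn_le leC _.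
  have -> : Q i.+1 j = (swx mu * Q i j * (swc n mu c j)^-1)%g.
    by rewrite -(Qcol i j) invgM invgK mulVKg.
  apply: (@ball_sub _ _ (bdn C1) _ (1 + (i + i + 1) + 1)) => //; first by nlia.
  apply: ballM; first by apply: ballM => //; exact: ball_letter.
  by apply: ball_letter; apply: bd_sym; apply: Sc.
have rrow i : (i <= n)%N -> rad (antidiags R) (bdn C1) (2 * n + 1) (row i).
  by move=> li; apply: rad_pw => j lj; rewrite Qi0 invg1 mul1g; apply: Qball.
have orow i : (i <= n)%N -> wover (bdn C1) (row i).
  by move=> li; apply: wover_pw => j lj; apply: Srow.
have srow i : size (row i) = N by apply: size_pw.
(* Each of the [n] diagonal letters sweeps one row across [N] squares, which gives area [n * N],
   that is, n^(k-2). *)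
have sweep i : (i <= n)%N -> htpy (antidiags R) (bdn C1) (2 * n + 1 + i) (i * N)
    (nseq i (swx mu) ++ row 0%N) (row i ++ nseq i kap).
  elim: i => [|i IH] li; first by rewrite cats0; apply: htpy_refl.
  apply: (@htpy_leN _ _ _ _ (i * N + N)); first by rewrite mulSn addnC.
  apply: (@htpy_trans _ _ _ _ _ _ _ (swx mu :: (row i ++ nseq i kap))).
    apply: (@htpy_sub _ _ (bdn C1) _ (1 + (2 * n + 1 + i))) => //; first by nlia.
    apply: (@htpy_catl _ _ _ _ _ _ [:: swx mu]); last exact: IH (ltnW li).
    by apply: rad_short => //; apply: wover1.
  have -> : row i.+1 ++ nseq i.+1 kap = (row i.+1 ++ [:: kap]) ++ nseq i kap by rewrite -catA.
  rewrite -cat_cons; apply: htpy_catr; apply: htpy_sym.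
  have lr : htpy (antidiags R) (bdn C1) (2 * n + 1) N (pw (Q i.+1) N ++ [:: ((Q i.+1 N)^-1 * (swx mu * Q i N))%g])
    (((Q i.+1 0%N)^-1 * (swx mu * Q i 0%N))%g :: pw (fun j => (swx mu * Q i j)%g) N).
    apply: ladder => [j lj|j lj|j lj|j lj].
    - exact: Srow.
    - by rewrite invgM -mulgA mulKg; apply: Srow => //; apply: ltnW.
    - by rewrite Qcol; apply: Sc.
    - by rewrite Qi0 invg1 mul1g; apply: Qball.
  move: lr; rewrite Qcol !Qi0 invg1 mul1g mulg1 pw_mull => lr.
  by apply: htpy_sub lr => //; nlia.
have hav : htpy (antidiags R) (bdn C1) 0 N.+1 (row 0%N) [:: lettX (av c)].
  have -> : row 0%N = nseq N (lettX (av (N%:R^-1 * c))).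
    apply: pw_const => j lj; rewrite !Q0 lettXV lettXM /av finvE oppr0 tr0 fmulE tr0 addr0.
    congr lettX; congr (_, _); rewrite -scaleNr -scalerDl; congr (_ *: _).
    by rewrite -natr1; ring.
  have -> : lettX (av c) = (lettX (av (N%:R^-1 * c)) ^+ N)%g.
    by rewrite lettX_avX mulrA NV' mul1r.
  apply: collapse => i iN; rewrite lettX_avX; apply: Sav; rewrite mulrA.
  rewrite normrM; apply: le_trans hc; rewrite ler_piMl // ger0_norm ?divr_ge0 //.
  by rewrite ler_pdivrMr ?ltr0n // mul1r ler_nat.
have C1_4 : (4 <= C1)%N by rewrite /C1 leq_addl.
have cc (d M : nat) (u v : seq E) : (d <= 4 * n)%N -> (M <= 4 * n ^ (k - 2))%N ->
    htpy (antidiags R) (bdn C1) d M u v -> cheapk C1 n u v.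
  move=> ld lM h; apply: (@htpy_leN _ _ _ _ M).
    by apply: leq_trans lM _; rewrite leq_mul2r C1_4 orbT.
  by apply: htpy_sub h => //; apply: leq_trans ld _; rewrite leq_mul2r C1_4 orbT.
have nn : (n * n <= 4 * n ^ (k - 2))%N by rewrite mulnn; apply: leq_trans n2 _; rewrite leq_pmull.
have sn x : (size (nseq n x : seq E) <= C1 * n)%N by rewrite size_nseq leq_pmull //; apply: leq_trans C1_4.
have on x : bdn C1 x -> wover (bdn C1) (nseq n x) by move=> h; apply: wover_nseq.
have rn : rad (antidiags R) (bdn C1) (C1 * n) (row n).
  by apply: rad_le (rrow n (leqnn n)); move: n0 C1_4; clear; nia.
have Xx : (xX * yY' = yY' * xX)%g by exact: lettXY.
(* A letter x of the first factor is traded for a diagonal one and an inverse in the second factor;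
   [e3] makes the converse exchange on the other side of the row. *)
have e1 : xX = (swx mu * yY')%g.
  by rewrite /xX /yY' /swx /lettX /lettY pmulE mulg1 fmulE tr_0 addr0 subrr.
have e2 : (swx mu * yY' = yY' * swx mu)%g.
  by rewrite /yY' /swx /lettY !pmulE mulg1 mul1g !fmulE !tr_0 !addr0 addrC.
have e3 : kap = (yB * xX)%g by rewrite kapE /yB /xX /lettX /lettY pmulE mulg1 mul1g.
exists (row n), (nseq n yB ++ nseq n yY').
have ra : rad (antidiags R) (bdn C1) (C1 * n) (row n ++ nseq n yB).
  apply: (@rad_le _ _ _ ((2 * n + 1) + n)); first by apply: (@leq_trans (4 * n)%N); [move: n0; clear; lia|rewrite leq_mul2r C1_4 orbT].
  apply: rad_cat'; first exact: rrow.
  by have := rad_word (antidiags R) (on _ SB); rewrite size_nseq.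
have catlr (C : nat) (u w w' : seq E) : (C1 <= C)%N -> rad (antidiags R) (bdn C1) (C1 * n) u ->
    cheapk C n w w' -> cheapk (C + C1) n (u ++ w) (u ++ w').
  move=> lC hu h; apply: (@htpy_leN _ _ _ _ (C * n ^ (k - 2))); first by rewrite leq_mul2r leq_addr orbT.
  rewrite mulnDl [(C * n + _)%N]addnC; apply: htpy_catl.
    by apply: rad_sub hu => [y|]; [apply: bdn_le; exact: leq_addl|].
  by apply: htpy_sub h => // y; apply: bdn_le; rewrite leq_addr.
have p1 : cheapk C1 n (nseq n xX) (nseq n (swx mu) ++ nseq n yY').
  apply: (@cc (2 * n)%N _ _ _ _ nn); first by rewrite leq_mul2r orbT.
  by apply: pow_split => //; rewrite -?e1 ?e2; [exact: eqA_refl|rewrite -e2 e1; exact: eqA_refl].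
have p2 : cheapk C1 n (nseq n kap) (nseq n yB ++ nseq n xX).
  apply: (@cc (2 * n)%N _ _ _ _ nn); first by rewrite leq_mul2r orbT.
  by apply: pow_split => //; rewrite -?e3; [exact: eqA_refl|rewrite e3 lettXY; exact: eqA_refl].
have p3 : cheapk C1 n [:: lettX (av c)] (row 0%N).
  apply: (@cc 0%N _ _ _ _ _ (htpy_sym hav)) => //.
  by move: NM n0 N0 n1; clear; move: (n ^ (k - 2))%N => M; lia.
have p4 : cheapk C1 n (nseq n (swx mu) ++ row 0%N) (row n ++ nseq n kap).
  apply: (@cc _ _ _ _ _ _ (sweep n (leqnn n))); first by move: n0; clear; lia.
  by rewrite nN leq_pmull.
have xX'E : nseq n xX' = winv (nseq n xX).
  by rewrite winv_nseq /xX lettXV finvE tr_0 oppr0.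
have p5 : cheapk (2 * C1 + C1 * C1) n (nseq n yY' ++ [:: lettX (av c)])
    ([:: lettX (av c)] ++ nseq n yY').
  apply: cheap_swap => //; [exact: on|by apply: wover1; apply: Sav| |].
    by rewrite /= muln_gt0 n0 andbT; apply: leq_trans C1_4.
  by move=> x y; rewrite mem_nseq inE => /andP[_ /eqP ->] /eqP ->; rewrite lettXY.
have p6 : cheapk (2 * C1 + C1 * C1) n (nseq n xX ++ nseq n yY')
    (nseq n yY' ++ nseq n xX).
  apply: cheap_swap => //; [exact: on|exact: on|].
  by move=> x y; rewrite !mem_nseq => /andP[_ /eqP ->] /andP[_ /eqP ->].
have p7 : cheapk C1 n (nseq n xX ++ nseq n xX') [::].
  by rewrite xX'E; apply: cheap_wV => //; exact: on.
split.
(* After the trade and the sweep, the word is [row n], then [kap] and [yY'] and the inverse of x,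
   each [n] times. Splitting [kap] into [yB] and x lets the powers of x cancel and leaves [row n]
   and a word in the second factor. *)
- rewrite /T !map_cat /xs !map_nseq -/mu mulNr -/mu -/xX -/xX' /=.
  have q1 : cheapk (4 * C1 + C1 * C1) n (nseq n xX ++ [:: lettX (av c)])
      (nseq n (swx mu) ++ [:: lettX (av c)] ++ nseq n yY').
    apply: cheap_le (cheap_trans (cheap_catr _ p1) _); last first.
    + by rewrite -catA; apply: (catlr) p5 => //; [apply: leq_trans (leq_addr _ _); rewrite leq_pmull|apply: rad_short => //; exact: on].
    + exact: leqnn.
    + by nlia.
  have q2 : cheapk (3 * C1) n (nseq n (swx mu) ++ [:: lettX (av c)]) (row n ++ nseq n kap).
    apply: cheap_le (cheap_trans _ p4); last first.
    + by apply: (catlr) p3 => //; apply: rad_short => //; exact: on.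
    + exact: leqnn.
    + by nlia.
  have q3 : cheapk (C1 + C1) n (row n ++ nseq n kap) (row n ++ nseq n yB ++ nseq n xX).
    exact: catlr.
  have q4 : cheapk (2 * C1 + C1 * C1 + C1) n
      ((row n ++ nseq n yB) ++ nseq n xX ++ nseq n yY') ((row n ++ nseq n yB) ++ nseq n yY' ++ nseq n xX).
    by apply: (catlr) => //; apply: leq_trans (leq_addr _ _); rewrite leq_pmull.
  have q5 : cheapk (C1 + C1 + C1) n
      ((row n ++ nseq n yB) ++ nseq n yY' ++ nseq n xX ++ nseq n xX') ((row n ++ nseq n yB) ++ nseq n yY' ++ [::]).
    apply: (catlr) => //; first exact: leq_addr.
    by apply: (catlr) => //; apply: rad_short => //; exact: on.
  have r1 := cheap_catr (nseq n xX') q1.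
  have r2 := cheap_catr (nseq n yY' ++ nseq n xX') (cheap_trans q2 q3).
  have r3 := cheap_catr (nseq n xX') q4.
  rewrite -!catA /= in r1 r2 r3 q5.
  have := cheap_trans r1 (cheap_trans r2 (cheap_trans r3 q5)); rewrite cats0.
  by apply: cheap_le => //; move: C1_4; clear; move: C1 => c1; nia.
- have sub : forall y, bdn C1 y -> bdn (200 * C1 * C1) y by move=> y; apply: bdn_le.
  split; first exact: wover_sub (orow n (leqnn n)).
  by apply: wover_cat; apply: wover_sub sub _; exact: on.
- by apply: rad_sub rn => [y|]; [apply: bdn_le|rewrite leq_mul2r Ccle orbT].
- rewrite srow size_cat !size_nseq; split=> //.
  have : (2 <= 200 * C1 * C1)%N by apply: leq_trans Ccle; apply: leq_trans C1_4.
  by rewrite addnn -mul2n leq_mul2r => ->; rewrite orbT.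
- move=> x t; rewrite !mem_cat !mem_nseq => /or3P[|/andP[_ /eqP ->]|/andP[_ /eqP ->]]; last 2 first.
  + by rewrite lettXY.
  + by rewrite lettXY.
  (* The letters of the row have x-exponent 0 in the first factor, where polynomials commute. *)
  move=> /mapP[j _ ->]; rewrite swpt_row /lettX /av !pmulE mulg1 mul1g !fmulE !tr0 !addr0.
  by rewrite [Z in ((_, Z), _)]addrC.
Qed.

Lemma xcat C n u w w' v (D : nat) : (forall l, l \in u -> box k (D%:R : R) l) -> (size u <= D * n)%N ->
  cheapk C n (X w) (X w') ->
  cheap p q (C + (D + D)) n (n ^ (k - 2)) (X (u ++ w ++ v)) (X (u ++ w' ++ v)).
Proof.
move=> hu su h; rewrite !map_cat; apply: cheap_cong => //; first exact: wover_lettX hu.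
by rewrite size_map; apply: leq_trans su _; rewrite leq_mul2r leq_addl orbT.
Qed.

Lemma boxs_T (r n : nat) s v : `|s| <= r%:R * n%:R -> (forall l, l \in v -> box k (r%:R : R) l) ->
  forall l, l \in T n s v -> box k (r%:R : R) l.
Proof.
move=> hs hv l; rewrite !mem_cat => /or3P[|/hv //|]; apply: box_xs => //.
by rewrite normrN.
Qed.

Lemma boxs_av (r m : nat) t l : `|t| <= r%:R -> l \in nseq m (av t) -> box k (r%:R : R) l.
Proof. by move=> h; rewrite mem_nseq => /andP[_ /eqP ->]; apply: box_av. Qed.

(** By [cross_split] the conjugate becomes a row of length n^(k-3) and O(n) further letters, all of
    which commute with powers of the top generator. Passing O(n) such powers across them costs
    O(n^(k-2)), as [3 < k]. *)
Lemma cross (r : nat) : exists C : nat, forall n s c t (m : nat), (0 < n)%N ->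
  `|s| <= r%:R * n%:R -> `|c| <= r%:R -> `|t| <= r%:R -> (m <= r * n)%N ->
  cheapk C n (X (nseq m (av t) ++ T n s [:: av c])) (X (T n s [:: av c] ++ nseq m (av t))).
Proof.
have [C hC] := cross_split r.
exists (C + (r + r) + ((r + r) + C + C + r + r * C) + C)%N => n s c t m n0 hs hc ht hm.
have [row [B [h1 [wr wB] rr [s1 s2] hcm]]] := hC n s c n0 hs hc.
have bA : forall l, l \in nseq m (av t) -> box k (r%:R : R) l by move=> l; apply: boxs_av.
apply: cheap_trans; first (apply: cheap_trans).
- rewrite map_cat; apply: (cheap_catl (D := (r + r)%N)) h1; first exact: wover_lettX bA.
  by rewrite size_map size_nseq; apply: leq_trans hm _; rewrite leq_mul2r leq_addl orbT.
- have oA : wover (bdn (r + r)) (X (nseq m (av t))) by exact: wover_lettX bA.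
  have H : htpy (antidiags R) (bdn (r + r + C)) (r * n + (C * n + C * n)) (m * size (row ++ B))
      (X (nseq m (av t)) ++ (row ++ B)) ((row ++ B) ++ X (nseq m (av t))).
    have := @swap _ (antidiags R) (bdn (r + r + C)) (r * n) (C * n + C * n) (X (nseq m (av t))) (row ++ B).
    rewrite size_map size_nseq; apply.
    + by apply: wover_sub oA => y; apply: bdn_le; apply: leq_addr.
    + by apply: wover_cat; [apply: wover_sub wr|apply: wover_sub wB] => y; apply: bdn_le; apply: leq_addl.
    + apply: rad_short; last by rewrite size_map size_nseq.
      by apply: wover_sub oA => y; apply: bdn_le; apply: leq_addr.
    + apply: (@rad_sub _ _ (bdn C) _ (C * n + C * n)) => //; first by move=> y; apply: bdn_le; apply: leq_addl.
      by apply: rad_cat' => //; apply: rad_short.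
    + move=> x y; rewrite map_nseq mem_nseq => /andP[_ /eqP ->] hy; rewrite hcm //; exact: eqA_refl.
  apply: (@htpy_leN _ _ _ _ (m * size (row ++ B))); last first.
    apply: htpy_sub H => [y|]; first by apply: bdn_le; nlia.
    by nlia.
  have nN : (n * n ^ (k - 3) = n ^ (k - 2))%N by rewrite -expnS; congr (_ ^ _)%N; nlia.
  have n2 : (n * n <= n ^ (k - 2))%N by rewrite mulnn; apply: expk2.
  apply: (@leq_trans ((r + r * C) * n ^ (k - 2))%N); last by rewrite leq_mul2r; apply/orP; right; nlia.
  apply: (leq_trans (leq_mul hm (leqnn _))); rewrite size_cat mulnDr mulnDl; apply: leq_add.
    by rewrite -nN mulnA leq_mul.
  apply: (leq_trans (leq_mul (leqnn _) s2)); rewrite mulnACA leq_mul //.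
- by rewrite map_cat; apply: cheap_catr; apply: cheap_sym.
Qed.

(** Each side contains a single power of the top generator, with a bounded exponent, so [few_tops2]
    applies. *)
Lemma T_split (r : nat) : exists C : nat, forall n s s' c, (0 < n)%N ->
  `|s| <= r%:R * n%:R -> `|s'| <= r%:R * n%:R -> `|c| <= r%:R ->
  cheapk C n (X (T n (s + s') [:: av c])) (X (xs n s ++ T n s' [:: av c] ++ xs n (- s))).
Proof.
have [C hC] := few_tops2 (r + r + 5); exists C => n s s' c n0 hs hs' hc.
have hss : `|s + s'| <= (r + r)%:R * n%:R.
  by apply: le_trans (ler_normD _ _) _; rewrite natrD mulrDl lerD.
have tc : tot [:: av c] <= (r + r + 5)%:R.
  by rewrite /tot big_seq1 th_av; apply: le_trans hc _; rewrite ler_nat -addnA leq_addr.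
have hn : (1 <= n)%N by [].
have cb l : l \in [:: av c] -> box k (r%:R : R) l by rewrite inE => /eqP ->; apply: box_av.
apply: hC => //.
- by rewrite size_T /=; nlia.
- by rewrite /T !size_cat !size_xs /=; nlia.
- move=> l; rewrite mem_cat => /orP[h|].
    apply: (@box_le_nat (r + r)%N); first by rewrite leq_addr.
    apply: boxs_T hss _ _ h => l' /cb; apply: box_le_nat; exact: leq_addr.
  rewrite mem_cat => /orP[h|]; last rewrite mem_cat => /orP[h|h]; apply: (@box_le_nat r); do ?[by rewrite -addnA leq_addr].
  + exact: box_xs h.
  + by apply: boxs_T h; rewrite ?normrN.
  + by apply: box_xs h; rewrite normrN.
- by rewrite tot_T.
- by rewrite (tot_cat (xs n s)) (tot_cat (T n s' _)) !tot_xs tot_T addr0 add0r.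
- rewrite (wval_cat (xs n s)) (wval_cat (T n s' _)) !wval_xs // !(@wval_T n _ _ (c *: top)) // ?wval1 //.
  by rewrite !fmulE !tr0 !add0r !addr0 tr_add subrr.
Qed.

Lemma xs_cancel (r : nat) : exists C : nat, forall n s, (0 < n)%N -> `|s| <= r%:R * n%:R ->
  cheapk C n (X (xs n (- s) ++ xs n s)) (X [::]).
Proof.
exists ((r + r).+1)%N => n s n0 hs; rewrite -winv_xs map_cat -winv_map_lettX.
apply: cheap_Vw; last exact: n_le_expk2.
  by apply: (@wover_sub _ (bdn (r + r))); [move=> y; apply: bdn_le|apply: (wover_lettX kp q0) => l; apply: box_xs].
by rewrite size_map size_xs leq_pmull.
Qed.

(** The second block is rewritten as a conjugate by x^s of the block at [s' - s]. The common
    conjugation then cancels between the blocks and [cross] concludes. *)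
Lemma T_comm (r : nat) : exists C : nat, forall n s s' c t, (0 < n)%N ->
  `|s| <= r%:R * n%:R -> `|s'| <= r%:R * n%:R -> `|c| <= r%:R -> `|t| <= r%:R * n%:R ->
  cheapk C n (X (T n s (nseq n (av (t / n%:R))) ++ T n s' [:: av c]))
     (X (T n s' [:: av c] ++ T n s (nseq n (av (t / n%:R))))).
Proof.
have [C1 h1] := T_split (r + r); have [C2 h2] := xs_cancel r; have [C3 h3] := cross ((r + r).+1).
eexists => n s s' c t n0 hs hs' hc ht; set v := nseq n _.
have n0' : 0 < n%:R :> R by rewrite ltr0n.
have ht' : `|t / n%:R| <= r%:R by rewrite normrM normfV normr_nat ler_pdivrMr.
have hr (x : R) : `|x| <= r%:R * n%:R -> `|x| <= (r + r)%:R * n%:R.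
  by move=> h; apply: le_trans h _; rewrite ler_wpM2r // ler_nat leq_addr.
have hr1 (x : R) : `|x| <= r%:R -> `|x| <= (r + r)%:R.
  by move=> h; apply: le_trans h _; rewrite ler_nat leq_addr.
have hr2 (x : R) : `|x| <= (r + r)%:R -> `|x| <= (r + r).+1%:R.
  by move=> h; apply: le_trans h _; rewrite ler_nat.
have hd : `|s' - s| <= (r + r)%:R * n%:R.
  by apply: le_trans (ler_normB _ _) _; rewrite natrD mulrDl lerD.
have hd2 : `|s' - s| <= (r + r).+1%:R * n%:R.
  by apply: le_trans hd _; rewrite ler_wpM2r // ler_nat.
have hT := h1 n s (s' - s) c n0 (hr _ hs) hd (hr1 _ hc).
rewrite subrKC in hT.
have bv l : l \in v -> box k (r%:R : R) l by apply: boxs_av.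
have bx l : l \in xs n s -> box k (r%:R : R) l by apply: box_xs.
have bT := boxs_T hs bv.
have sT m (D : nat) : (m = 3 * n)%N -> (3 <= D)%N -> (m <= D * n)%N.
  by move=> ->; rewrite leq_mul2r => ->; rewrite orbT.
have bD D w : (r <= D)%N -> (forall l, l \in w -> box k (r%:R : R) l) -> forall l, l \in w -> box k (D%:R : R) l.
  by move=> le h l /h; apply: box_le_nat.
pose Z := T n (s' - s) [:: av c].
apply: cheap_trans.
  have := @xcat _ n (T n s v) _ _ [::] (r + 3)%N _ _ hT; rewrite !cats0; apply.
    exact: bD (leq_addr _ _) bT.
  by rewrite size_T size_nseq; apply: sT; [nlia|exact: leq_addl].
apply: cheap_trans.
  have := @xcat _ n (xs n s ++ v) _ _ (Z ++ xs n (- s)) (r + 3)%N _ _ (h2 n s n0 hs).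
  rewrite /T -!catA; apply.
    by apply: bD (leq_addr _ _) _ => l; rewrite mem_cat => /orP[/bx|/bv].
  by rewrite size_cat !size_nseq; nlia.
rewrite -catA /=.
apply: cheap_trans.
  have := @xcat _ n (xs n s) _ _ (xs n (- s)) (r + 1)%N _ _ (h3 n (s' - s) c (t / n%:R) n n0 hd2 (hr2 _ (hr1 _ hc)) (hr2 _ (hr1 _ ht')) _).
  rewrite -/v -!catA; apply.
  - exact: bD (leq_addr _ _) bx.
  - by rewrite size_xs addn1 leq_pmull.
  - by rewrite leq_pmull.
apply: cheap_trans.
  have hZ l : l \in Z -> box k ((r + r)%:R : R) l.
    by move=> h; apply: boxs_T hd _ _ h => l'; rewrite inE => /eqP ->; apply/box_av/hr1.
  have := @xcat _ n (xs n s ++ Z) _ _ (v ++ xs n (- s)) (r + r + 4)%N _ _ (cheap_sym (h2 n s n0 hs)).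
  rewrite /Z -!catA; apply.
  - move=> l; rewrite mem_cat => /orP[/bx|/hZ]; apply: box_le_nat; last exact: leq_addr.
    by rewrite -addnA leq_addr.
  - by rewrite ?/Z /T !size_cat !size_xs /=; nlia.
rewrite /= -/Z.
have := cheap_catr (X (T n s v)) (cheap_sym hT); rewrite -map_cat /Z -!map_cat /T -!catA; apply.
Qed.

(** In [NF] the exponents may have order n and are spread over [n] letters; in [ADD] they are
    bounded and take one letter each, so that [tot] of such a word stays bounded. *)
Definition NF n (js : seq nat) (t : nat -> R) : seq L :=
  flatten [seq T n (j%:R * n%:R) (nseq n (av (t j / n%:R))) | j <- js].
Definition ADD n (js : seq nat) (t : nat -> R) : seq L :=
  flatten [seq T n (j%:R * n%:R) [:: av (t j)] | j <- js].

Lemma size_NF n js (t : nat -> R) : size (NF n js t) = (size js * (3 * n))%N.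
Proof. by elim: js => //= j js IH; rewrite size_cat size_T size_nseq -/(NF n js t) IH; lia. Qed.
Lemma size_ADD n js (t : nat -> R) : size (ADD n js t) = (size js * (2 * n).+1)%N.
Proof. by elim: js => //= j js IH; rewrite size_cat size_T -/(ADD n js t) IH /=; lia. Qed.

Lemma node_le (r n j : nat) : (j <= r)%N -> `|j%:R * n%:R : R| <= r%:R * n%:R.
Proof. by move=> h; rewrite -natrM normr_nat -natrM ler_nat leq_mul2r h orbT. Qed.

Lemma div_le (r n : nat) t : (0 < n)%N -> `|t| <= r%:R * n%:R -> `|t / n%:R| <= r%:R.
Proof. by move=> n0 h; rewrite normrM normfV normr_nat ler_pdivrMr // ltr0n. Qed.

Lemma boxs_NF (r n : nat) js (t : nat -> R) : (0 < n)%N -> all (fun j => j <= r)%N js ->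
  (forall j, `|t j| <= r%:R * n%:R) -> forall l, l \in NF n js t -> box k (r%:R : R) l.
Proof.
move=> n0 + ht; elim: js => //= j js IH /andP[hj hjs] l; rewrite mem_cat => /orP[|/IH]; last exact.
by apply: boxs_T; [exact: node_le|move=> l'; apply/boxs_av/div_le].
Qed.

Lemma boxs_ADD (r n : nat) js (t : nat -> R) : all (fun j => j <= r)%N js ->
  (forall j, `|t j| <= r%:R) -> forall l, l \in ADD n js t -> box k (r%:R : R) l.
Proof.
move=> + ht; elim: js => //= j js IH /andP[hj hjs] l; rewrite mem_cat => /orP[|/IH]; last exact.
by apply: boxs_T; [exact: node_le|move=> l'; rewrite inE => /eqP ->; apply: box_av].
Qed.

Lemma NF_comm (r : nat) js : all (fun j => j <= r)%N js -> exists C : nat, forall n (j : nat) (t : nat -> R) c, (0 < n)%N ->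
  (j <= r)%N -> (forall i, `|t i| <= r%:R * n%:R) -> `|c| <= r%:R ->
  cheapk C n (X (NF n js t ++ T n (j%:R * n%:R) [:: av c]))
    (X (T n (j%:R * n%:R) [:: av c] ++ NF n js t)).
Proof.
have [C1 h1] := T_comm r.
elim: js => [_|i js IH /andP[hi hjs]].
  by exists 0%N => n j t c *; rewrite cats0; apply: htpy_refl.
have [C2 h2] := IH hjs; eexists => n j t c n0 hj ht hc.
rewrite /NF /= -/(NF n js t) -catA.
apply: cheap_trans.
  have := @xcat _ n (T n (i%:R * n%:R) (nseq n (av (t i / n%:R)))) _ _ [::] (r + 3)%N _ _ (h2 n j t c n0 hj ht hc).
  rewrite !cats0; apply.
    move=> l; move/(boxs_T (node_le _ hi)) => H; apply: (@box_le_nat r); first exact: leq_addr.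
    by apply: H => l'; apply/boxs_av/div_le.
  by rewrite size_T size_nseq; nlia.
have := cheap_catr (X (NF n js t)) (h1 n _ _ c (t i) n0 (node_le n hi) (node_le n hj) hc (ht i)).
by rewrite -!map_cat -!catA; apply.
Qed.

(** The conjugating powers cancel, and the additional letter is spread evenly over the [n] letters
    of the block, at quadratic cost. *)
Lemma av_merge (r : nat) : exists C : nat, forall n s t c, (0 < n)%N ->
  `|s| <= r%:R * n%:R -> `|c| <= r%:R -> `|t| <= r%:R * n%:R ->
  cheapk C n (X (T n s (nseq n (av (t / n%:R))) ++ T n s [:: av c]))
     (X (T n s (nseq n (av ((t + c) / n%:R))))).
Proof.
have [C2 h2] := xs_cancel r.
eexists => n s t c n0 hs hc ht; set v := nseq n (av (t / n%:R)).
have n0' : 0 < n%:R :> R by rewrite ltr0n.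
have ht' := div_le n0 ht.
have c' : `|c| <= r%:R * n%:R by apply: le_trans hc _; rewrite ler_peMr // ler1n.
have hc' := div_le n0 c'.
have bx l : l \in xs n s -> box k (r%:R : R) l by apply: box_xs.
have bv l : l \in v -> box k (r%:R : R) l by apply: boxs_av.
have Sav (u : R) : `|u| <= (r + r)%:R -> bdn (r + r + (r + r)) (lettX (av u)).
  by move=> hu; apply: (bd_lettX kp q0); apply: box_av.
have hr (u : R) : `|u| <= r%:R -> `|u| <= (r + r)%:R.
  by move=> h; apply: le_trans h _; rewrite ler_nat leq_addr.
have tc : (t + c) / n%:R = t / n%:R + c / n%:R by rewrite mulrDl.
have n2 : (n ^ 2 <= n ^ (k - 2))%N by apply: expk2.
have n1 : (n <= n ^ (k - 2))%N by apply: n_le_expk2.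
apply: cheap_trans.
  have := @xcat _ n (xs n s ++ v) _ _ ([:: av c] ++ xs n (- s)) (r + 3)%N _ _ (h2 n s n0 hs).
  rewrite /T -!catA; apply.
    by move=> l; rewrite mem_cat => /orP[/bx|/bv]; apply: box_le_nat; exact: leq_addr.
  by rewrite size_cat !size_nseq; nlia.
rewrite cat0s (catA v).
apply: (@xcat _ n (xs n s) _ _ (xs n (- s)) (r + 1)%N).
- by move=> l /bx; apply: box_le_nat; exact: leq_addr.
- by rewrite size_xs addn1 leq_pmull.
apply: cheap_sym; rewrite map_cat !map_nseq tc.
have -> : X [:: av c] = [:: (lettX (av (c / n%:R)) ^+ n)%g].
  by rewrite lettX_avX mulrC divfK // gt_eqF.
apply: (@cheap_trans _ _ _ _ _ _ _ _ (nseq n (lettX (av (t / n%:R))) ++ nseq n (lettX (av (c / n%:R))))).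
  apply: (@htpy_leN _ _ _ _ (n * n)); last first.
    apply: htpy_sub (pow_split n (Sav (t / n%:R) _) (Sav (c / n%:R) _) (Sav (t / n%:R + c / n%:R) _) _ _).
    - by move=> y; apply: bdn_le; exact: (leq_addr 2).
    - by rewrite leq_mul2r leq_addl orbT.
    - exact: hr.
    - exact: hr.
    - by apply: le_trans (ler_normD _ _) _; rewrite natrD lerD.
    - by rewrite lettX_avD; exact: eqA_refl.
    - by rewrite !lettX_avD addrC; exact: eqA_refl.
  by rewrite mulnn; apply: leq_trans n2 _; rewrite leq_pmull // addnS.
apply: (cheap_catl (D := (r + r + (r + r)).+1)).
- by apply: wover_nseq; apply: bdn_le (Sav _ (hr _ ht')).
- by rewrite size_nseq leq_pmull.
apply: (@htpy_leN _ _ _ _ n.+1); last first.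
  apply: htpy_sub (collapse (antidiags R) (S := bdn (r + r + (r + r))) (n := n) _) => //.
    by move=> y; apply: bdn_le; exact: (leq_addr 2).
  move=> i hi; rewrite lettX_avX; apply/Sav/hr; rewrite mulrCA; apply: le_trans hc.
  rewrite normrM ler_piMr // ger0_norm ?divr_ge0 // ler_pdivrMr // mul1r ler_nat //.
by move: n1 n0; clear; move: (n ^ (k - 2))%N => M; rewrite addn2; nia.
Qed.

Lemma absorb (r : nat) js : all (fun j => j <= r)%N js -> exists C : nat, forall n (t c : nat -> R), (0 < n)%N ->
  (forall i, `|t i| <= r%:R * n%:R) -> (forall i, `|c i| <= r%:R) ->
  cheapk C n (X (NF n js t ++ ADD n js c)) (X (NF n js (fun i => t i + c i))).
Proof.
have [C1 h1] := av_merge r.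
elim: js => [_|i js IH /andP[hi hjs]].
  by exists 0%N => n t c *; apply: htpy_refl.
have [C2 h2] := IH hjs; have [C3 h3] := NF_comm hjs.
eexists => n t c n0 ht hc.
have bT : forall l, l \in T n (i%:R * n%:R) (nseq n (av (t i / n%:R))) -> box k (r%:R : R) l.
  by apply: boxs_T; [exact: node_le|move=> l'; apply/boxs_av/div_le].
have bA : forall l, l \in T n (i%:R * n%:R) [:: av (c i)] -> box k (r%:R : R) l.
  by apply: boxs_T; [exact: node_le|move=> l'; rewrite inE => /eqP ->; apply: box_av].
have le D : (r <= r + D)%N by exact: leq_addr.
rewrite /NF /ADD /= -/(NF n js t) -/(ADD n js c) -/(NF n js (fun i => t i + c i)) -catA.
apply: cheap_trans.
  rewrite [NF n js t ++ _]catA.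
  apply: (@xcat _ n _ _ _ _ (r + 3)%N _ _ (h3 n i t (c i) n0 hi ht (hc i))).
    by move=> l /bT; apply: box_le_nat.
  by rewrite size_T size_nseq; nlia.
rewrite -(catA (T n _ [:: _])) catA.
apply: cheap_trans.
  have := @xcat _ n (T n (i%:R * n%:R) (nseq n (av (t i / n%:R))) ++ T n (i%:R * n%:R) [:: av (c i)]) _ _ [::] (r + 6)%N _ _ (h2 n t c n0 ht hc).
  rewrite !cats0; apply.
    by move=> l; rewrite mem_cat => /orP[/bT|/bA]; apply: box_le_nat.
  by rewrite /T !size_cat !size_xs size_nseq /=; nlia.
have := cheap_catr (X (NF n js (fun i => t i + c i))) (h1 n _ (t i) (c i) n0 (node_le n hi) (hc i) (ht i)).
by rewrite -!map_cat -!catA; apply.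
Qed.

Let m := k.-1.
Let nodes : 'rV[R]_m := \row_j j%:R.
Let W : 'M[R]_m := invmx (Vandermonde m nodes).

Let VW : Vandermonde m nodes *m W = 1%:M.
Proof.
apply: mulmxV; rewrite unitmxE det_Vandermonde unitfE prodf_seq_neq0.
apply/allP => i _; apply/implyP => _; rewrite prodf_seq_neq0; apply/allP => j _; apply/implyP => ij.
by rewrite !mxE subr_eq0 eqr_nat gt_eqF.
Qed.

(* The polynomials tr (j * n) 'X^(k-2), for j < k - 1, form a basis of the
   polynomials of degree at most k - 2; the coordinates are obtained by
   inverting a Vandermonde matrix. *)
Definition cf (n : nat) f (j : nat) : R :=
  if insub j is Some j' then \sum_(e < m) W j' e * (f`_(k - 2 - e) / ('C(k - 2, e)%:R * n%:R ^+ e)) else 0.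

Lemma cfD n f f' j : cf n (f + f') j = cf n f j + cf n f' j.
Proof.
rewrite /cf; case: insubP => [j' _ _|_]; last by rewrite addr0.
by rewrite -big_split; apply: eq_bigr => e _; rewrite coefD mulrDl mulrDr.
Qed.

Lemma cf0 n j : cf n 0 j = 0.
Proof. by apply: (@addrI _ (cf n 0 j)); rewrite -cfD !addr0. Qed.

Lemma cf_sum n f : (0 < n)%N -> (size f < k)%N ->
  \sum_(j <- iota 0 m) cf n f j *: tr (j%:R * n%:R) top = f.
Proof.
move=> n0 sf; have n0' : n%:R != 0 :> R by rewrite pnatr_eq0 -lt0n.
have -> : iota 0 m = index_iota 0 m by rewrite /index_iota subn0.
rewrite big_mkord; apply/polyP => i; rewrite coef_sum.
have [le|lt] := leqP i (k - 2); last first.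
  rewrite nth_default; last by apply: leq_trans lt; rewrite -ltnS; apply: leq_trans sf _; nlia.
  rewrite big1 // => j _; rewrite coefZ trXn coef_XaddCn bin_small //.
  by rewrite mulr0n mulr0.
have e0P : (k - 2 - i < m)%N by rewrite /m; nlia.
(* The coefficient of degree [i] of the translate by [j * n] is a binomial coefficient times (j
   n)^(k-2-i); hence [e0] indexes the moment of the coordinates that degree [i] sees. *)
pose e0 := Ordinal e0P; pose y e := f`_(k - 2 - e) / ('C(k - 2, e)%:R * n%:R ^+ e).
have cfE (j : 'I_m) : cf n f j = \sum_(e < m) W j e * y e.
  by rewrite /cf insubT //= => lj; apply: eq_bigr => e _; congr (W _ _ * _); apply: val_inj.
have hVW (e : 'I_m) : \sum_(j < m) (j%:R : R) ^+ e0 * W j e = (e0 == e)%:R.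
  have := congr1 (fun M : 'M[R]_m => M e0 e) VW; rewrite [LHS]mxE [RHS]mxE => <-.
  by apply: eq_bigr => j _; rewrite !mxE.
have hy : \sum_(j < m) (j%:R : R) ^+ e0 * cf n f j = y e0.
  under eq_bigr do rewrite cfE mulr_sumr.
  rewrite exchange_big (bigD1 e0) //= [Z in _ + Z]big1 => [|e ne].
    under eq_bigr do rewrite mulrA.
    by rewrite -mulr_suml hVW eqxx mul1r addr0.
  under eq_bigr do rewrite mulrA.
  by rewrite -mulr_suml hVW eq_sym (negbTE ne) mul0r.
have -> : \sum_(j < m) (cf n f j *: tr (j%:R * n%:R) top)`_i =
    n%:R ^+ e0 * 'C(k - 2, i)%:R * \sum_(j < m) (j%:R : R) ^+ e0 * cf n f j.
  rewrite mulr_sumr; apply: eq_bigr => j _.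
  by rewrite coefZ trXn coef_XaddCn exprMn -mulr_natr /=; ring.
rewrite hy /y /= subKn // bin_sub //.
have b0 : 'C(k - 2, i)%:R != 0 :> R by rewrite pnatr_eq0 -lt0n bin_gt0.
by rewrite mulrC [n%:R ^+ _ * _]mulrC divfK // mulf_neq0 // expf_neq0.
Qed.

(** The nodes are multiples of [n], so the inverse matrix [W] does not depend on [n]; the remaining
    division by [n ^+ e] is exactly what the weights of [fb] pay for. *)
Lemma cf_bound : exists K : nat, forall (n : nat) B f j, (0 < n)%N ->
  fb n%:R (B * n%:R ^+ (k - 2)) f -> `|cf n f j| <= K%:R * B.
Proof.
have [K hK] := nat_above (\sum_(j < m) \sum_(e < m) `|W j e|).
exists K => n B f j n0 hf; have n0' : 0 < n%:R :> R by rewrite ltr0n.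
have B0 : 0 <= B.
  by have := fb_ge0 hf (ltW n0'); rewrite pmulr_lge0 // exprn_gt0.
apply: (@le_trans _ _ ((\sum_(j < m) \sum_(e < m) `|W j e|) * B)); last by rewrite ler_wpM2r.
rewrite /cf; case: insubP => [j' _ _|_]; last first.
  by rewrite normr0 mulr_ge0 // sumr_ge0 // => i _; apply: sumr_ge0.
rewrite [Z in _ <= Z * B](bigD1 j') //= mulrDl ler_wpDr //.
  by rewrite mulr_ge0 // sumr_ge0 // => i _; apply: sumr_ge0.
rewrite mulr_suml; apply: le_trans (ler_norm_sum _ _ _) _; apply: ler_sum => e _.
rewrite normrM ler_wpM2l //; have le : (e <= k - 2)%N by have := ltn_ord e; rewrite /m; nlia.
have b0 : 0 < 'C(k - 2, e)%:R :> R by rewrite ltr0n bin_gt0.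
rewrite normrM normfV [Z in _ / Z]ger0_norm; last by rewrite mulr_ge0 // exprn_ge0 // ltW.
rewrite ler_pdivrMr; last by rewrite mulr_gt0 // exprn_gt0.
have := hf (k - 2 - e)%N; rewrite -[Z in B * _ ^+ Z](subnK le) exprD mulrA.
rewrite mulrAC ler_pM2r ?exprn_gt0 // => /le_trans; apply; rewrite ler_wpM2l //.
by rewrite ler_peMl ?exprn_ge0 // ler1n bin_gt0.
Qed.

Lemma wval_ADD n js (t : nat -> R) : (0 < n)%N ->
  wval (ADD n js t) = (0, \sum_(j <- js) t j *: tr (j%:R * n%:R) top) :> L.
Proof.
move=> n0; elim: js => [|j js IH]; first by rewrite big_nil wval_nil.
rewrite big_cons /ADD /= wval_cat -/(ADD n js t) IH (@wval_T n _ _ (t j *: top)) // ?wval1 //.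
by rewrite fmulE tr0 addr0 trZ.
Qed.

Lemma wval_NF n js (t : nat -> R) : (0 < n)%N ->
  wval (NF n js t) = (0, \sum_(j <- js) t j *: tr (j%:R * n%:R) top) :> L.
Proof.
move=> n0; elim: js => [|j js IH]; first by rewrite big_nil wval_nil.
rewrite big_cons /NF /= wval_cat -/(NF n js t) IH (@wval_T n _ _ (t j *: top)) //.
  by rewrite fmulE tr0 addr0 trZ.
rewrite wval_nseq /av fexpv; congr (_, _); rewrite -scaler_nat scalerA mulrC divfK //.
by rewrite pnatr_eq0 -lt0n.
Qed.

Lemma tot_NF0 n js : tot (NF n js (cf n 0)) = 0.
Proof.
elim: js => [|j js IH]; first by rewrite /tot big_nil.
rewrite /NF /= (tot_cat (T _ _ _)) -/(NF n js (cf n 0)) IH addr0 tot_T cf0 mul0r.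
rewrite /tot big_nseq; elim: (n) => //= i ->; by rewrite th_av normr0 addr0.
Qed.

Lemma tot_ADD (r : nat) n js (t : nat -> R) : (forall j, `|t j| <= r%:R) ->
  tot (ADD n js t) <= (size js * r)%:R.
Proof.
move=> ht; elim: js => [|j js IH]; first by rewrite /tot big_nil.
rewrite /ADD /= (tot_cat (T _ _ _)) -/(ADD n js t) mulSn natrD lerD // tot_T.
by rewrite /tot big_seq1 th_av.
Qed.

Let js := iota 0 m.

Lemma js_le (r : nat) : (m <= r)%N -> all (fun j => j <= r)%N js.
Proof. by move=> h; apply/allP => j; rewrite mem_iota /= => lt; apply: leq_trans (ltnW lt) h. Qed.

(* The word NF (cf n f) ++ xs n s is a normal form of the element (s, f). *)
Lemma append (r : nat) : exists C : nat, forall n s f l, (0 < n)%N ->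
  `|s| <= r%:R * n%:R -> (size f < k)%N -> fb n%:R (r%:R * n%:R ^+ (k - 1)) f ->
  box k (r%:R : R) l -> `|s + l.1| <= r%:R * n%:R ->
  cheapk C n (X (NF n js (cf n f) ++ xs n s ++ [:: l]))
    (X (NF n js (cf n (f + tr s l.2)) ++ xs n (s + l.1))).
Proof.
have [K hK] := cf_bound; have [D hD] := nat_above ((1 + trK k (r%:R : R)) * r%:R).
pose M := (r + K * r + K * D + m)%N.
have [C1 h1] := few_tops2 (3 * m + (M + m * M + 3)); have [C2 h2] := @absorb M js (js_le (leq_addl _ _)).
eexists => n s f l n0 hs sf hf hl hs'.
have n0' : 0 < n%:R :> R by rewrite ltr0n.
have n1 : 1 <= n%:R :> R by rewrite ler1n.
have [hl1 hl2 hl3] := hl.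
have rM : (r <= M)%N by rewrite /M; nlia.
(* The exponents of the current normal form are O(n), whereas a single letter changes them by O(1),
   as [hc] states: its translate has weight n^(k-2) instead of n^(k-1). *)
have ht j : `|cf n f j| <= M%:R * n%:R.
  apply: le_trans (@hK n (r%:R * n%:R) f j n0 _) _.
    by rewrite -mulrA -exprS; have -> : ((k - 2).+1 = k - 1)%N by nlia.
  by rewrite mulrA ler_wpM2r // -natrM ler_nat /M; nlia.
have hc j : `|cf n (tr s l.2) j| <= M%:R.
  apply: le_trans (@hK n D%:R _ j n0 _) _; last by rewrite -natrM ler_nat /M; nlia.
  apply: fb_le (tr_fb (ltnW hl2) (ler0n _ r) n0' hs (box_fb n1 k1 hl)).
  by rewrite mulrA ler_wpM2r // exprn_ge0.
have st : (size (tr s l.2) < k)%N by rewrite size_tr.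
have bA := boxs_ADD (n := n) (js_le (leq_addl _ m)) hc.
have bN := boxs_NF n0 (js_le (leq_addl _ m)) ht.
have e1 : X (NF n js (cf n (f + tr s l.2)) ++ xs n (s + l.1)) =
    X (NF n js (fun i => cf n f i + cf n (tr s l.2) i) ++ xs n (s + l.1)).
  by congr (X (_ ++ _)); rewrite /NF; congr flatten; apply: eq_map => j; rewrite cfD.
rewrite e1.
apply: cheap_trans; last first.
  have := cheap_catr (X (xs n (s + l.1))) (h2 n (cf n f) (cf n (tr s l.2)) n0 ht hc).
  by rewrite -!map_cat; apply.
(* Moving the power of x past [l] produces an [ADD] word. Both sides have bounded [tot], so
   [few_tops2] makes this exchange; [absorb] then takes care of the blocks. *)
rewrite -catA.
have := @xcat _ n (NF n js (cf n f)) _ _ [::] (M + 3 * m)%N _ _ (h1 n (xs n s ++ [:: l]) (ADD n js (cf n (tr s l.2)) ++ xs n (s + l.1)) n0 _ _ _ _ _ _).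
rewrite !cats0; apply.
- by move=> l' /bN; apply: box_le_nat; exact: leq_addr.
- by rewrite size_NF size_iota; nlia.
- by rewrite size_cat size_xs /=; nlia.
- rewrite size_cat size_ADD size_iota size_xs; apply: (@leq_trans (m * (3 * n) + n)%N).
    by rewrite leq_add2r leq_mul2l; apply/orP; right; move: n0; clear; lia.
  have -> : (m * (3 * n) + n = (3 * m + 1) * n)%N by rewrite mulnDl mul1n mulnCA mulnA.
  by rewrite leq_mul2r leq_add2l addn_gt0 !orbT.
- move=> l'; rewrite mem_cat => /orP[|].
    rewrite mem_cat inE => /orP[h|/eqP ->]; apply: (@box_le_nat r) => //; do ?[by nlia].
    exact: box_xs h.
  rewrite mem_cat => /orP[/bA|h]; first by apply: box_le_nat; nlia.
  by apply: (@box_le_nat r); [nlia|exact: box_xs h].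
- rewrite tot_cat tot_xs add0r /tot big_seq1; apply: le_trans (hl3 _) _; rewrite ler_nat; nlia.
- rewrite tot_cat tot_xs addr0; apply: le_trans (tot_ADD n js hc) _.
  rewrite size_iota ler_nat; nlia.
- rewrite !wval_cat !wval_xs // wval1 wval_ADD // cf_sum //.
  by case: (l) => a b; rewrite !fmulE tr_0 addr0 !add0r.
Qed.

Lemma null_fillable_succ : null_fillable R p q k.
Proof.
move=> r.
have [C0 h0] := @word_bound R k r k1; pose r' := (r + C0)%N.
have [C1 h1] := append r'; have [C2 h2] := few_tops2 (3 * m + 1).
exists (C1 + C2 + C2)%N => n w n0 sw hw w1.
have hj j : forall l, l \in take j w -> box k (r%:R : R) l by move=> l /mem_take /hw.
have sj j : (size (take j w) <= n)%N.
  by rewrite size_take_min; apply: leq_trans (geq_minr _ _) sw.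
have ht i : `|cf n 0 i| <= (m%:R : R) * n%:R by rewrite cf0 normr0 mulr_ge0.
(* The normal form of 1 is not the empty word, but its exponents vanish, so its [tot] is 0. *)
have base : cheapk C2 n (X (NF n js (cf n 0) ++ xs n 0)) (X [::]).
  apply: h2 => //.
  - rewrite size_cat size_NF size_xs size_iota.
    by have -> : (m * (3 * n) + n = (3 * m + 1) * n)%N by rewrite mulnDl mul1n mulnCA mulnA.
  - move=> l; rewrite cats0 mem_cat => /orP[|h].
      by move/(boxs_NF n0 (js_le (leqnn m)) ht); apply: box_le_nat; nlia.
    by apply: (@box_le_nat 0); [nlia|apply: box_xs h; rewrite normr0 mul0r].
  - by rewrite tot_cat tot_xs tot_NF0 addr0.
  - by rewrite /tot big_nil.
  - by rewrite wval_cat wval_xs // wval_NF // cf_sum ?size_poly0 // fmulE tr0 !addr0 wval_nil.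
have main j : (j <= size w)%N -> htpy (antidiags R) (bdn (C1 + C2)) ((C1 + C2) * n)
    (C2 * n ^ (k - 2) + j * (C1 * n ^ (k - 2))) (X (take j w))
    (X (NF n js (cf n (wval (take j w)).2) ++ xs n (wval (take j w)).1)).
  elim: j => [_|j IH lt].
    rewrite take0 wval_nil mul0n addn0; apply: htpy_sym; apply: htpy_sub base => [y|].
      by apply: bdn_le; exact: leq_addl.
    by rewrite leq_mul2r leq_addl orbT.
  rewrite (take_nth 1%g lt) wval_rcons -cats1.
  set l := nth 1%g w j; have hl : box k (r%:R : R) l by apply: hw; apply: mem_nth.
  have [b1 b2 b3] := h0 n _ n0 (sj j) (hj j); have [b1' _ _] := h0 n _ n0 (sj j.+1) (hj j.+1).
  rewrite (take_nth 1%g lt) wval_rcons -/l in b1'.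
  case: (wval (take j w)) IH b1 b2 b3 b1' => s f /= IH b1 b2 b3 b1'.
  have e : (((s, f) : L) * l = (s + l.1, f + tr s l.2))%g by case: (l).
  rewrite ?e /=.
  have rr : r%:R <= r'%:R :> R by rewrite ler_nat leq_addr.
  have ap : cheapk C1 n (X (NF n js (cf n f) ++ xs n s ++ [:: l]))
    (X (NF n js (cf n (f + tr s l.2)) ++ xs n (s + l.1))).
    apply: h1 => //.
    - by apply: le_trans b1 _; rewrite ler_wpM2r.
    - by apply: fb_le b3; rewrite ler_wpM2r ?exprn_ge0 // ler_nat leq_addl.
    - by apply: box_le_nat hl; exact: leq_addr.
    - by apply: le_trans b1' _; rewrite ler_wpM2r.
  rewrite mulSn [(C1 * _ + _)%N]addnC addnA; apply: htpy_trans.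
    by rewrite map_cat; apply: htpy_catr; exact: IH (ltnW lt).
  rewrite -map_cat -catA; apply: htpy_sub ap => [y|]; first by apply: bdn_le; exact: leq_addr.
  by rewrite leq_mul2r leq_addr orbT.
have := main _ (leqnn _); rewrite take_size w1 /= => H.
have H' : htpy (antidiags R) (bdn (C1 + C2)) ((C1 + C2) * n) (C2 * n ^ (k - 2))
    (X (NF n js (cf n 0) ++ xs n 0)) (X [::]).
  apply: htpy_sub base => [y|]; first by apply: bdn_le; exact: leq_addl.
  by rewrite leq_mul2r leq_addl orbT.
apply: (@htpy_leN _ _ _ _ (C2 * n ^ (k - 2) + size w * (C1 * n ^ (k - 2)) + C2 * n ^ (k - 2))).
  have -> : (n ^ (k - 1) = n * n ^ (k - 2))%N by rewrite -expnS; congr (_ ^ _)%N; nlia.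
  have a1 : (size w * (C1 * n ^ (k - 2)) <= C1 * (n * n ^ (k - 2)))%N.
    by rewrite mulnCA leq_mul2l leq_mul2r sw !orbT.
  have a2 : (C2 * n ^ (k - 2) <= C2 * (n * n ^ (k - 2)))%N by rewrite leq_mul2l leq_pmull ?orbT.
  by rewrite !mulnDl addnAC addnC addnA !leq_add.
apply: htpy_sub (htpy_trans H H') => [y|]; first by apply: bdn_le; exact: leq_addr.
by rewrite leq_mul2r leq_addr orbT.
Qed.
End Step.

Lemma null_fillable_all (R : archiRealFieldType) p q k : (2 < k)%N -> (k <= p)%N -> (k.-1 <= q)%N ->
  (2 < q)%N -> null_fillable R p q k.
Proof.
move=> + + + q2; case: k => // k; elim: k => // k IH k2 kp kq.
have [k3|] := ltnP 3 k.+2; last first.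
  move=> k3; have k1 : (k.+2 = 3)%N by nlia.
  rewrite k1; apply: null_fillable3 => //.
 by rewrite -k1.
apply: null_fillable_succ => //=; apply: fillable_null => //; first exact: ltnW.
by apply: IH; lia.
Qed.

(** The last induction step fills words in two copies of l_(p-1), which requires [p.-1 <= q];
    together with [q <= p] this leaves the two groups of the theorem. *)
Lemma fillable_top (R : archiRealFieldType) p q : (2 < q)%N -> (q <= p)%N -> (p.-1 <= q)%N ->
  fillable R p q p q.
Proof. by move=> q2 qp pq; apply: fillable_null => //; apply: null_fillable_all => //; lia. Qed.

Local Open Scope classical_set_scope.
Local Open Scope ring_scope.

(** * Fillings in compact presentations *)

Section FreeWords.
Variable G : groupType.
Implicit Types (S : set G) (u v w : word G) (Rel : set (word G)).

Lemma free_eq_cat u v w w' : free_eq w w' -> free_eq (u ++ w ++ v) (u ++ w' ++ v).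
Proof.
elim=> [w0|w0 w1 _ IH|w0 w1 w2 _ IH1 _ IH2|l w0 w1].
- exact: free_eq_refl.
- exact: free_eq_sym.
- exact: free_eq_trans IH1 IH2.
- by rewrite -[(w0 ++ w1) ++ v]catA -catA /= !catA -(catA _ _ v); apply: free_eq_cancel.
Qed.

Lemma word_invK : involutive (@word_inv G).
Proof.
move=> w; rewrite /word_inv map_rev revK -map_comp.
by rewrite -[RHS]map_id; apply: eq_map => -[g b] /=; rewrite negbK.
Qed.

Lemma word_inv_cat u v : word_inv (u ++ v) = word_inv v ++ word_inv u.
Proof. by rewrite /word_inv map_cat rev_cat. Qed.

Lemma size_word_inv w : size (word_inv w) = size w.
Proof. by rewrite size_rev size_map. Qed.

Lemma word_over_inv S w : word_over S w -> word_over S (word_inv w).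
Proof. by move=> h l; rewrite mem_rev => /mapP[m /h hm ->]. Qed.

Lemma word_over_cat S u v : word_over S u -> word_over S v -> word_over S (u ++ v).
Proof. by move=> h1 h2 l; rewrite mem_cat => /orP[/h1|/h2]. Qed.

Lemma word_over_catl S u v : word_over S (u ++ v) -> word_over S u.
Proof. by move=> h l hl; apply: h; rewrite mem_cat hl. Qed.

Lemma free_eq_wV w : free_eq (w ++ word_inv w) [::].
Proof.
elim/last_ind: w => [|w l IH]; first exact: free_eq_refl.
rewrite -cats1 word_inv_cat -catA /= /word_inv /=.
by apply: free_eq_trans (free_eq_cancel l w _) _.
Qed.

Lemma free_eq_Vw w : free_eq (word_inv w ++ w) [::].
Proof. by have := free_eq_wV (word_inv w); rewrite word_invK. Qed.

Lemma word_val_cat u v : word_val (u ++ v) = (word_val u * word_val v)%g.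
Proof. exact: big_cat. Qed.

Lemma word_val_inv w : word_val (word_inv w) = ((word_val w)^-1)%g.
Proof.
elim: w => [|[g b] w IH]; first by rewrite /word_val big_nil invg1.
rewrite -cat1s word_inv_cat !word_val_cat IH invgM; congr (_ * _)%g.
by rewrite /word_val !big_seq1 /letter_val /=; case: b => /=; rewrite ?invgK.
Qed.

Lemma free_eq_val w w' : free_eq w w' -> word_val w = word_val w'.
Proof.
elim=> [//|w0 w1 _ -> //|w0 w1 w2 _ -> _ -> //|[g b] w0 w1].
rewrite !word_val_cat /word_val !big_cons /letter_val; congr (_ * _)%g.
by case: b => /=; rewrite mulgA ?mulgV ?mulVg mul1g.
Qed.

Lemma filling_val S Rel w fl : (forall r, Rel r -> word_val r = 1%g) ->
  is_filling S Rel w fl -> word_val w = 1%g.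
Proof.
move=> hR [h /free_eq_val ->]; elim: fl h => [|[u r] fl IH] h /=; first by rewrite /word_val big_nil.
rewrite !word_val_cat IH; last by move=> x hx; apply: h; rewrite inE hx orbT.
have [_ hr] := h _ (mem_head _ _).
have -> : word_val r = 1%g.
  by case: hr => /hR // /(congr1 (fun x => (x^-1)%g)); rewrite word_val_inv invgK invg1.
by rewrite word_val_inv mul1g mulVg mulg1.
Qed.

Lemma flatten_conj U (fl : seq (word G * word G)) :
  free_eq (flatten [seq word_inv ur.1 ++ ur.2 ++ ur.1 | ur <- [seq (x.1 ++ word_inv U, x.2) | x <- fl]])
    (U ++ flatten [seq word_inv ur.1 ++ ur.2 ++ ur.1 | ur <- fl] ++ word_inv U).
Proof.
elim: fl => [|[u r] fl IH] /=; first exact/free_eq_sym/free_eq_wV.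
rewrite word_inv_cat word_invK -!catA.
have := free_eq_cat (U ++ word_inv u ++ r ++ u ++ word_inv U) [::] IH.
rewrite !cats0 -!catA => /free_eq_trans; apply.
have := free_eq_cat (U ++ word_inv u ++ r ++ u)
  (flatten [seq word_inv ur.1 ++ ur.2 ++ ur.1 | ur <- fl] ++ word_inv U) (free_eq_Vw U).
by rewrite -!catA.
Qed.

(** In the free group [U x V] is the conjugate of [x y^-1] by the inverse of [U], times [U y V]. *)
Lemma filling_step S Rel U V x y fl0 fl : word_over S U ->
  is_filling S Rel (x ++ word_inv y) fl0 -> is_filling S Rel (U ++ y ++ V) fl ->
  is_filling S Rel (U ++ x ++ V) ([seq (z.1 ++ word_inv U, z.2) | z <- fl0] ++ fl).
Proof.
move=> hU [h1 e1] [h2 e2]; split=> [ur|].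
  rewrite mem_cat => /orP[/mapP[z /h1[hz1 hz2] ->]|/h2 //]; split=> //=.
  by apply: word_over_cat => //; apply: word_over_inv.
rewrite map_cat flatten_cat; apply: free_eq_sym.
set F0 := flatten _; set F := flatten _.
apply: (@free_eq_trans _ _ (F0 ++ (U ++ y ++ V))).
  by have := free_eq_cat F0 [::] (free_eq_sym e2); rewrite !cats0.
apply: (@free_eq_trans _ _ ((U ++ (x ++ word_inv y) ++ word_inv U) ++ (U ++ y ++ V))).
  apply: (@free_eq_cat [::] (U ++ y ++ V)); apply: free_eq_trans (flatten_conj U fl0) _.
  exact/free_eq_cat/free_eq_sym.
apply: (@free_eq_trans _ _ (U ++ x ++ word_inv y ++ y ++ V)).
  have := free_eq_cat (U ++ x ++ word_inv y) (y ++ V) (free_eq_Vw U).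
  by rewrite -!catA.
by have := free_eq_cat (U ++ x) V (free_eq_Vw y); rewrite -!catA.
Qed.
End FreeWords.

Section Balls.
Variables (R : realType) (G : topGroupType) (S : set G).
Implicit Types (u v w : word G) (d : R).

Lemma word_ballM d d' (x y : G) : word_ball S d x -> word_ball S d' y -> word_ball S (d + d') (x * y)%g.
Proof.
move=> [w [h1 <- h3]] [w' [h1' <- h3']]; exists (w ++ w'); split.
- exact: word_over_cat.
- exact: word_val_cat.
- by rewrite size_cat natrD lerD.
Qed.

Lemma word_ballV d (x : G) : word_ball S d x -> word_ball S d (x^-1)%g.
Proof.
move=> [w [h1 <- h3]]; exists (word_inv w); split; first exact: word_over_inv.
- exact: word_val_inv.
- by rewrite size_word_inv.
Qed.

Lemma word_ball_le d d' (x : G) : d <= d' -> word_ball S d x -> word_ball S d' x.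
Proof. by move=> le [w [h1 h2 h3]]; exists w; split=> //; apply: le_trans le. Qed.

Lemma diameter_le d d' u : d <= d' -> word_diameter_le S d u -> word_diameter_le S d' u.
Proof. by move=> le h u1 u2 /h; apply: word_ball_le. Qed.

Lemma diameter_word u : word_over S u -> word_diameter_le S ((size u)%:R : R) u.
Proof.
move=> h u1 u2 e; exists u1; split=> //; first by move: h; rewrite e; apply: word_over_catl.
by rewrite e size_cat ler_nat leq_addr.
Qed.

(** A prefix of the inverse is the inverse of a suffix of [u], whose value is a quotient of the
    values of two prefixes; hence the doubling. *)
Lemma diameter_inv d u : word_diameter_le S d u -> word_diameter_le S (d + d) (word_inv u).
Proof.
move=> h u1 u2 e.
have eu : u = word_inv u2 ++ word_inv u1 by rewrite -word_inv_cat -e word_invK.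
have hu : word_ball S d (word_val u) by apply: (h u [::]); rewrite cats0.
have -> : word_val u1 = ((word_val u)^-1 * word_val (word_inv u2))%g.
  by rewrite eu word_val_cat !word_val_inv invgM !invgK mulgK.
by apply: word_ballM; [exact: word_ballV|exact: h eu].
Qed.

Lemma diameter_cat d d' u v : 0 <= d' -> word_diameter_le S d u -> word_diameter_le S d' v ->
  word_diameter_le S (d + d') (u ++ v).
Proof.
move=> d0 hu hv w1 w2 /cat_split[[w [eu _]]|[w [-> hw]]].
  by apply: (@word_ball_le d); [rewrite lerDl|exact: hu eu].
rewrite word_val_cat; apply: word_ballM; last exact: hv hw.
by apply: (hu u [::]); rewrite cats0.
Qed.
End Balls.

Section Filled.
Variables (R : realType) (G : topGroupType) (S : set G) (Rel : set (word G)).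
Implicit Types (x y U V : word G).

Definition filled_by (a : nat) (d : R) (w : word G) : Prop :=
  exists fl, [/\ is_filling S Rel w fl, (size fl <= a)%N & filling_diameter_le S d fl].

Lemma filled_nil a (d : R) : filled_by a d [::].
Proof. by exists [::]; split=> //; split=> //; apply: free_eq_refl. Qed.

Lemma filled_le a a' (d d' : R) w : (a <= a')%N -> d <= d' -> filled_by a d w -> filled_by a' d' w.
Proof.
move=> la ld [fl [h1 h2 h3]]; exists fl; split=> //; first exact: leq_trans la.
by move=> ur /h3; apply: diameter_le.
Qed.

Lemma filled_step a0 a (d0 dU d : R) U V x y : word_over S U -> 0 <= dU ->
  word_diameter_le S dU (word_inv U) -> filled_by a0 d0 (x ++ word_inv y) ->
  filled_by a d (U ++ y ++ V) -> d0 + dU <= d -> filled_by (a0 + a) d (U ++ x ++ V).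
Proof.
move=> hU dU0 hd [fl0 [h1 h2 h3]] [fl [h1' h2' h3']] ld.
exists ([seq (z.1 ++ word_inv U, z.2) | z <- fl0] ++ fl); split.
- exact: filling_step h1 h1'.
- by rewrite size_cat size_map leq_add.
- move=> ur; rewrite mem_cat => /orP[/mapP[z /h3 hz ->]|/h3' //] /=.
  by apply: diameter_le ld _; apply: diameter_cat.
Qed.

Variables (E : groupType) (A : central_subgroup E) (SE : E -> Prop).
Variables (pi : E -> G) (tau : E -> word G) (K a0 : nat) (d0 : R).
Hypothesis K0 : (0 < K)%N.
Hypothesis tauS : forall e, SE e ->
  [/\ word_over S (tau e), word_val (tau e) = pi e & (size (tau e) <= K)%N].
Local Notation theta w := (flatten (map tau w)).
(** This replaces the requirement that [pi] be a morphism: the projection used below is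
    multiplicative only on polynomials of bounded degree. *)
Hypothesis piA : forall w w', wover SE w -> wover SE w' -> eqA A (wval w) (wval w') ->
  word_val (theta w) = word_val (theta w').
Hypothesis null : forall w : word G, word_over S w -> word_val w = 1%g -> (size w <= 4 * K)%N ->
  filled_by a0 d0 w.

Lemma theta_over (w : seq E) : wover SE w -> word_over S (theta w).
Proof. by move=> h l /flattenP[v /mapP[e /h /tauS[he _ _] ->]]; apply: he. Qed.

Lemma size_theta (w : seq E) : wover SE w -> (size (theta w) <= size w * K)%N.
Proof.
elim: w => //= e w IH h; rewrite size_cat mulSn leq_add //.
  by have [] := tauS (h e (mem_head _ _)).
by apply: IH => x hx; apply: h; rewrite inE hx orbT.
Qed.

Lemma theta_prefix (u : seq E) (w1 w2 : word G) : wover SE u -> theta u = w1 ++ w2 ->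
  exists v1 v2 y, [/\ u = v1 ++ v2, w1 = theta v1 ++ y, word_over S y & (size y <= K)%N].
Proof.
elim: u w1 w2 => [|e u IH] w1 w2 hu /=.
  by case: w1 => // _; exists [::], [::], [::].
have [he _ se] := tauS (hu e (mem_head _ _)).
move=> /cat_split[[w [ew _]]|[w [-> ew]]].
  exists [::], (e :: u), w1; split=> //; first by move: he; rewrite ew; apply: word_over_catl.
  by apply: leq_trans se; rewrite ew size_cat leq_addr.
have [|v1 [v2 [y [-> -> h3 h4]]]] := IH w w2 _ ew.
  by move=> x hx; apply: hu; rewrite inE hx orbT.
by exists (e :: v1), v2, y; split=> //=; rewrite catA.
Qed.

Lemma theta_diameter d (u : seq E) : wover SE u -> rad A SE d u ->
  word_diameter_le S ((d * K + K)%:R : R) (theta u).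
Proof.
move=> hu hr w1 w2 e; have [v1 [v2 [y [e1 -> hy sy]]]] := theta_prefix hu e.
have [w [hw sw hA]] := hr _ _ e1.
rewrite word_val_cat natrD; apply: word_ballM; last first.
  by exists y; split=> //; rewrite ler_nat.
exists (theta w); split; first exact: theta_over.
  by apply: piA => //; move: hu; rewrite e1; apply: wover_catl.
by rewrite ler_nat; apply: leq_trans (size_theta hw) _; rewrite leq_mul2r sw orbT.
Qed.

Lemma null_change x y : word_over S x -> word_over S y -> word_val x = word_val y ->
  (size x + size y <= 4 * K)%N -> filled_by a0 d0 (x ++ word_inv y).
Proof.
move=> hx hy e s; apply: null.
- by apply: word_over_cat => //; apply: word_over_inv.
- by rewrite word_val_cat word_val_inv e mulgV.
- by rewrite size_cat size_word_inv.
Qed.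

(** A relator of length at most 4 is spelled by a null-homotopic word of length at most [4 * K], and
    [null] fills that with area [a0]. *)
Lemma htpy_filled d N w : htpy A SE d N w [::] -> wover SE w ->
  filled_by (N * a0) (d0 + ((d * K + K)%:R + (d * K + K)%:R)) (theta w).
Proof.
suff H w' : htpy A SE d N w w' -> w' = [::] -> wover SE w ->
    filled_by (N * a0) (d0 + ((d * K + K)%:R + (d * K + K)%:R)) (theta w).
  by move=> h; apply: (H _ h).
elim=> [N' w0 -> _|N' u r r' v w0 hu sr hr hr' e _ IH e' hw]; first exact: filled_nil.
have hw' : wover SE (u ++ r' ++ v).
  move=> x; have := hw x; rewrite !mem_cat => h /or3P[hx|/hr' //|hx]; apply: h; rewrite hx ?orbT //.
have := IH e' hw'; rewrite !map_cat !flatten_cat mulSn => {}IH.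
have ou : wover SE u by apply: wover_catl hw.
have sz z : wover SE z -> (size (theta z) <= size z * K)%N by apply: size_theta.
apply: (filled_step _ _ _ _ IH); last exact: lexx.
- exact: theta_over.
- by [].
- exact/diameter_inv/theta_diameter.
- apply: null_change; [exact: theta_over|exact: theta_over|exact: piA|].
  apply: leq_trans (leq_add (size_theta hr) (size_theta hr')) _.
  by rewrite -mulnDl leq_mul2r sr orbT.
Qed.

Variable lift : G * bool -> E.
Hypothesis liftS : forall l, S l.1 -> SE (lift l) /\ pi (lift l) = letter_val l.

Lemma lift_over (w : word G) : word_over S w -> wover SE (map lift w).
Proof. by move=> h e /mapP[l /h /liftS[hl _] ->]. Qed.

(** A word and its round trip through [E] differ letter by letter, by null-homotopic words of length
    at most [1 + K]. *)
Lemma lift_filled a (d : R) (w : word G) : word_over S w ->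
  d0 + ((size w * K)%:R + (size w * K)%:R) <= d ->
  filled_by a d (theta (map lift w)) -> filled_by (size w * a0 + a) d w.
Proof.
move=> hw hd; suff H w2 : forall w1, w = w1 ++ w2 ->
    filled_by a d (theta (map lift w)) ->
    filled_by (size w2 * a0 + a) d (theta (map lift w1) ++ w2) by exact: (H w [::]).
elim: w2 => [|l w2 IH] w1 e hf; first by rewrite cats0 -[w1]cats0 -e.
have hl : S l.1 by apply: hw; rewrite e mem_cat mem_head orbT.
have h1 : word_over S w1 by move: hw; rewrite e; apply: word_over_catl.
have [he epi] := liftS hl; have [ho ev es] := tauS he.
have := IH (rcons w1 l); rewrite cat_rcons => /(_ e hf).
rewrite map_rcons map_rcons flatten_rcons -catA /= mulSn -addnA => {}IH.
have o1 := theta_over (lift_over h1).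
apply: (@filled_step _ _ d0 _ d _ _ [:: l] _ o1 _ _ _ IH hd).
- by [].
- apply: diameter_inv; apply: diameter_le (diameter_word _ o1); rewrite ler_nat.
  apply: leq_trans (size_theta (lift_over h1)) _; rewrite size_map leq_mul2r e size_cat leq_addr orbT //.
- apply: null_change => //.
  + by move=> l'; rewrite inE => /eqP ->.
  + by rewrite ev epi /word_val big_seq1.
  + apply: (@leq_trans (1 + K)); first by rewrite leq_add2l.
    by move: K0; clear; lia.
Qed.
End Filled.

(** * Compact sets and balls of a compact generating set *)

HB.instance Definition _ (R : realType) (n : nat) := Complete.on 'rV[R]_n.

Section Baire.
Variables (R : realType) (G : topGroupType) (N : nat).
Variables (kap : G -> 'rV[R]_N) (mk : 'rV[R]_N -> G).
Hypotheses (kap_cont : continuous kap) (mk_cont : continuous mk).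
Hypotheses (kapK : cancel kap mk) (mkK : cancel mk kap).
Variable S : set G.
Hypothesis genS : compact_generating S.

Lemma compact_image (T U : topologicalType) (f : T -> U) (A : set T) :
  continuous f -> compact A -> compact (f @` A).
Proof. by move=> hf; apply: continuous_compact; exact: continuous_subspaceT. Qed.

Lemma mulg_left_continuous (a : G) : continuous (fun x : G => (a * x)%g).
Proof.
move=> x; apply: (@cvg_comp _ _ _ (fun x : G => (a, x)) (fun z : G * G => (z.1 * z.2)%g) _ (nbhs (a, x))).
  by apply: cvg_pair; [exact: cvg_cst|exact: cvg_id].
exact: (@mulg_continuous G (a, x)).
Qed.

Fixpoint powS (k : nat) : set G :=
  if k is k'.+1 then (fun z : G * G => (z.1 * z.2)%g) @` ((S `|` ((fun x : G => (x^-1)%g) @` S)) `*` powS k')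
  else [set 1%g].

Lemma compact_powS k : compact (powS k).
Proof.
elim: k => [|k IH] /=; first exact: compact_set1.
apply: compact_image; first exact: mulg_continuous.
apply: compact_setX => //; have [cS _] := genS; apply: compactU => //.
by apply: compact_image => //; exact: invg_continuous.
Qed.

Lemma powS_ball k : powS k `<=` word_ball S (k%:R : R).
Proof.
elim: k => [|k IH] x /=.
  by move=> ->; exists [::]; split=> //; rewrite /word_val big_nil.
move=> [[y z] /= [hy /IH hz] <-]; rewrite -natr1 addrC; apply: word_ballM => //.
case: hy => [hy|[y' hy' <-]].
  exists [:: (y, true)]; split=> //; last by rewrite /word_val big_seq1.
  by move=> l; rewrite inE => /eqP ->.
exists [:: (y', false)]; split=> //; last by rewrite /word_val big_seq1.
by move=> l; rewrite inE => /eqP ->.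
Qed.

Lemma word_powS (w : word G) : word_over S w -> powS (size w) (word_val w).
Proof.
elim: w => [|[g b] w IH] h; first by rewrite /word_val big_nil.
have hg : S g by apply: (h (g, b)); rewrite mem_head.
exists (letter_val (g, b), word_val w); last by rewrite /word_val big_cons.
split=> /=; last by apply: IH => l hl; apply: h; rewrite inE hl orbT.
by rewrite /letter_val /=; case: b {h}; [left|right; exists g].
Qed.

(* By Baire, as the compact sets powS k cover G. *)
Lemma powS_interior : exists k (D : set 'rV[R]_N),
  [/\ open D, D !=set0 & D `<=` kap @` powS k].
Proof.
apply: contrapT => h.
have H i : open (~` (kap @` powS i)) /\ dense (~` (kap @` powS i)).
  split.
    apply: closed_openC; apply: compact_closed; first exact: norm_hausdorff.
    by apply: compact_image => //; exact: compact_powS.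
  move=> D hD oD; apply: contrapT => h'; apply: h; exists i, D; split=> //.
  move=> c hc; apply: contrapT => hc'; apply: h'; by exists c.
have [c [_ hc]] := Baire H (ex_intro setT 0 I) openT.
have [w hw ew] := genS.2 (mk c).
apply: (hc (size w) I); exists (mk c) => //.
by rewrite -ew; exact: word_powS.
Qed.

(** Let [powS k] contain a neighbourhood of [x0]. Its translates by [mk c] times the inverse of [x0]
    cover [B], and finitely many are enough; a point of [B] is then a product of three elements of
    bounded length. *)
Lemma compact_ball (B : set G) : compact B -> exists K : nat, B `<=` word_ball S (K%:R : R).
Proof.
move=> cB; have [k [D [oD [d0 hd0] hD]]] := powS_interior; pose x0 := mk d0.
have hex c : exists n : nat, word_ball S (n%:R : R) (mk c).
  by have [w hw ew] := genS.2 (mk c); exists (size w); exists w.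
have [b hb] := choice hex.
pose f (c : 'rV[R]_N) : set 'rV[R]_N := (fun c' => kap (x0 * (mk c)^-1 * mk c')%g) @^-1` D.
have fopen c : open (f c).
  apply: open_comp => // c' _.
  apply: (@continuous_comp _ _ _ mk (fun y => kap (x0 * (mk c)^-1 * y)%g)); first exact: mk_cont.
  apply: (@continuous_comp _ _ _ (fun y => x0 * (mk c)^-1 * y)%g kap); last exact: kap_cont.
  exact: mulg_left_continuous.
have := compact_image kap_cont cB; rewrite compact_cover => /(_ _ setT f) [].
- by move=> c _; apply: fopen.
- by move=> c _; exists c => //; rewrite /f /= mulgVK mkK.
move=> D' _ hD'; exists (\max_(c <- D') b c + (k + k))%N => x Bx.
have [c cD /hD [v hv ev]] : cover [set` D'] f (kap x) by apply: hD'; exists x.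
have {}ev : v = (x0 * (mk c)^-1 * x)%g by rewrite -[LHS]kapK ev !kapK.
have [v0 hv0 ev0] := hD _ hd0.
have -> : x = ((mk c * x0^-1) * v)%g by rewrite ev !mulgA mulgVK mulgV mul1g.
have hx0 : word_ball S (k%:R : R) (x0^-1)%g.
  by apply: word_ballV; rewrite /x0 -ev0 kapK; apply: powS_ball.
rewrite !natrD addrA; apply: word_ballM; last exact: powS_ball.
apply: word_ballM hx0; apply: word_ball_le (hb c); rewrite ler_nat.
exact: leq_bigmax_seq.
Qed.
End Baire.

(** * Coordinates on the central product *)

Section Coordinates.
Variables (R : realType) (p q : nat).
Hypotheses (hp : (2 < p)%N) (hq : (2 < q)%N).
Let n := (p + q - 3)%N.
Local Notation G := (central_product_group R p q).
Local Notation U := (chain_up R n p).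
Local Notation D := (chain_down R n p).

Definition lin_part (s t : R) : 'M[R]_n := expm (s *: U + t *: D).

Lemma lin_partE (s t : R) : exists u : 'rV[R]_p * 'rV[R]_q, [/\ s *: U + t *: D = Tm u, sco u.1 = s & sco u.2 = t].
Proof.
have sc m (c : R) : (0 < m)%N -> sco (\row_(i < m) (c *+ (i == 0%N :> nat))) = c.
  move=> m0; rewrite /sco (bigD1 (Ordinal m0)) //= big1 ?addr0 ?mxE //= => i.
  by rewrite -val_eqE /= => /negbTE ->; rewrite mulr0n.
exists (\row_(i < p) (s *+ (i == 0%N :> nat)), \row_(i < q) (t *+ (i == 0%N :> nat))).
by rewrite /Tm /= !sc //; [apply: leq_trans hq|apply: leq_trans hp].
Qed.

Definition mkM (s t : R) (v : 'cV[R]_n) : 'M[R]_(p + q - 3 + 1) := gaff (lin_part s t) v.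

Fact mkM_proof s t v : @is_exp_rho R p q (mkM s t v).
Proof.
apply/asboolP; have [u [eu _ _]] := lin_partE s t.
have [B hB] := phim_inv (Tm_nil u (leqnn n)); have [u' [e1 e2]] := Vm_surj u (B *m v).
by exists u'; rewrite expm_rho e1 e2 mulmxA [_ *m B]hB mul1mx /mkM /lin_part eu.
Qed.

Definition mk s t v : G := exist (@is_exp_rho R p q) _ (mkM_proof s t v).

Lemma mk_surj (x : G) : exists s t v, x = mk s t v.
Proof.
have [u eu] := cpg_exp x; exists (sco u.1), (sco u.2), (phim (Tm u) *m Vm u).
by apply: val_inj; rewrite eu expm_rho.
Qed.

Lemma mk_inj s t v s' t' v' : mk s t v = mk s' t' v' -> [/\ s = s', t = t' & v = v'].
Proof.
move=> /(congr1 val) /= /gaff_inj[]; rewrite /lin_part.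
have [u [-> <- <-]] := lin_partE s t; have [u' [-> <- <-]] := lin_partE s' t'.
move=> h ->; have [a1 a2] := expm_Tm_entry hp hq u; have [b1 b2] := expm_Tm_entry hp hq u'.
by move: a1 a2; rewrite h b1 b2.
Qed.

Lemma lin_partM s t s' t' : lin_part s t * lin_part s' t' = lin_part (s + s') (t + t').
Proof.
rewrite /lin_part; have [u [eu <- <-]] := lin_partE s t; have [u' [eu' <- <-]] := lin_partE s' t'.
by rewrite /= -/(Tm u) -/(Tm u') expm_Tm /Tm /= !scoD.
Qed.

Lemma mkM_mul s t v s' t' v' : (mk s t v * mk s' t' v')%g = mk (s + s') (t + t') (lin_part s t *m v' + v).
Proof. by apply: val_inj; rewrite /= /mkM mulmxE gaffM mulmxE lin_partM. Qed.

Lemma lin_part0 : lin_part 0 0 = 1.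
Proof. by rewrite /lin_part !scale0r addr0 expm0. Qed.

Lemma mk1 : mk 0 0 0 = 1%g.
Proof.
by apply: (mulgI (mk 0 0 0)); rewrite mulg1 mkM_mul lin_part0 mul1mx !addr0.
Qed.

Let lt0 : (0 < n)%N. Proof. by rewrite /n; lia. Qed.
Let lt1 : (1 < n)%N. Proof. by rewrite /n; lia. Qed.
Let lt2 : (p - 2 < n)%N. Proof. by rewrite /n; lia. Qed.
Let lt3 : (p - 1 < n)%N. Proof. by rewrite /n; lia. Qed.

(** Each of the two matrix entries receives a contribution from the first power alone in the
    exponential series, so it reads off [s] or [t] without a logarithm; the chart is then visibly
    continuous. *)
Definition coords (x : G) : 'rV[R]_(1 + (1 + n)) :=
  row_mx (const_mx (ulsubmx (val x) (Ordinal lt1) (Ordinal lt0)))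
    (row_mx (const_mx (ulsubmx (val x) (Ordinal lt2) (Ordinal lt3))) (ursubmx (val x))^T).

Definition of_coords (c : 'rV[R]_(1 + (1 + n))) : G :=
  mk (lsubmx c 0 0) (lsubmx (rsubmx c) 0 0) (rsubmx (rsubmx c))^T.

Lemma lin_part_entries s t : lin_part s t (Ordinal lt1) (Ordinal lt0) = s /\
  lin_part s t (Ordinal lt2) (Ordinal lt3) = t.
Proof.
rewrite /lin_part; have [u [-> <- <-]] := lin_partE s t.
have [<- <-] := expm_Tm_entry hp hq u.
by split; congr (fun_of_matrix _ _ _); apply: val_inj.
Qed.

Lemma coords_mk s t v : coords (mk s t v) = row_mx (const_mx s) (row_mx (const_mx t) v^T).
Proof.
have [es et] := lin_part_entries s t.
by rewrite /coords /= /mkM /gaff block_mxKul block_mxKur es et.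
Qed.

Lemma of_coordsK : cancel of_coords coords.
Proof.
move=> c; rewrite /of_coords coords_mk trmxK -[RHS]hsubmxK; congr row_mx.
  by apply/matrixP => i j; rewrite mxE !ord1.
rewrite -[RHS]hsubmxK; congr row_mx.
by apply/matrixP => i j; rewrite mxE !ord1.
Qed.

Lemma coordsK : cancel coords of_coords.
Proof.
move=> x; have [s [t [v ->]]] := mk_surj x.
by rewrite coords_mk /of_coords !(row_mxKl, row_mxKr) !mxE trmxK.
Qed.

Lemma coords_continuous : continuous coords.
Proof.
have cv i j : continuous (fun x : G => (val x) i j).
  by apply: cont_entry; exact: cpg_val_continuous.
apply: cont_mx => i j; rewrite /coords.
have [j' ->|j' ->] := split_ordP j.
  by under eq_fun do rewrite row_mxEl !mxE; apply: cv.
have [j'' ->|j'' ->] := split_ordP j'.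
  by under eq_fun do rewrite row_mxEr row_mxEl !mxE; apply: cv.
by under eq_fun do rewrite !row_mxEr !mxE; apply: cv.
Qed.

Lemma gaff_continuous (T : topologicalType) m (f : T -> 'M[R]_m) (g : T -> 'cV[R]_m) :
  continuous f -> continuous g -> continuous (fun x => gaff (f x) (g x)).
Proof.
move=> cf cg; apply: cont_mx => i j; rewrite /gaff.
have [i' ->|i' ->] := split_ordP i; have [j' ->|j' ->] := split_ordP j.
- by under eq_fun do rewrite block_mxEul; apply: cont_entry.
- by under eq_fun do rewrite block_mxEur; apply: cont_entry.
- by under eq_fun do rewrite block_mxEdl; exact: cst_continuous.
- by under eq_fun do rewrite block_mxEdr; exact: cst_continuous.
Qed.

Lemma expm_continuous (T : topologicalType) m (f : T -> 'M[R]_m) :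
  continuous f -> continuous (fun x => expm (f x)).
Proof.
move=> cf; rewrite /expm; apply: cont_mx => i j.
under eq_fun do rewrite summxE.
apply: (@continuous_big R 'I_m +%R 0 predT add_continuous T (index_enum 'I_m)
  (fun l x => ((l`!%:R)^-1 *: f x ^+ l) i j)) => l _.
under eq_fun do rewrite mxE.
move=> x; apply: (@continuousM _ _ (fun=> _) (fun x => (f x ^+ l) i j)); first exact: cst_continuous.
by apply: cont_entry; apply: cont_exp.
Qed.

Lemma of_coords_continuous : continuous of_coords.
Proof.
apply: continuous_comp_initial.
have ce i j : continuous (fun c : 'rV[R]_(1 + (1 + n)) => c i j) by apply: cont_entry => x; exact: cvg_id.
have cz (m : nat) (A : 'M[R]_m) k : continuous (fun c : 'rV[R]_(1 + (1 + n)) => c 0 k *: A).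
  apply: cont_mx => i j; under eq_fun do rewrite mxE.
  by move=> x; apply: (@continuousM _ _ (fun c : 'rV[R]_(1 + (1 + n)) => c 0 k) (fun=> _)); [exact: ce|exact: cst_continuous].
apply: gaff_continuous.
  apply: expm_continuous; under eq_fun do rewrite !mxE.
  by apply: cont_addmx; apply: cz.
by apply: cont_mx => i j; under eq_fun do rewrite !mxE; apply: ce.
Qed.
End Coordinates.

Lemma taylor_tr (R : realType) (n : nat) (s : R) (f : {poly R}) (i : nat) : (size f <= n)%N ->
  \sum_(k < n) (k`!%:R)^-1 * (s ^+ k * f^`(k)`_i) = (tr s f)`_i.
Proof.
move=> sf; rewrite (@coef_tr _ (i + n)); last by apply: leq_trans sf (leq_addl _ _).
rewrite big_split_ord /= [Z in _ = Z + _]big1 ?add0r => [|j _]; last by rewrite bin_small // mulr0n mulr0.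
apply: eq_bigr => k _; rewrite coef_derivn addKn [(k + i)%N]addnC -[f`_(_) *+ _]mulr_natr -[_ *+ 'C(_, _)]mulr_natr -bin_ffact natrM.
rewrite -[in RHS]bin_sub ?leq_addr // addKn.
have k0 : k`!%:R != 0 :> R by apply: fact_neq0.
by field.
Qed.

Section Exponential.
Variables (R : realType) (n : nat) (h : nat -> nat) (c : nat -> R) (K : nat).
Hypothesis Kn : (K <= n)%N.
Definition polyvec (f : {poly R}) : 'cV[R]_n := \col_k (f`_(h k) * c k).

(** The exponential of [s] times the derivation is the translation by [s], by Taylor's formula;
    [K <= n] ensures that the truncated series has enough terms. *)
Lemma expm_polyvec (T : 'M[R]_n) (s : R) (f : {poly R}) :
  (forall g : {poly R}, (size g < K)%N -> T *m polyvec g = s *: polyvec g^`()) ->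
  (size f < K)%N -> expm T *m polyvec f = polyvec (tr s f).
Proof.
move=> hT sf.
have sd k : (size (f^`(k)) < K)%N.
  elim: k => //= k IH; rewrite -/(f^`(k)); have [->|nz] := eqVneq f^`(k) 0.
    by rewrite linear0 size_poly0; apply: leq_ltn_trans sf.
  exact: ltn_trans (lt_size_deriv nz) IH.
have hk k : T ^+ k *m polyvec f = s ^+ k *: polyvec f^`(k).
  elim: k => [|k IH]; first by rewrite !expr0 mul1mx scale1r.
  by rewrite exprS -mulmxE -mulmxA IH -scalemxAr hT // scalerA exprSr.
rewrite /expm mulmx_suml; apply/colP => j; rewrite summxE [RHS]mxE -(@taylor_tr _ n); last first.
  by apply: leq_trans Kn; apply: ltnW.
rewrite mulr_suml; apply: eq_bigr => k _.
by rewrite -scalemxAl hk !mxE !mulrA.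
Qed.
End Exponential.

(** * The projection of E onto the central product *)

Section Projection.
Variables (R : realType) (p q : nat).
Hypotheses (hp : (2 < p)%N) (hq : (2 < q)%N).
Let n := (p + q - 3)%N.
Local Notation G := (central_product_group R p q).
Local Notation U := (chain_up R n p).
Local Notation D := (chain_down R n p).
Local Notation E := (filiform R * filiform R)%type.

(* As the generators x_i and y_j of the abelian ideal are iterated brackets,
   they correspond to the polynomials 'X^k / k`!. *)
Definition vecX := @polyvec R n (fun k => (p - 2 - k)%N)
  (fun k => if (k <= p - 2)%N then ((p - 2 - k)`!)%:R else 0).
Definition vecY := @polyvec R n (fun k => (k - (p - 2))%N)
  (fun k => if (p - 2 <= k)%N then ((k - (p - 2))`!)%:R else 0).

Lemma chain_up_vecX (f : {poly R}) : (size f < p)%N -> U *m vecX f = vecX f^`().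
Proof.
move=> sf; apply/colP => i; rewrite !mxE coef_deriv.
have [i0|i0] := posnP i.
  rewrite big1 => [|j _]; last by rewrite !mxE i0 /= mul0r.
  by rewrite i0 subn0 nth_default ?mul0rn ?mul0r //; rewrite -ltnS; apply: leq_trans sf _; move: hp; clear; lia.
have li : (i.-1 < n)%N by have := ltn_ord i; lia.
rewrite (bigD1 (Ordinal li)) //= big1 ?addr0 => [|j].
  rewrite !mxE /= prednK // eqxx /=; case: ltnP => h.
    have -> : (p - 2 - i.-1 = (p - 2 - i).+1)%N by lia.
    have -> : (i.-1 <= p - 2)%N by lia.
    have -> : (i <= p - 2)%N by lia.
    by rewrite mul1r factS natrM mulrA [_ * _.+1%:R]mulr_natr.
  by have -> : (i <= p - 2)%N = false by [lia]; rewrite mul0r mulr0.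
rewrite -val_eqE /= => ne; rewrite !mxE; have -> : (i == j.+1 :> nat) = false by lia.
by rewrite mul0r.
Qed.

Lemma chain_down_vecX (f : {poly R}) : D *m vecX f = 0.
Proof.
apply/colP => i; rewrite !mxE big1 // => j _; rewrite !mxE.
case: eqP => [e|]; rewrite ?mul0r //=; case: leqP => h; rewrite ?mul0r //.
by have -> : (j <= p - 2)%N = false by [lia]; rewrite !mulr0.
Qed.

Lemma chain_up_vecY (f : {poly R}) : U *m vecY f = 0.
Proof.
apply/colP => i; rewrite !mxE big1 // => j _; rewrite !mxE.
case: eqP => [e|]; rewrite ?mul0r //=; case: leqP => h; rewrite ?mul0r //.
by have -> : (p - 2 <= j)%N = false by [lia]; rewrite !mulr0.
Qed.

Lemma chain_down_vecY (f : {poly R}) : (size f < q)%N -> D *m vecY f = vecY f^`().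
Proof.
move=> sf; apply/colP => i; rewrite !mxE coef_deriv.
have [li|i0] := ltnP i.+1 n; last first.
  rewrite big1 => [|j _]; last first.
    by rewrite !mxE; have -> : (j == i.+1 :> nat) = false by [have := ltn_ord j; lia]; rewrite mul0r.
  rewrite nth_default ?mul0rn ?mul0r // -ltnS; apply: leq_trans sf _.
  by move: i0 hp hq; rewrite /n; clear; lia.
rewrite (bigD1 (Ordinal li)) //= big1 ?addr0 => [|j].
  rewrite !mxE /= eqxx /=; case: leqP => h.
    have -> : (i.+1 - (p - 2) = (i - (p - 2)).+1)%N by lia.
    have -> : (p - 2 <= i.+1)%N by lia.
    have -> : (p - 2 <= i)%N by lia.
    by rewrite mul1r factS natrM mulrA [_ * _.+1%:R]mulr_natr.
  by have -> : (p - 2 <= i)%N = false by [lia]; rewrite mul0r mulr0.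
rewrite -val_eqE /= => ne; rewrite !mxE; have -> : (j == i.+1 :> nat) = false by lia.
by rewrite mul0r.
Qed.

Lemma lin_part_vecX s t (f : {poly R}) : (size f < p)%N -> lin_part p q s t *m vecX f = vecX (tr s f).
Proof.
apply: expm_polyvec => [|g sg]; first by rewrite /n; lia.
by rewrite mulmxDl -!scalemxAl chain_up_vecX // chain_down_vecX scaler0 addr0.
Qed.

Lemma lin_part_vecY s t (f : {poly R}) : (size f < q)%N -> lin_part p q s t *m vecY f = vecY (tr t f).
Proof.
apply: expm_polyvec => [|g sg]; first by rewrite /n; lia.
by rewrite mulmxDl -!scalemxAl chain_down_vecY // chain_up_vecY scaler0 add0r.
Qed.

Definition proj (e : E) : G := mk hp hq e.1.1 e.2.1 (vecX e.1.2 + vecY e.2.2).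

(** E contains polynomials of every degree; this condition describes the subgroup l_p x l_q, on
    which [proj] is a morphism. *)
Definition sized (e : E) : Prop := (size e.1.2 < p)%N /\ (size e.2.2 < q)%N.

Lemma polyvecD m h c (f g : {poly R}) : @polyvec R m h c (f + g) = polyvec m h c f + polyvec m h c g.
Proof. by apply/colP => i; rewrite !mxE coefD mulrDl. Qed.

Lemma proj_mul e e' : sized e' -> proj (e * e')%g = (proj e * proj e')%g.
Proof.
move: e e' => [[s f] [t g]] [[s' f'] [t' g']] [/= h1 h2].
rewrite pmulE !fmulE /proj mkM_mul /=; congr mk.
by rewrite mulmxDr lin_part_vecX // lin_part_vecY // /vecX /vecY !polyvecD addrACA addrC.
Qed.

Lemma proj1 : proj 1%g = 1%g.
Proof.
have -> : (1%g : E) = ((0, 0), (0, 0)) by [].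
have v0 m h c : @polyvec R m h c 0 = 0 by apply/colP => i; rewrite !mxE coef0 mul0r.
by rewrite /proj /= /vecX /vecY !v0 addr0 mk1.
Qed.

Lemma sizedM e e' : sized e -> sized e' -> sized (e * e')%g.
Proof.
move: e e' => [[s f] [t g]] [[s' f'] [t' g']] [/= h1 h2] [/= h1' h2'].
by rewrite pmulE !fmulE; split=> /=; apply: size_polyDlt; rewrite ?size_tr.
Qed.

Lemma sizedV e : sized e -> sized (e^-1)%g.
Proof.
by move: e => [[s f] [t g]] [/= h1 h2]; rewrite pinvE !finvE; split=> /=; rewrite size_polyN size_tr.
Qed.

Lemma projV e : sized e -> proj (e^-1)%g = ((proj e)^-1)%g.
Proof.
by move=> h; apply: (mulIg (proj e)); rewrite -proj_mul // !mulVg proj1.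
Qed.

(** [vecX] and [vecY] overlap only in coordinate [p - 2], where the two constant terms are added. *)
Lemma proj_ker e : sized e -> proj e = 1%g <-> antidiag e.
Proof.
move: e => [[s f] [t g]] [/= sf sg]; rewrite -proj1; split=> [|[c [-> -> -> ->]]].
  have -> : (1%g : E) = ((0, 0), (0, 0)) by [].
  move=> /mk_inj[/= -> -> hv].
  have hc (k : 'I_n) := congr1 (fun M : 'cV[R]_n => M k 0) hv.
  have hf i : (0 < i)%N -> f`_i = 0.
    move=> i0; have [si|si] := leqP (size f) i; first exact: nth_default.
    have ip := leq_ltn_trans si sf.
    have lk : (p - 2 - i < n)%N by rewrite /n; nlia.
    have := hc (Ordinal lk); rewrite !mxE /= !coef0 !mul0r addr0.
    have -> : (p - 2 <= p - 2 - i)%N = false by nlia.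
    rewrite leq_subr subKn; last by nlia.
    by rewrite mulr0 addr0 => /eqP; rewrite mulf_eq0 (negbTE (fact_neq0 _ _)) orbF => /eqP.
  have hg i : (0 < i)%N -> g`_i = 0.
    move=> i0; have [si|si] := leqP (size g) i; first exact: nth_default.
    have iq := leq_ltn_trans si sg.
    have lk : (p - 2 + i < n)%N by rewrite /n; nlia.
    have := hc (Ordinal lk); rewrite !mxE /= !coef0 !mul0r addr0.
    have -> : (p - 2 + i <= p - 2)%N = false by nlia.
    rewrite leq_addr addKn mulr0 add0r.
    by move=> /eqP; rewrite mulf_eq0 (negbTE (fact_neq0 _ _)) orbF => /eqP.
  have lk : (p - 2 < n)%N by rewrite /n; nlia.
  have := hc (Ordinal lk); rewrite !mxE /= !coef0 !mul0r addr0 leqnn subnn fact0 !mulr1 => h0.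
  have ef : f = (f`_0)%:P by apply/polyP => -[|i]; rewrite coefC //= hf.
  have eg : g = - (f`_0)%:P.
    apply/polyP => -[|i]; rewrite coefN coefC /=; last by rewrite oppr0 hg.
    by move/eqP: h0; rewrite addrC addr_eq0 => /eqP.
  by exists f`_0; rewrite {1}ef eg.
have -> : (1%g : E) = ((0, 0), (0, 0)) by [].
rewrite /proj /=; congr mk; apply/colP => k; rewrite !mxE !coef0 !mul0r addr0 coefN !coefC.
have [lt|lt|e] := ltngtP k (p - 2)%N.
- by have -> : (p - 2 - k == 0)%N = false by [nlia]; rewrite mul0r mulr0 addr0.
- by have -> : (k - (p - 2) == 0)%N = false by [nlia]; rewrite oppr0 mul0r mulr0 addr0.
- by rewrite e subnn /= fact0 !mulr1 subrr.
Qed.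
End Projection.

(** * From homotopies in E to fillings over a compact generating set *)

Section Transfer.
Variables (R : realType) (p q : nat).
Hypotheses (hp : (2 < p)%N) (hq : (2 < q)%N).
Let n := (p + q - 3)%N.
Local Notation G := (central_product_group R p q).
Local Notation E := (filiform R * filiform R)%type.
Local Notation coords := (coords hp hq).
Local Notation of_coords := (of_coords hp hq).
Local Notation proj := (proj hp hq).

Definition cube (M : R) : set G := of_coords @` [set c : 'rV[R]_(1 + (1 + n)) | forall i, `[- M, M]%classic (c 0 i)].

Lemma compact_cube M : compact (cube M).
Proof.
apply: compact_image; first exact: of_coords_continuous.
by apply: (@rV_compact R _ (fun=> `[- M, M]%classic)) => i; exact: segment_compact.
Qed.

Lemma cube_mk M s t (v : 'cV[R]_n) : `|s| <= M -> `|t| <= M -> (forall k, `|v k 0| <= M) ->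
  cube M (mk hp hq s t v).
Proof.
move=> hs ht hv; exists (row_mx (const_mx s) (row_mx (const_mx t) v^T)); last first.
  by rewrite /of_coords !(row_mxKl, row_mxKr) !mxE trmxK.
move=> i /=; rewrite in_itv /= -ler_norml.
have [j ->|j ->] := split_ordP i; first by rewrite row_mxEl mxE.
have [j' ->|j' ->] := split_ordP j; first by rewrite row_mxEr row_mxEl mxE.
by rewrite !row_mxEr mxE.
Qed.

Lemma compact_sub_cube (B : set G) : compact B -> exists r : nat, B `<=` cube r%:R.
Proof.
move=> cB; have := compact_bounded (compact_image (@coords_continuous R p q hp hq) cB).
move=> [M [_ /(_ (M + 1))]]; rewrite ltrDl ltr01 => /(_ isT) hM.
have [r hr] := nat_above (M + 1); exists r => x Bx; exists (coords x); last exact: coordsK.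
move=> i /=; rewrite in_itv /= -ler_norml; apply: le_trans hr.
have := hM (coords x) (ex_intro2 _ _ x Bx erefl); apply: le_trans.
rewrite [leRHS]/Num.norm /= mx_normrE.
exact: (le_bigmax _ (fun ij => `|coords x ij.1 ij.2|) (ord0, i)).
Qed.

Lemma cube_lift (r : nat) (x : G) : cube r%:R x ->
  exists e : E, [/\ box p r%:R e.1, box q r%:R e.2 & proj e = x].
Proof.
move=> [c hc <-]; have {}hc i : `|c 0 i| <= r%:R by have := hc i; rewrite /= in_itv /= -ler_norml.
pose v : 'cV[R]_n := (rsubmx (rsubmx c))^T; have hv k : `|v k 0| <= r%:R by rewrite !mxE.
pose w k : R := if insub k is Some k' then v k' 0 else 0.
have hw k : `|w k| <= r%:R by rewrite /w; case: insubP => [k' _ _|_]; rewrite ?normr0.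
have hwf k i : `|w k / i`!%:R| <= r%:R.
  apply: le_trans (hw k); rewrite normrM normfV normr_nat ler_pdivrMr ?ltr0n ?fact_gt0 //.
  by rewrite ler_peMr // ler1n fact_gt0.
pose f : {poly R} := \poly_(i < p.-1) (w (p - 2 - i)%N / i`!%:R).
(* The coordinate shared by the two factors is carried by [f], so [g] has no constant term. *)
pose g : {poly R} := \poly_(i < q.-1) (if i is 0 then 0 else w (p - 2 + i)%N / i`!%:R).
exists (((lsubmx c 0 0, f), (lsubmx (rsubmx c) 0 0, g)) : E).
have p0 : (0 < p)%N by apply: leq_trans hp.
have q0 : (0 < q)%N by apply: leq_trans hq.
split.
- split=> /=; first by rewrite mxE.
    by rewrite -[p in (_ < p)%N](prednK p0) ltnS; apply: size_poly.
  by move=> i; rewrite coef_poly; case: ifP => _; rewrite ?normr0.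
- split=> /=; first by rewrite !mxE.
    by rewrite -[q in (_ < q)%N](prednK q0) ltnS; apply: size_poly.
  by move=> i; rewrite coef_poly; case: ifP => _; rewrite ?normr0 //; case: i => [|i]; rewrite ?normr0.
rewrite /proj /of_coords /=; congr mk; apply/colP => k.
have wk : w k = v k 0 by rewrite /w valK.
rewrite -/v -wk !mxE !coef_poly.
have kn := ltn_ord k.
have [lt|gt|eq] := ltngtP (k : nat) (p - 2)%N.
- have -> : (p - 2 - k < p.-1)%N by nlia.
  by rewrite subKn; [rewrite mulr0 addr0 divfK // fact_neq0|exact: ltnW].
- have -> : (k - (p - 2) < q.-1)%N by move: kn gt hp hq; rewrite /n; clear; lia.
  have -> : (k - (p - 2) = (k - (p - 2)).-1.+1)%N by rewrite prednK // subn_gt0.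
  rewrite mulr0 add0r prednK ?subn_gt0 // subnKC; last exact: ltnW.
  by rewrite divfK // fact_neq0.
- rewrite eq subnn mulr1 /= fact0 divr1 subn0.
  have -> : (0 < p.-1)%N by move: hp; clear; lia.
  by case: ifP => _; rewrite mulr1 addr0.
Qed.

Lemma bd_sized C (e : E) : bd p q C e -> sized p q e.
Proof.
move=> [[_ h _ _]|[_ h _ _]] //; rewrite -[e]invgK; exact: sizedV.
Qed.

(** The letters do not form a bounded set in E, but their images do, since [proj] sees only the sum
    of the constant terms. The factorial in [M] bounds the factors in [vecX] and [vecY]. *)
Lemma bd_compact (C : nat) : exists2 B : set G, compact B & forall e, bd p q (C%:R : R) e -> B (proj e).
Proof.
pose M : R := C%:R * (p + q)`!%:R; exists (cube M `|` (fun x : G => (x^-1)%g) @` cube M).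
  apply: compactU; first exact: compact_cube.
  by apply: compact_image; [exact: invg_continuous|exact: compact_cube].
have F1 (i : nat) : (i <= p + q)%N -> 1 <= (i`!%:R : R) <= (p + q)`!%:R.
  by move=> le; rewrite ler1n fact_gt0 ler_nat leq_fact.
have /andP[f1 _] := F1 _ (leqnn _).
have CM : C%:R <= M by rewrite ler_peMr.
have H e : bd0 p q (C%:R : R) e -> cube M (proj e).
  move=> [[h1 h2] _ [h3 h4] h5]; apply: cube_mk; [exact: le_trans CM|exact: le_trans CM|].
  have B (h : {poly R}) i : wb 1 C%:R h -> (0 < i)%N -> (i <= p + q)%N -> `|h`_i * i`!%:R| <= M.
    move=> hw i0 /F1/andP[_ le]; rewrite normrM normr_nat; apply: ler_pM => //.
    by have := hw i i0; rewrite expr1n mulr1.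
  move=> k; rewrite !mxE; have kn := ltn_ord k.
  have [lt|gt|eq] := ltngtP (k : nat) (p - 2)%N.
  - by rewrite mulr0 addr0; apply: B => //; rewrite ?subn_gt0 //; move: kn; clear; lia.
  - by rewrite mulr0 add0r; apply: B => //; rewrite ?subn_gt0 //; move: kn hp hq; rewrite /n; clear; lia.
  - by rewrite eq subnn fact0 !mulr1; apply: le_trans CM.
move=> e he; case: (he) => [h|h]; first by left; apply: H.
right; exists (proj (e^-1)%g); first exact: H.
by rewrite projV ?invgK //; exact: bd_sized he.
Qed.

Lemma cube_generating : compact_generating (cube 1).
Proof.
split=> [|x]; first exact: compact_cube.
have [s [t [v ->]]] := mk_surj hp hq x.
have [M hM] := compact_sub_cube (@compact_set1 _ (mk hp hq s t v)).
have [c hc ec] := hM _ erefl; pose N := M.+1.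
have N0 : N%:R != 0 :> R by rewrite pnatr_eq0.
have h1 (y : R) : `|y| <= M%:R -> `|y / N%:R| <= 1.
  move=> hy; rewrite normrM normfV normr_nat ler_pdivrMr ?ltr0n // mul1r.
  by apply: le_trans hy _; rewrite ler_nat.
have {}hc i : `|c 0 i| <= M%:R by have := hc i; rewrite /= in_itv /= -ler_norml.
have [es et ev] := mk_inj ec.
pose x1 := mk hp hq 0 0 (N%:R^-1 *: v); pose x2 := mk hp hq (s / N%:R) (t / N%:R) 0.
have v0 : forall k, `|(0 : 'cV[R]_n) k 0| <= 1 by move=> k; rewrite mxE normr0.
have hx1 : cube 1 x1.
  apply: cube_mk; rewrite ?normr0 // => k; rewrite mxE mulrC; apply: h1.
  by rewrite -ev !mxE.
have hx2 : cube 1 x2 by apply: cube_mk => //; apply: h1; rewrite -?es -?et !mxE.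
have X1 i : (x1 ^+ i)%g = mk hp hq 0 0 ((N%:R^-1 *: v) *+ i).
  elim: i => [|i IH]; first by rewrite mk1.
  by rewrite expgS IH mkM_mul lin_part0 mul1mx !addr0 -mulrSr.
have X2 i : (x2 ^+ i)%g = mk hp hq ((s / N%:R) *+ i) ((t / N%:R) *+ i) 0.
  elim: i => [|i IH]; first by rewrite mk1.
  by rewrite expgS IH mkM_mul mulmx0 addr0 -!mulrS.
have wn i (y : G) : word_val (nseq i (y, true)) = (y ^+ i)%g.
  elim: i => [|i IH]; first by rewrite /word_val big_nil.
  by rewrite /word_val /= big_cons -/(word_val _) IH expgS.
have wo i (y : G) : cube 1 y -> word_over (cube 1) (nseq i (y, true)).
  by move=> hy; elim: i => // i IH l; rewrite inE => /predU1P[->|/IH].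
clearbody x1 x2.
exists (nseq N (x1, true) ++ nseq N (x2, true)).
  by apply: word_over_cat; apply: wo.
have sN (y : R) : (y / N%:R) *+ N = y by rewrite -[LHS]mulr_natr divfK.
by rewrite word_val_cat !wn X1 X2 mkM_mul mulmx0 !add0r !sN -scaler_nat scalerA mulfV // scale1r.
Qed.

Lemma proj_word (w : seq E) : wover (sized p q) w ->
  (\prod_(e <- w) proj e)%g = proj (wval w) /\ sized p q (wval w).
Proof.
elim: w => [_|e w IH h].
  by rewrite big_nil wval_nil proj1; split=> //; split; rewrite size_poly0; apply: leq_trans _ (ltnW _); [|exact: hp| |exact: hq].
have [|e1 e2] := IH; first by move=> x hx; apply: h; rewrite inE hx orbT.
have he := h e (mem_head _ _).
by rewrite big_cons wval_cons e1 proj_mul //; split=> //; apply: sizedM.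
Qed.

Hypothesis fill : fillable R p q p q.

(** The constant [K] depends on [S] alone, so the relators may be chosen after it, as the existence
    of a suitable presentation requires. *)
Lemma transfer (S : set G) : compact_generating S -> exists K : nat,
  forall (Rel : set (word G)) (a0 d0 : nat),
    (forall w, word_over S w -> word_val w = 1%g -> (size w <= 4 * K)%N ->
       filled_by S Rel a0 (d0%:R : R) w) ->
  exists C : nat, forall w, word_over S w -> word_val w = 1%g ->
    filled_by S Rel (C * size w ^ (p - 1)) ((C * size w)%:R : R) w.
Proof.
move=> genS; have [cS _] := genS.
have cS' : compact (S `|` (fun x : G => (x^-1)%g) @` S).
  by apply: compactU => //; apply: compact_image => //; exact: invg_continuous.
have [r hr] := compact_sub_cube cS'.
have [Cf hf] := fill r; pose C := (Cf + (r + r))%N; pose SE := bd p q (C%:R : R).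
have [B cB hB] := bd_compact C.
have [K hK] := compact_ball (@coords_continuous R p q hp hq) (@of_coords_continuous R p q hp hq)
  (@coordsK R p q hp hq) (@of_coordsK R p q hp hq) genS cB.
have [tau htau] : exists tau : E -> word G, forall e, SE e ->
    [/\ word_over S (tau e), word_val (tau e) = proj e & (size (tau e) <= K.+1)%N].
  have H e : exists w : word G, SE e -> [/\ word_over S w, word_val w = proj e & (size w <= K.+1)%N].
    have [he|he] := pselect (SE e); last by exists [::].
    have [w [h1 h2 h3]] := hK _ (hB _ he); exists w => _; split=> //.
    by apply: ltnW; rewrite ltnS -(ler_nat R).
  by have [tau h] := choice H; exists tau.
have [lift hlift] : exists lift : G * bool -> E, forall l, S l.1 ->
    [/\ box p r%:R (lift l).1, box q r%:R (lift l).2 & proj (lift l) = letter_val l].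
  have H (l : G * bool) : exists e : E, S l.1 -> [/\ box p r%:R e.1, box q r%:R e.2 & proj e = letter_val l].
    have [hl|hl] := pselect (S l.1); last by exists 1%g.
    have [|e he] := @cube_lift r (letter_val l); last by exists e.
    by apply: hr; rewrite /letter_val; case: ifP => _; [left|right; exists l.1].
  by have [lift h] := choice H; exists lift.
exists K.+1 => Rel a0 d0 hnull.
have piA w w' : wover SE w -> wover SE w' -> eqA (antidiags R) (wval w) (wval w') ->
    word_val (flatten (map tau w)) = word_val (flatten (map tau w')).
  move=> hw hw' hA.
  have tw (u : seq E) : wover SE u -> word_val (flatten (map tau u)) = (\prod_(e <- u) proj e)%g.
    elim: u => [|e u IH] hu; first by rewrite /word_val !big_nil.
    rewrite /= word_val_cat big_cons IH; last by move=> x hx; apply: hu; rewrite inE hx orbT.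
    by have [_ -> _] := htau e (hu e (mem_head _ _)).
  have sz (u : seq E) : wover SE u -> wover (sized p q) u by move=> hu x /hu /bd_sized.
  have [e1 s1] := proj_word (sz _ hw); have [e2 s2] := proj_word (sz _ hw').
  rewrite !tw // e1 e2; apply/esym/(mulgI (proj (wval w))^-1)%g.
  rewrite mulVg -projV // -proj_mul //; apply/(@proj_ker R p q hp hq) => //.
  by apply: sizedM => //; apply: sizedV.
have liftSE l : S l.1 -> SE (lift l) /\ proj (lift l) = letter_val l.
  move=> /hlift[b1 b2 ->]; split=> //; apply: (@bdn_le _ _ _ (r + r)); first exact: leq_addl.
  by rewrite natrD; case: (lift l) b1 b2 => a b; apply: bd_box.
pose C1 := (a0 + Cf * a0 + d0 + 2 * ((Cf + 2) * K.+1))%N; exists C1 => w hw w1.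
have [n0|n0] := posnP (size w).
  by move/eqP: n0; rewrite size_eq0 => /eqP ->; exact: filled_nil.
have h := hf (size w) (map lift w) n0 _ _ _; rewrite size_map in h.
have {h}ch : cheap p q Cf (size w) (size w ^ (p - 1)) (map lift w) [::].
  apply: h => // [e /mapP[l /hw /hlift[h1 h2 _] ->] //|].
  have ol : wover SE (map lift w) by move=> e /mapP[l /hw /liftSE[hl _] ->].
  have sl : wover (sized p q) (map lift w) by move=> e /ol /bd_sized.
  have [e1 s1] := proj_word sl; apply/(@proj_ker R p q hp hq) => //.
  rewrite -e1 big_map; apply: etrans w1; rewrite /word_val big_seq [RHS]big_seq.
  by apply: eq_bigr => l /hw /hlift[].
have ch' : htpy (antidiags R) SE (Cf * size w) (Cf * size w ^ (p - 1)) (map lift w) [::].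
  by apply: htpy_sub ch => // e; apply: bdn_le; exact: leq_addr.
have ol := lift_over liftSE hw.
have F := htpy_filled htau piA hnull ch' ol.
have nn : (size w <= size w ^ (p - 1))%N.
  by rewrite -{1}(expn1 (size w)) leq_pexp2l // subn_gt0 ltnW.
pose D := (d0 + 2 * ((Cf * size w) * K.+1 + K.+1 + size w * K.+1))%N.
have F' : filled_by S Rel (Cf * size w ^ (p - 1) * a0) (D%:R : R) (flatten (map tau (map lift w))).
  by apply: filled_le F => //; rewrite -!natrD ler_nat /D; lia.
have := lift_filled (isT : (0 < K.+1)%N) htau hnull liftSE hw _ F'.
have hD : d0%:R + ((size w * K.+1)%:R + (size w * K.+1)%:R) <= D%:R :> R.
  by rewrite -!natrD ler_nat /D; lia.
move=> /(_ hD); apply: filled_le.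
  rewrite /C1 !mulnDl -!addnA; apply: leq_add; first by rewrite mulnC leq_mul2l nn orbT.
  by apply: leq_trans (leq_addr _ _); rewrite mulnAC.
rewrite ler_nat /D /C1; move: n0; clear; move: (size w) => m m0.
have h1 : (d0 <= d0 * m)%N by rewrite leq_pmulr.
have h2 : (K.+1 <= K.+1 * m)%N by rewrite leq_pmulr.
by nia.
Qed.
End Transfer.

Lemma bigO_nat (R : realType) (C : nat) (f : nat -> nat) :
  (fun n : nat => (C * f n)%:R : R) =O_\oo (fun n : nat => (f n)%:R : R).
Proof.
apply/eqOP; exists (C%:R : R); split=> // k hk; near=> n.
by rewrite !normr_nat natrM ler_wpM2r // ltW.
Unshelve. all: by end_near.
Qed.

Lemma admits_of_fillable (R : realType) (p q : nat) : (2 < p)%N -> (2 < q)%N -> fillable R p q p q ->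
  admits_filling_pair (central_product_group R p q) (fun x : R => x ^+ (p - 1)) (fun x : R => x).
Proof.
move=> hp hq fill.
split.
  have gen := cube_generating R hp hq; set S := cube _ _ _ in gen.
  have [K hK] := transfer hp hq fill gen.
  (* With these relators every null-homotopic word of length at most [4 * K] has area 1 and an empty
     conjugator. *)
  pose Rel : set (word (central_product_group R p q)) :=
    [set w | [/\ word_over S w, word_val w = 1%g & (size w <= 4 * K)%N]].
  have [w h1 h2 h3|C hC] := hK Rel 1%N 0%N.
    exists [:: ([::], w)]; split=> //.
      split=> [ur|]; last by rewrite /= !cats0; exact: free_eq_refl.
      by rewrite inE => /eqP -> /=; split=> //; left.
    by move=> ur; rewrite inE => /eqP ->; apply: (@diameter_word R _ S [::]).
  exists S, Rel; split.
    split=> //.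
    - by move=> r [].
    - by exists (4 * K)%N => r [].
    - move=> w hw; split=> [w1|[fl hfl]].
        by have [fl [hfl _ _]] := hC w hw w1; exists fl.
      by apply: filling_val hfl => r [].
  exists (fun n : nat => (C * n ^ (p - 1))%:R : R), (fun n : nat => (C * n)%:R : R) => w hw w1.
  by have [fl [h1 h2 h3]] := hC w hw w1; exists fl; split=> //; rewrite ler_nat.
move=> S Rel [gen _ _ _] [area [diam hfin]].
have [K hK] := transfer hp hq fill gen.
(* Only finitely many lengths are at most [4 * K], so the sum of the absolute values bounds the
   given area function on all of them. *)
have [a0 ha] := nat_above (\sum_(i < (4 * K).+1) `|area i|).
have [d0 hd] := nat_above (\sum_(i < (4 * K).+1) `|diam i|).
have le_sum (F : nat -> R) i : (i <= 4 * K)%N -> F i <= \sum_(i < (4 * K).+1) `|F i|.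
  move=> le; rewrite (bigD1 (Ordinal (le : (i < (4 * K).+1)%N))) //=.
  by apply: le_trans (ler_norm _) _; rewrite lerDl sumr_ge0.
have [w h1 h2 h3|C hC] := hK Rel a0 d0.
  have [fl [g1 g2 g3]] := hfin w h1 h2; exists fl; split=> //.
    by rewrite -(ler_nat R); apply: le_trans g2 (le_trans (le_sum area _ h3) ha).
  by move=> ur /g3; apply: diameter_le; apply: le_trans (le_sum diam _ h3) hd.
exists (fun n : nat => (C * n ^ (p - 1))%:R : R), (fun n : nat => (C * n)%:R : R); split.
- have -> : (fun n : nat => n%:R ^+ (p - 1)) = (fun n : nat => (n ^ (p - 1))%:R : R).
    by apply/funext => m; rewrite natrX.
  exact: bigO_nat.
- exact: bigO_nat.
- move=> w hw w1; have [fl [h1 h2 h3]] := hC w hw w1.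
  by exists fl; split=> //; rewrite ler_nat.
Qed.

Theorem theorem6p1 (R : realType) (p : nat) (hp : (4 <= p)%N) :
  admits_filling_pair (central_product_group R p p)
    (fun x : R => x ^+ (p - 1)) (fun x : R => x) /\
  admits_filling_pair (central_product_group R p (p - 1))
    (fun x : R => x ^+ (p - 1)) (fun x : R => x).
Proof.
by split; apply: admits_of_fillable; try lia; apply: fillable_top; lia.
Qed.
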